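(* Let $P=\lambda_0M_0+\sum_{i=1}^t\lambda_iM_i$ be a quasi-identity of $M_n$, where $M_0,\dots,M_t$ are noncommutative monomials in the $x_k$ and $\lambda_0,\dots,\lambda_t\in\mathcal C$. If $M_1,\dots,M_t$ are $M_n$-locally linearly independent, then $P$ is a consequence of the Cayley–Hamilton identity, i.e. $P\in(Q_n)$.
   Context: $F$ is a field of characteristic $0$, $n\ge1$, $M_n=M_n(F)$, $\mathcal C=F[x^{(k)}_{ij}:1\le i,j\le n,\ k\ge1]$, $X=\{x_1,x_2,\dots\}$ noncommuting; $\mathcal C\langle X\rangle$ is the free $\mathcal C$-algebra (quasi-polynomials). A quasi-identity vanishes when each $x_k$ is replaced by any $A_k=(a^{(k)}_{ij})\in M_n$ and each $x^{(k)}_{ij}$ by $a^{(k)}_{ij}$. $M_1,\dots,M_t$ are $M_n$-locally linearly independent if there exist matrices at which their values are linearly independent. Generic matrices $\xi_k=(x^{(k)}_{ij})\in M_n(\mathcal C)$; $\mathrm{tr}(x_{i_1}\cdots x_{i_r}):=\mathrm{tr}(\xi_{i_1}\cdots\xi_{i_r})\in\mathcal C$. $Q_n=\sum_{\sigma\in S_{n+1}}\epsilon_\sigma\phi_\sigma(x_1,\dots,x_n)$, where for $\sigma=(i_1,\dots,i_{k_1})\cdots(u_1,\dots,u_h)(s_1,\dots,s_k,n+1)$ (disjoint cycles, the one containing $n+1$ last) $\phi_\sigma=\mathrm{tr}(x_{i_1}\cdots x_{i_{k_1}})\cdots\mathrm{tr}(x_{u_1}\cdots x_{u_h})x_{s_1}\cdots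 x_{s_k}$. A T-ideal is an ideal of $\mathcal C\langle X\rangle$ closed under simultaneous substitutions $x_k\mapsto H_k$, $x^{(k)}_{ij}\mapsto\Phi(H_k)_{ij}$, with $\Phi$ the $\mathcal C$-algebra map $x_k\mapsto\xi_k$; $(Q_n)$ is the T-ideal generated by $Q_n$. *)

(* Defs.v *)
From HB Require Import structures.
From mathcomp Require Import all_boot all_order all_algebra all_fingroup.
Set Implicit Arguments. Unset Strict Implicit. Unset Printing Implicit Defensive.
Import GRing.Theory.
Local Open Scope ring_scope.

(* Convention: the variable index k : nat stands for x_{k+1}
   (resp. the commutative variable (k,i,j) for x^{(k+1)}_{ij}). *)

Section QuasiPoly.
Variables (F : fieldType) (n : nat).

Definition cvar := (nat * 'I_n * 'I_n)%type.
(* commutative monomial: a multiset of commutative variables (order irrelevant) *)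
Definition cmono := seq cvar.
Definition word := seq nat.
Definition qterm := (F * cmono * word)%type.
(* a quasi-polynomial, as a finite formal sum of terms *)
Definition quasipoly := seq qterm.

(* coefficient of the basis element (m, w) of C<X> over F *)
Definition qcoef (P : quasipoly) (m : cmono) (w : word) : F :=
  \sum_(t <- P | perm_eq t.1.2 m && (t.2 == w)) t.1.1.
Definition qeq (P Q : quasipoly) : Prop := forall m w, qcoef P m w = qcoef Q m w.

Definition qzero : quasipoly := [::].
Definition qconst (c : F) : quasipoly := [:: (c, [::], [::])].
Definition qone : quasipoly := qconst 1.
Definition qadd (P Q : quasipoly) : quasipoly := P ++ Q.
Definition qscale (c : F) (P : quasipoly) : quasipoly :=
  [seq (c * t.1.1, t.1.2, t.2) | t <- P].
Definition qmul (P Q : quasipoly) : quasipoly :=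
  [seq (s.1.1 * t.1.1, s.1.2 ++ t.1.2, s.2 ++ t.2) | s <- P, t <- Q].
Definition qword (w : word) : quasipoly := [:: (1, [::], w)].
Definition qsum (s : seq quasipoly) : quasipoly := foldr qadd qzero s.
Definition qprod (s : seq quasipoly) : quasipoly := foldr qmul qone s.

(* elements of C (inside C<X>): no noncommutative part *)
Definition is_coef (P : quasipoly) : bool := all (fun t => t.2 == [::]) P.

(* (i,j) entry of the product of generic matrices xi_{k1} ... xi_{kr},
   as a list of commutative monomials (summed) *)
Fixpoint gword (w : word) (i j : 'I_n) : seq cmono :=
  match w with
  | [::] => if i == j then [:: [::]] else [::]
  | k :: w' => flatten [seq [seq (k, i, l) :: m | m <- gword w' l j] | l <- enum 'I_n]
  end.

(* Phi(P)_{ij} in C, where Phi is the C-algebra map x_k |-> xi_k *)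
Definition qPhi (P : quasipoly) (i j : 'I_n) : quasipoly :=
  flatten [seq [seq (t.1.1, t.1.2 ++ m, [::]) | m <- gword t.2 i j] | t <- P].

Definition qtr (w : word) : quasipoly := qsum [seq qPhi (qword w) i i | i <- enum 'I_n].

Definition qsubst (H : nat -> quasipoly) (P : quasipoly) : quasipoly :=
  qsum [seq qscale t.1.1
          (qmul (qprod [seq qPhi (H v.1.1) v.1.2 v.2 | v <- t.1.2])
                (qprod [seq H k | k <- t.2])) | t <- P].

Definition wordval (A : nat -> 'M[F]_n) (w : word) : 'M[F]_n :=
  foldr (fun k M => A k *m M) 1%:M w.

Definition qeval (A : nat -> 'M[F]_n) (P : quasipoly) : 'M[F]_n :=
  \sum_(t <- P) (t.1.1 * \prod_(v <- t.1.2) A v.1.1 v.1.2 v.2) *: wordval A t.2.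

Definition quasi_identity (P : quasipoly) : Prop := forall A, qeval A P = 0.

Definition locally_lin_indep (t : nat) (Ms : 'I_t -> word) : Prop :=
  exists A : nat -> 'M[F]_n,
    forall c : 'I_t -> F, \sum_(i < t) c i *: wordval A (Ms i) = 0 -> forall i, c i = 0.

(* The Cayley-Hamilton quasi-polynomial Q_n.  Points of 'I_n.+1 below
   n (= ord_max) stand for x_1, ..., x_n (via the shift convention);
   ord_max plays the role of n+1. *)
Definition cycle_word (s : 'S_n.+1) (x : 'I_n.+1) : word :=
  [seq nat_of_ord y | y <- traject s x #|porbit s x|].

Definition phi_perm (s : 'S_n.+1) : quasipoly :=
  qmul (\big[qmul/qone]_(O in porbits s | ord_max \notin O)
           qtr (cycle_word s (odflt ord_max [pick x in O])))
       (qword [seq nat_of_ord y | y <- traject s (s ord_max) #|porbit s ord_max|.-1]).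

Definition Qn : quasipoly :=
  qsum [seq qscale ((-1) ^+ odd_perm s) (phi_perm s) | s <- enum 'S_n.+1].

Inductive in_TQn : quasipoly -> Prop :=
| TQ_gen : in_TQn Qn
| TQ_zero : in_TQn qzero
| TQ_add P Q : in_TQn P -> in_TQn Q -> in_TQn (qadd P Q)
| TQ_mul A P B : in_TQn P -> in_TQn (qmul (qmul A P) B)
| TQ_subst (H : nat -> quasipoly) P : in_TQn P -> in_TQn (qsubst H P)
| TQ_eq P Q : in_TQn P -> qeq P Q -> in_TQn Q.

End QuasiPoly.

(* Main.v *)
(** The coefficients of the relations between the values of M_0, .., M_t form a
    module over the polynomial ring C, which has rank one by the local linear
    independence of M_1, .., M_t.  As C is factorial, it is free on a generator mu,
    and lam = h mu.  Conjugation by g in GL_n preserves the module, hence multiplies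
    mu by a unit of C, that is, by a scalar chi(g); the relations of the group force
    chi = 1 on transvections and on the matrices diag(1, .., s^n, .., 1), which is
    enough to make the mu_i invariants.  By Schur-Weyl duality they are polynomials
    in traces of words, so sum_i mu_i tr(M_i x) is a trace identity.  Polarization
    turns it into an element of F[S_m] acting by 0 on tensors of degree m.  Modulo
    the antisymmetrizers of n+1 points every permutation is a combination of
    permutations without decreasing subsequence of length n+1, and these act
    independently.  Contracted against words, an antisymmetrizer of n+1 points gives
    a multiple of an instance v Q_n(H_1, .., H_n) u of Q_n, or an expression with a
    factor that vanishes because it antisymmetrizes n+1 indices in dimension n. *)

Require Import Defs.
From HB Require Import structures.
From mathcomp Require Import all_boot all_order all_algebra all_fingroup.
From mathcomp Require Import fraction generic_quotient zify ring mxrepresentation.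
Set Implicit Arguments. Unset Strict Implicit. Unset Printing Implicit Defensive.
Import Order.TTheory GRing.Theory.
Local Open Scope ring_scope.

Section FiniteSums.

Lemma ffun_neqP (I : finType) (T : eqType) (f g : {ffun I -> T}) :
  reflect (exists i, f i != g i) (f != g).
Proof.
apply: (iffP idP) => [ne|[i]]; last by apply: contraNneq => ->.
apply/existsP; apply: contraNT ne; rewrite negb_exists => /forallP eq_fg.
by apply/eqP/ffunP => i; apply/eqP; rewrite -[_ == _]negbK eq_fg.
Qed.

Lemma sum_eq_mul (R : pzSemiRingType) (I : finType) (i0 : I) (G : I -> R) :
  \sum_i (i == i0)%:R * G i = G i0.
Proof.
rewrite (bigD1 i0) //= eqxx mul1r big1 ?addr0 // => i /negPf->.
by rewrite mul0r.
Qed.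

Lemma prodr_eq_nat (R : comPzSemiRingType) (I : finType) (T : eqType)
    (f g : {ffun I -> T}) : \prod_i (f i == g i)%:R = (f == g)%:R :> R.
Proof.
case: eqVneq => [->|/ffun_neqP[i /negPf ni]]; first by rewrite big1 // => i _; rewrite eqxx.
by rewrite (bigD1 i) //= ni mul0r.
Qed.

Lemma sum_perm_const (R : pzSemiRingType) m (x : R) : \sum_(s : 'S_m) x = (m`!)%:R * x.
Proof. by rewrite sumr_const mulr_natl -(card_Sn m). Qed.

Variables (I T : finType).

Definition permf (f : {ffun I -> T}) (t : {perm I}) : {ffun I -> T} := [ffun i => f (t i)].

Lemma permfE f t i : permf f t i = f (t i).
Proof. exact: ffunE. Qed.

Lemma permfM f s t : permf f (s * t) = permf (permf f t) s.
Proof. by apply/ffunP => i; rewrite !ffunE permM. Qed.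

Lemma permf1 f : permf f 1 = f.
Proof. by apply/ffunP => i; rewrite ffunE perm1. Qed.

Lemma permf_bij t : bijective (permf^~ t).
Proof. by exists (permf^~ t^-1%g) => f; rewrite -permfM ?mulgV ?mulVg permf1. Qed.

End FiniteSums.

Section CharacteristicZero.
Variable F : fieldType.
Hypothesis charF0 : has_pchar0 F.

Lemma natr_neq0_pchar0 k : (0 < k)%N -> k%:R != 0 :> F.
Proof. by move/pcharf0P: charF0 => ->; rewrite lt0n. Qed.

Lemma natr_inj_pchar0 : injective (fun k : nat => k%:R : F).
Proof.
move=> i j; wlog le_ij : i j / (i <= j)%N.
  by move=> wlog_le; case/orP: (leq_total i j) => h e; [|symmetry]; apply: wlog_le.
move/esym/eqP; rewrite -subr_eq0 -natrB //.
by move/pcharf0P: charF0 => -> /eqP; lia.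
Qed.

Lemma poly_nonroot (p : {poly F}) (f : nat -> F) :
  injective f -> p != 0 -> exists k, p.[f k] != 0.
Proof.
move=> injf nz; have := max_poly_roots (rs := [seq f k | k <- iota 0 (size p)]) nz.
rewrite size_map size_iota ltnn map_inj_uniq ?iota_uniq // => roots.
have /allPn[_ /mapP[k _ ->] nroot] : ~~ all (root p) [seq f k | k <- iota 0 (size p)].
  by apply/negP => /roots/(_ isT).
by exists k.
Qed.

Lemma poly_eq0_inj_roots (p : {poly F}) (f : nat -> F) :
  injective f -> (forall k, p.[f k] = 0) -> p = 0.
Proof.
move=> injf p0; apply/eqP; apply: contraT => /(poly_nonroot injf)[k].
by rewrite p0 eqxx.
Qed.

Lemma horner_inj_pchar0 (p q : {poly F}) : (forall s, p.[s] = q.[s]) -> p = q.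
Proof.
move=> eq_pq; apply/subr0_eq/(poly_eq0_inj_roots natr_inj_pchar0) => k.
by rewrite hornerD hornerN eq_pq subrr.
Qed.

End CharacteristicZero.

(** * Polynomials as lists of terms *)

Section TermLists.
Variables (F : fieldType) (V : eqType).
Implicit Types (x : V -> F) (L : seq (F * seq V)) (m : seq V).

Definition term_eval x L : F := \sum_(t <- L) t.1 * \prod_(v <- t.2) x v.

Lemma eq_term_eval x y L : x =1 y -> term_eval x L = term_eval y L.
Proof. by move=> eq_xy; apply: eq_bigr => t _; under eq_bigr do rewrite eq_xy. Qed.

Lemma term_eval_cat x L L' : term_eval x (L ++ L') = term_eval x L + term_eval x L'.
Proof. exact: big_cat. Qed.

Lemma term_evalN x L : term_eval x [seq (- t.1, t.2) | t <- L] = - term_eval x L.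
Proof. by rewrite /term_eval big_map -sumrN; apply: eq_bigr => t _; rewrite mulNr. Qed.

Lemma perm_eq_count_filterC1 v (m m' : seq V) : perm_eq m m' =
  (count_mem v m == count_mem v m') && perm_eq (filter (predC1 v) m) (filter (predC1 v) m').
Proof.
apply/idP/andP => [pe|[/eqP eq_v pe]]; first by rewrite (seq.permP pe) perm_filter.
apply/allP => u _ /=; apply/eqP; case: (eqVneq u v) => [->//|nuv].
have count_u s : count_mem u (filter (predC1 v) s) = count_mem u s.
  by rewrite count_filter; apply: eq_count => w /=; case: eqP => //= ->.
by rewrite -count_u -[RHS]count_u; apply/seq.permP.
Qed.

Hypothesis charF0 : has_pchar0 F.

(* Compare the coefficients of [s ^ k] in the value of [L] at the point where [v] is [s]. *)
Lemma term_eval_coef_eq0 L v k : (forall x, term_eval x L = 0) -> forall x,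
  term_eval x [seq (t.1, filter (predC1 v) t.2) | t <- L & count_mem v t.2 == k] = 0.
Proof.
move=> L0 x; pose p : {poly F} := \sum_(t <- L)
  (t.1 * \prod_(u <- t.2 | u != v) x u)%:P * 'X^(count_mem v t.2).
have p0 : p = 0.
  apply: horner_inj_pchar0 => // s; rewrite horner0 /p horner_sum.
  rewrite -[RHS](L0 (fun u => if u == v then s else x u)).
  apply: eq_bigr => t _; rewrite hornerM hornerC hornerXn -mulrA; congr (_ * _).
  rewrite [RHS](bigID (pred1 v)) /= mulrC; congr (_ * _).
    rewrite (eq_bigr (fun=> s)) => [|u /eqP->]; last by rewrite eqxx.
    by rewrite big_const_seq iter_mulr mulr1.
  by apply: eq_bigr => u /negPf->.
have := congr1 (fun q : {poly F} => q`_k) p0; rewrite coef0 => <-.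
rewrite /p coef_sum /term_eval big_map big_filter big_mkcond /=.
apply: eq_bigr => t _; rewrite coefCM coefXn eq_sym big_filter.
by case: eqP => _; rewrite ?mulr1 ?mulr0.
Qed.

Theorem coef_eq0_term_eval L :
  (forall x, term_eval x L = 0) -> forall m, \sum_(t <- L | perm_eq t.2 m) t.1 = 0.
Proof.
have [vs] : exists vs : seq V, forall t, t \in L -> {subset t.2 <= vs}.
  exists (flatten [seq t.2 | t <- L]) => t tL v vt.
  by apply/flatten_mapP; exists t.
elim: vs L => [|v vs IH] L Lvs L0 m.
  have monomial_nil t : t \in L -> t.2 = [::].
    by move=> /Lvs; case: t.2 => // v s /(_ v (mem_head _ _)).
  rewrite [LHS] big_seq_cond; case: m => [|v m]; last first.
    by rewrite big1 // => t /andP[/monomial_nil-> /perm_size].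
  rewrite -[RHS](L0 (fun=> 0)) [RHS]big_seq; apply: eq_big => [t|t /andP[/monomial_nil-> _]].
    by apply/andb_idr => /monomial_nil->.
  by rewrite big_nil mulr1.
under eq_bigl do rewrite (perm_eq_count_filterC1 v).
rewrite -big_filter_cond; set L' := filter _ L.
have := IH [seq (t.1, filter (predC1 v) t.2) | t <- L'] _ _ (filter (predC1 v) m).
rewrite big_map; apply; last exact: term_eval_coef_eq0.
move=> _ /mapP[t + ->] u; rewrite mem_filter => /andP[_ tL].
by rewrite mem_filter /= => /andP[nuv /(Lvs _ tL)]; rewrite inE (negPf nuv).
Qed.

End TermLists.

Lemma term_eval_map (F : fieldType) (V W : eqType) (h : V -> W) (x : W -> F) L :
  term_eval x [seq (t.1, map h t.2) | t <- L] = term_eval (x \o h) L.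
Proof. by rewrite /term_eval big_map; apply: eq_bigr => t _; rewrite big_map. Qed.

(** * Forms *)

Lemma sum_perm_multilinear_eq0 (F : fieldType) (m : nat) (G : {ffun 'I_m -> 'I_m} -> F) :
    has_pchar0 F -> (forall s : 'I_m -> F, \sum_f G f * \prod_j s (f j) = 0) ->
  \sum_(t : 'S_m) G [ffun j => t j] = 0.
Proof.
move=> charF0 G0; pose codomf (f : {ffun 'I_m -> 'I_m}) := [seq f j | j <- enum 'I_m].
pose L := [seq (G f, codomf f) | f <- enum {ffun 'I_m -> 'I_m}].
have L0 x : term_eval x L = 0.
  rewrite /term_eval big_map big_enum -[RHS](G0 x); apply: eq_bigr => f _ /=.
  by rewrite big_map big_enum.
rewrite -[RHS](coef_eq0_term_eval charF0 L0 (enum 'I_m)) big_map big_enum_cond /=.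
have perm_codom (f : {ffun 'I_m -> 'I_m}) : perm_eq (codomf f) (enum 'I_m) -> injectiveb f.
  by move=> /perm_uniq; rewrite enum_uniq.
rewrite [RHS](reindex_onto (fun t : 'S_m => [ffun j => t j])
  (fun f => insubd (1%g : 'S_m) f)) /=; last first.
  move=> f /perm_codom inj_f; apply/ffunP => j.
  by rewrite ffunE -pvalE insubdK.
apply: eq_bigl => t; symmetry; apply/andP; split.
  apply: uniq_perm; rewrite ?enum_uniq //.
    rewrite map_inj_in_uniq ?enum_uniq // => i j _ _; rewrite !ffunE; exact: perm_inj.
  move=> i; rewrite mem_enum; apply/mapP; exists (t^-1%g i); rewrite ?mem_enum //.
  by rewrite ffunE permKV.
apply/eqP/permP => j; rewrite -pvalE insubdK ?ffunE // unfold_in.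
by apply/injectiveP => a b; rewrite !ffunE; exact: perm_inj.
Qed.

Section Forms.
Variables (F : fieldType) (V : finType) (d : nat).
Implicit Types (T : {ffun 'I_d -> V} -> F) (x : V -> F) (f g : {ffun 'I_d -> V}).

Definition form T x : F := \sum_f T f * \prod_j x (f j).

Definition symmetrize T f : F := \sum_(t : 'S_d) T (permf f t).

Lemma eq_form T x y : x =1 y -> form T x = form T y.
Proof. by move=> eq_xy; apply: eq_bigr => f _; under eq_bigr do rewrite eq_xy. Qed.

Lemma form_symmetrize T x : form (symmetrize T) x = (d`!)%:R * form T x.
Proof.
rewrite -sum_perm_const /form; under eq_bigr do rewrite mulr_suml.
rewrite exchange_big; apply: eq_bigr => t _ /=.
rewrite [RHS](reindex _ (onW_bij _ (permf_bij V t))); apply: eq_bigr => f _ /=.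
congr (_ * _); rewrite (reindex_inj (@perm_inj _ t)).
by apply: eq_bigr => j _; rewrite ffunE.
Qed.

Lemma formZ T c x : form T (fun v => c * x v) = c ^+ d * form T x.
Proof.
rewrite /form mulr_sumr; apply: eq_bigr => f _.
by rewrite big_split prodr_const card_ord mulrCA.
Qed.

Lemma formB T T' x : form (fun f => T f - T' f) x = form T x - form T' x.
Proof. by rewrite /form -sumrB; apply: eq_bigr => f _; rewrite mulrBl. Qed.

(* Polarization: evaluate at [x v = \sum_(i | f i = v) s i] and extract the
   coefficient of [\prod_i s i]. *)
Theorem symmetrize_eq0 T : has_pchar0 F -> (forall x, form T x = 0) -> symmetrize T =1 fun=> 0.
Proof.
move=> charF0 T0 f; rewrite -[RHS](sum_perm_multilinear_eq0
  (G := fun e : {ffun 'I_d -> 'I_d} => T [ffun j => f (e j)]) charF0) => [|s].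
  by apply: eq_bigr => t _; congr T; apply/ffunP => j; rewrite !ffunE.
rewrite -[RHS](T0 (fun v => \sum_i (v == f i)%:R * s i)) /form.
under [RHS]eq_bigr do rewrite bigA_distr_bigA mulr_sumr /=.
rewrite [RHS]exchange_big; apply: eq_bigr => e _ /=.
have prod_delta g : \prod_i ((g i == f (e i))%:R * s (e i)) =
    (g == [ffun j => f (e j)])%:R * \prod_j s (e j).
  by rewrite big_split -prodr_eq_nat; congr (_ * _); apply: eq_bigr => j _; rewrite ffunE.
by under [RHS]eq_bigr do rewrite prod_delta mulrCA; rewrite sum_eq_mul.
Qed.

Definition form_subst (C : V -> V -> F) T f : F := \sum_g T g * \prod_j C (g j) (f j).

Lemma form_linear_subst T C x : form T (fun v => \sum_u C v u * x u) = form (form_subst C T) x.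
Proof.
rewrite /form; under eq_bigr do rewrite bigA_distr_bigA mulr_sumr.
rewrite exchange_big; apply: eq_bigr => f _; rewrite /form_subst mulr_suml.
by apply: eq_bigr => g _; rewrite big_split mulrA.
Qed.

Lemma symmetrize_form_subst C T f :
  symmetrize (form_subst C T) f = form_subst C (symmetrize T) f.
Proof.
rewrite /form_subst; under [RHS]eq_bigr do rewrite mulr_suml.
rewrite [RHS]exchange_big; apply: eq_bigr => t _ /=.
rewrite [LHS](reindex _ (onW_bij _ (permf_bij V t))); apply: eq_bigr => g _ /=.
congr (_ * _); rewrite [RHS](reindex_inj (@perm_inj _ t)).
by apply: eq_bigr => j _; rewrite !ffunE.
Qed.

End Forms.

(** * Polynomial functions *)

Section PolynomialFunctions.
Variables (F : fieldType) (V : finType).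
Implicit Types (x y : V -> F) (f g : (V -> F) -> F).

Definition polyfun f := exists L : seq (F * seq V), forall x, f x = term_eval x L.

Lemma polyfun_ext f g : f =1 g -> polyfun f -> polyfun g.
Proof. by move=> eq_fg [L fL]; exists L => x; rewrite -eq_fg. Qed.

Lemma polyfun_eq f x y : polyfun f -> x =1 y -> f x = f y.
Proof. by case=> L fL eq_xy; rewrite !fL; apply: eq_term_eval. Qed.

Lemma polyfun_const c : polyfun (fun=> c).
Proof.
by exists [:: (c, [::])] => x; rewrite /term_eval big_seq1 big_nil mulr1.
Qed.

Lemma polyfun_var v : polyfun (fun x => x v).
Proof. by exists [:: (1, [:: v])] => x; rewrite /term_eval !big_seq1 mul1r. Qed.

Lemma polyfunD f g : polyfun f -> polyfun g -> polyfun (fun x => f x + g x).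
Proof. by move=> [L fL] [L' gL']; exists (L ++ L') => x; rewrite fL gL' term_eval_cat. Qed.

Lemma polyfunM f g : polyfun f -> polyfun g -> polyfun (fun x => f x * g x).
Proof.
move=> [L fL] [L' gL']; exists [seq (s.1 * t.1, s.2 ++ t.2) | s <- L, t <- L'] => x.
rewrite fL gL' /term_eval big_allpairs_dep /= big_distrlr /=.
apply: eq_bigr => s _; apply: eq_bigr => u _.
by rewrite big_cat /= mulrACA.
Qed.

Lemma polyfunB f g : polyfun f -> polyfun g -> polyfun (fun x => f x - g x).
Proof.
move=> pf pg; apply: polyfun_ext (polyfunD pf (polyfunM (polyfun_const (-1)) pg)) => x.
by rewrite mulN1r.
Qed.

Lemma polyfun_sum (I : Type) (r : seq I) (P : pred I) (f : I -> (V -> F) -> F) :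
  (forall i, polyfun (f i)) -> polyfun (fun x => \sum_(i <- r | P i) f i x).
Proof.
move=> pf; elim: r => [|i r IH].
  by apply: polyfun_ext (polyfun_const 0) => x; rewrite big_nil.
case: (boolP (P i)) => Pi.
  by apply: polyfun_ext (polyfunD (pf i) IH) => x; rewrite big_cons Pi.
by apply: polyfun_ext IH => x; rewrite big_cons (negPf Pi).
Qed.

Lemma polyfun_prod (I : Type) (r : seq I) (P : pred I) (f : I -> (V -> F) -> F) :
  (forall i, polyfun (f i)) -> polyfun (fun x => \prod_(i <- r | P i) f i x).
Proof.
move=> pf; elim: r => [|i r IH].
  by apply: polyfun_ext (polyfun_const 1) => x; rewrite big_nil.
case: (boolP (P i)) => Pi.
  by apply: polyfun_ext (polyfunM (pf i) IH) => x; rewrite big_cons Pi.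
by apply: polyfun_ext IH => x; rewrite big_cons (negPf Pi).
Qed.

Lemma polyfun_comp (h : (V -> F) -> V -> F) f :
  (forall v, polyfun (h^~ v)) -> polyfun f -> polyfun (f \o h).
Proof.
move=> ph [L fL]; apply: polyfun_ext (fun x => esym (fL (h x))) _.
apply: polyfun_sum => t; apply: polyfunM; first exact: polyfun_const.
exact: polyfun_prod.
Qed.

Lemma polyfun_line f x y : polyfun f -> exists p : {poly F},
  [/\ p.[0] = f x, p.[1] = f y & forall s, p.[s] = f (fun v => x v + s * (y v - x v))].
Proof.
move=> pf; have [L fL] := pf.
pose p := \sum_(t <- L) t.1%:P * \prod_(v <- t.2) ((x v)%:P + 'X * (y v - x v)%:P).
have pE s : p.[s] = f (fun v => x v + s * (y v - x v)).
  rewrite fL horner_sum; apply: eq_bigr => t _; rewrite hornerM hornerC horner_prod.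
  by congr (_ * _); apply: eq_bigr => v _; rewrite hornerD hornerC hornerM hornerX hornerC.
exists p; split=> //; rewrite pE; apply: polyfun_eq => // v.
  by rewrite mul0r addr0.
by rewrite mul1r addrC subrK.
Qed.

Hypothesis charF0 : has_pchar0 F.

Lemma polyfun_mul_eq0 f g : polyfun f -> polyfun g -> (exists x, f x != 0) ->
  (forall x, f x * g x = 0) -> forall x, g x = 0.
Proof.
move=> pf pg [a fa] fg0 b.
have [p [p0 _ pE]] := polyfun_line a b pf; have [q [_ q1 qE]] := polyfun_line a b pg.
have /eqP : p * q = 0.
  by apply: horner_inj_pchar0 => // s; rewrite hornerM horner0 pE qE fg0.
rewrite mulf_eq0 => /orP[/eqP|/eqP] z; last by rewrite -q1 z horner0.
by rewrite -p0 z horner0 eqxx in fa.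
Qed.

Lemma polyfun_unit_const f g : polyfun f -> polyfun g ->
  (forall x, f x * g x = 1) -> forall x y, f x = f y.
Proof.
move=> pf pg fg1 x y.
have [p [p0 p1 pE]] := polyfun_line x y pf; have [q [_ _ qE]] := polyfun_line x y pg.
have pq1 : p * q = 1.
  by apply: horner_inj_pchar0 => // s; rewrite hornerM hornerC pE qE fg1.
have : p \is a GRing.unit by apply/unitrPr; exists q.
by rewrite poly_unitE -p0 -p1 => /andP[/size_poly1P[c _ ->] _]; rewrite !hornerC.
Qed.

End PolynomialFunctions.

(** * Proportional families over a factorial ring *)

Definition proportional (R : pzRingType) (I : Type) (a b : I -> R) :=
  forall i j, a i * b j = a j * b i.

(* For a UFD this says that a saturated submodule of rank one of a free module
   is free; unlike unique factorization, it passes directly to polynomials. *)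
Definition rank_one_free (R : idomainType) := forall (I : finType) (a : I -> R),
  (exists i, a i != 0) ->
  exists mu : I -> R, forall b, proportional a b -> exists k, forall i, b i = k * mu i.

Lemma rank_one_free_field (K : fieldType) : rank_one_free K.
Proof.
move=> I a [i0 nz]; exists (fun i => a i / a i0) => b ab.
by exists (b i0) => i; apply: (mulfI nz); rewrite ab mulrCA mulrC [a i0 * _]mulrC divfK.
Qed.

Lemma Bezoutp_family (K : fieldType) (I : finType) (f : I -> {poly K}) :
  exists (g : {poly K}) (u : I -> {poly K}),
    (forall i, g %| f i) /\ g = \sum_i u i * f i.
Proof.
suff bezout (l : seq I) : exists (g : {poly K}) (u : I -> {poly K}),
    (forall i, i \in l -> g %| f i) /\ g = \sum_i u i * f i.
  by have [g [u [g_dvd gE]]] := bezout (enum I); exists g, u; split=> // i; rewrite g_dvd ?mem_enum.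
elim: l => [|i l [g [u [g_dvd gE]]]].
  by exists 0, (fun=> 0); split=> //; rewrite big1 // => i _; rewrite mul0r.
have [[w1 w2] /= bezout_eqp] := Bezoutp (f i) g.
exists (w1 * f i + w2 * g), (fun j => (j == i)%:R * w1 + w2 * u j); split=> [j|].
  rewrite inE (eqp_dvdl _ bezout_eqp) => /orP[/eqP->|/g_dvd]; first exact: dvdp_gcdl.
  by apply: dvdp_trans; apply: dvdp_gcdr.
under eq_bigr do rewrite mulrDl -!mulrA.
by rewrite big_split /= sum_eq_mul -mulr_sumr -gE.
Qed.

Lemma rank_one_free_polyfield (K : fieldType) : rank_one_free {poly K}.
Proof.
move=> I a [i0 nza]; have [g [u [g_dvd gE]]] := Bezoutp_family a.
have nzg : g != 0.
  by apply: contraNneq nza => g0; have := g_dvd i0; rewrite g0 dvd0p.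
exists (fun i => a i %/ g) => b ab; exists (\sum_i u i * b i) => j; apply: (mulIf nzg).
rewrite -mulrA divpK // {1}gE mulr_sumr mulr_suml; apply: eq_bigr => i _.
by rewrite mulrCA -!mulrA [b j * _]mulrC ab mulrC [b i * _]mulrC mulrC.
Qed.

Section Divisibility.
Variable R : comPzRingType.

Definition dvdr (r x : R) := exists y, x = r * y.

Lemma dvdr0 r : dvdr r 0. Proof. by exists 0; rewrite mulr0. Qed.

Lemma dvdrD r x y : dvdr r x -> dvdr r y -> dvdr r (x + y).
Proof. by move=> [u ->] [v ->]; exists (u + v); rewrite mulrDr. Qed.

Lemma dvdrN r x : dvdr r x -> dvdr r (- x).
Proof. by move=> [u ->]; exists (- u); rewrite mulrN. Qed.

Lemma dvdrB r x y : dvdr r x -> dvdr r y -> dvdr r (x - y).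
Proof. by move=> rx /dvdrN; apply: dvdrD. Qed.

Lemma dvdr_mull r x y : dvdr r x -> dvdr r (y * x).
Proof. by move=> [u ->]; exists (y * u); rewrite mulrCA. Qed.

Lemma dvdr_sum r (J : Type) (s : seq J) (P : pred J) (f : J -> R) :
  (forall i, P i -> dvdr r (f i)) -> dvdr r (\sum_(i <- s | P i) f i).
Proof. by move=> dvd; elim/big_ind: _ => //; [exact: dvdr0 | exact: dvdrD]. Qed.

End Divisibility.

Section Gauss.
Variable R : idomainType.
Implicit Types (r x : R) (f g : {poly R}).

Lemma dvdr_polyCP r f : dvdr r%:P f <-> forall l, dvdr r f`_l.
Proof.
split=> [[q ->] l|dvd]; first by exists q`_l; rewrite coefCM.
have [y yE] := fin_all_exists (fun l : 'I_(size f) => dvd l).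
exists (rVpoly (\row_l y l)); apply/polyP => l; rewrite coefCM.
case: (ltnP l (size f)) => hl.
  by rewrite -[l]/(nat_of_ord (Ordinal hl)) coef_rVpoly_ord mxE -yE.
by rewrite [RHS]mulrC !nth_default ?mul0r // (leq_trans (size_poly _ _)).
Qed.

Lemma dvdr_mul_lead r f g j : dvdr r%:P (f * g) ->
    (forall k, (j < k)%N -> dvdr r%:P (g`_k *: f)) ->
  dvdr r (g`_j * lead_coef f).
Proof.
move=> /dvdr_polyCP fg gk; set d := (size f).-1.
have jlt : (d < (d + j).+1)%N by rewrite ltnS leq_addr.
have := fg (d + j)%N; rewrite coefM (bigD1 (Ordinal jlt)) //= addKn => dvd.
rewrite mulrC -[_ * _](addrK (\sum_(i < (d + j).+1 | i != Ordinal jlt) f`_i * g`_(d + j - i))).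
apply: dvdrB dvd _; apply: dvdr_sum => i ni.
have [id|di] := ltnP i d.
  have /gk/dvdr_polyCP/(_ i) : (j < d + j - i)%N by rewrite ltn_subRL ltn_add2r.
  by rewrite coefZ mulrC.
rewrite nth_default ?mul0r; first exact: dvdr0.
apply: leq_trans (leqSpred _) _; rewrite ltn_neqAle di andbT.
by apply: contraNneq ni => e; apply/eqP/val_inj.
Qed.

Lemma size_sub_lead f : f != 0 ->
  (size (f - lead_coef f *: 'X^((size f).-1))%R < size f)%N.
Proof.
rewrite -size_poly_gt0 => /prednK sz; rewrite -[X in (_ < X)%N]sz ltnS.
apply/leq_sizeP => l; rewrite coefB coefZ coefXn leq_eqVlt => /predU1P[<-|lt_l].
  by rewrite eqxx mulr1 subrr.
by rewrite gtn_eqF // mulr0 subr0 nth_default // -sz.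
Qed.

Definition primitive (I : Type) (g : I -> {poly R}) := forall r x,
  r != 0 -> (forall i, dvdr r%:P (x *: g i)) -> dvdr r x.

Theorem primitive_dvdr (I : Type) (g : I -> {poly R}) r f : primitive g -> r != 0 ->
  (forall i, dvdr r%:P (f * g i)) -> dvdr r%:P f.
Proof.
move=> prim nzr; have [s] := ubnP (size f); elim: s f => // s IH f; rewrite ltnS => sf fg.
suff gf i j : dvdr r%:P ((g i)`_j *: f).
  apply/dvdr_polyCP => l; apply: prim nzr _ => i; apply/dvdr_polyCP => j.
  by have /dvdr_polyCP/(_ l) := gf i j; rewrite !coefZ mulrC.
have [->|nzf] := eqVneq f 0; first by rewrite scaler0; apply: dvdr0.
have [d] := ubnP (size (g i) - j); elim: d j => // d IHd j; rewrite ltnS => jd.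
have [gj|jg] := leqP (size (g i)) j; first by rewrite nth_default // scale0r; apply: dvdr0.
have gk k : (j < k)%N -> dvdr r%:P ((g i)`_k *: f) by move=> jk; apply: IHd; lia.
have lead := dvdr_mul_lead (fg i) gk.
have lead_dvd (h : {poly R}) : dvdr r%:P (((g i)`_j * lead_coef f) *: h).
  by rewrite -mul_polyC mulrC; apply: dvdr_mull; case: lead => y ->; exists y%:P; rewrite polyCM.
pose top := lead_coef f *: 'X^((size f).-1).
rewrite -[f](subrK top) scalerDr [_ *: top]scalerA; apply: dvdrD (lead_dvd _).
apply: IH => [|k]; last first.
  rewrite -scalerAl mulrBl scalerBr -scalerAl scalerA; apply: dvdrB (lead_dvd _).
  by rewrite -mul_polyC; apply: dvdr_mull.
exact: leq_trans (leq_ltn_trans (size_scale_leq _ _) (size_sub_lead nzf)) sf.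
Qed.

Hypothesis freeR : rank_one_free R.

Lemma primitive_part (I : finType) (h : I -> {poly R}) : (exists i, h i != 0) ->
  exists (c : R) (mu : I -> {poly R}), primitive mu /\ forall i, h i = c *: mu i.
Proof.
move=> [i0 nzh]; pose d := (\max_i size (h i))%N.
have rVpolyK i : rVpoly (poly_rV (h i) : 'rV_d) = h i by rewrite poly_rV_K // leq_bigmax.
have [[i l] nzc] : exists il : I * 'I_d, (h il.1)`_il.2 != 0.
  have ld : ((size (h i0)).-1 < d)%N.
    by rewrite prednK ?size_poly_gt0 // leq_bigmax.
  by exists (i0, Ordinal ld); rewrite -lead_coefE lead_coef_eq0.
have [nu gen] := freeR (ex_intro (fun il : I * 'I_d => (h il.1)`_il.2 != 0) (i, l) nzc).
have [c cE] := gen _ (fun i j => mulrC _ _).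
have nz_nu : nu (i, l) != 0 by apply: contraNneq nzc => e; rewrite (cE (i, l)) e mulr0.
exists c, (fun i => rVpoly (\row_l nu (i, l))); split=> [r x nzr xmu|k]; last first.
  rewrite -linearZ -[LHS]rVpolyK; congr rVpoly; apply/rowP => l'; rewrite !mxE.
  exact: (cE (k, l')).
have [b bE] : exists b : I * 'I_d -> R, forall il, x * nu il = r * b il.
  apply: (@fin_all_exists _ (fun=> R) (fun il y => x * nu il = r * y)) => -[k l'].
  by have /dvdr_polyCP/(_ l') := xmu k; rewrite coefZ coef_rVpoly_ord mxE.
have [y yE] : exists y, forall il, b il = y * nu il.
  apply: gen => il kl; apply: (mulfI nzr); rewrite mulrCA -bE [RHS]mulrCA -bE !cE.
  by ring.
by exists y; apply: (mulIf nz_nu); rewrite bE yE mulrA.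
Qed.

End Gauss.

Local Notation "x %:F" := (FracField.tofrac x) (at level 1, format "x %:F").
Local Notation fracp := (map_poly (@FracField.tofrac _)).

Section ClearDenominators.
Variable R : idomainType.

Lemma fraction_denominator (x : {fraction R}) : exists r, r != 0 /\ exists h, r%:F * x = h%:F.
Proof.
elim/quotW: x => x; exists \d_x; split; first exact: denom_ratioP; exists \n_x.
unlock FracField.tofrac; rewrite -[LHS]FracField.pi_mul; apply/eqmodP => /=.
rewrite /FracField.equivf /FracField.mulf !numden_Ratio ?(oner_neq0, mulf_neq0, denom_ratioP) //.
by rewrite mulr1 !mul1r mulrC.
Qed.

Lemma common_denominator (J : finType) (f : J -> {fraction R}) :
  exists r : R, r != 0 /\ exists h : J -> R, forall j, r%:F * f j = (h j)%:F.
Proof.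
suff [r [nz den]] : exists r : R, r != 0 /\
    forall j, j \in enum J -> exists h, r%:F * f j = h%:F.
  exists r; split=> //.
  apply: (@fin_all_exists J (fun=> R) (fun j h => r%:F * f j = h%:F)) => j.
  by apply: den; rewrite mem_enum.
elim: (enum J) => [|j l [r [nz den]]]; first by exists 1; split=> //; apply: oner_neq0.
have [r' [nz' [h' hE']]] := fraction_denominator (f j).
exists (r * r'); split=> [|i]; first exact: mulf_neq0.
rewrite inE => /orP[/eqP->|/den[h hE]].
  by exists (r * h'); rewrite !tofracM -mulrA hE'.
by exists (r' * h); rewrite !tofracM mulrAC hE mulrC.
Qed.

Lemma polynomial_common_denominator (I : finType) (f : I -> {poly {fraction R}}) :
  exists r : R, r != 0 /\ exists h : I -> {poly R}, forall i, r%:F *: f i = fracp (h i).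
Proof.
pose d := (\max_i size (f i))%N.
have [r [nz [h hE]]] := common_denominator (fun il : I * 'I_d => (f il.1)`_il.2).
exists r; split=> //; exists (fun i => rVpoly (\row_l h (i, l))) => i.
rewrite -[f i](poly_rV_K (d := d)) ?leq_bigmax // -linearZ; apply/polyP => l.
rewrite coef_map; case: (ltnP l d) => ld.
  rewrite -[l]/(nat_of_ord (Ordinal ld)) !coef_rVpoly_ord !mxE.
  exact: (hE (i, Ordinal ld)).
by rewrite !nth_default ?tofrac0 // (leq_trans (size_poly _ _)).
Qed.

Lemma fracp_inj : injective (fracp : {poly R} -> _).
Proof. by apply: map_inj_poly => [x y /eqP|]; [rewrite tofrac_eq => /eqP | exact: tofrac0]. Qed.

End ClearDenominators.

Theorem rank_one_free_poly (R : idomainType) : rank_one_free R -> rank_one_free {poly R}.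
Proof.
move=> freeR I a [i0 nza].
have nz_fa : fracp (a i0) != 0 by rewrite -(rmorph0 fracp) (inj_eq (@fracp_inj R)).
have frac_prop b : proportional a b -> proportional (fracp \o a) (fracp \o b).
  by move=> ab i j /=; rewrite -!rmorphM ab.
have [m gen_m] := rank_one_free_polyfield (ex_intro (fun i => fracp (a i) != 0) i0 nz_fa).
have [r [nzr [h hE]]] := polynomial_common_denominator m.
have [|c [mu [prim cE]]] := primitive_part freeR (h := h).
  have [k /= kE] := gen_m _ (frac_prop a (fun i j => mulrC _ _)).
  exists i0; apply: contraNneq nz_fa => hi0.
  have /eqP : r%:F *: m i0 = 0 by rewrite hE hi0 rmorph0.
  by rewrite scaler_eq0 tofrac_eq0 (negPf nzr) kE => /eqP->; rewrite mulr0.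
exists mu => b /frac_prop/gen_m[k /= kE].
have [r' [nzr' [h' hE']]] := polynomial_common_denominator (fun _ : unit => (c%:F / r%:F) *: k).
have bE i : r' *: b i = h' tt * mu i.
  apply: fracp_inj; rewrite rmorphM /= -hE' map_polyZ /= (kE i) -!scalerAl; congr (_ *: _).
  rewrite scalerAr -scalerA; congr (_ * _).
  have -> : m i = r%:F^-1 *: fracp (h i) by rewrite -hE scalerA mulVf ?scale1r ?tofrac_eq0.
  by rewrite cE map_polyZ /= !scalerA [_^-1 * _]mulrC mulrC.
have [|q qE] := primitive_dvdr (f := h' tt) prim nzr'.
  by move=> i; rewrite -bE; exists (b i); rewrite mul_polyC.
exists q => i; have nzP : r'%:P != 0 by rewrite polyC_eq0.
by apply: (mulfI nzP); rewrite mul_polyC bE qE mulrA.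
Qed.

Section PolynomialRing.
Variable F : fieldType.

Fixpoint iter_poly (k : nat) : idomainType :=
  if k is k'.+1 then {poly iter_poly k'} : idomainType else F.

Fixpoint iter_eval (k : nat) (x : nat -> F) : {rmorphism iter_poly k -> F} :=
  match k with
  | 0 => idfun
  | k'.+1 => horner_eval (x k') \o map_poly (iter_eval k' x)
  end.

Lemma rank_one_free_iter k : rank_one_free (iter_poly k).
Proof. by elim: k => [|k IH]; [exact: rank_one_free_field | exact: rank_one_free_poly]. Qed.

Lemma eq_iter_eval k x y (r : iter_poly k) :
  (forall i, (i < k)%N -> x i = y i) -> iter_eval k x r = iter_eval k y r.
Proof.
elim: k r => //= k IH r e; rewrite /horner_eval e //.
by congr (_.[_]); apply: eq_map_poly => c /=; apply: IH => i /ltnW/e.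
Qed.

Lemma iter_eval_const k c : exists r : iter_poly k, forall x, iter_eval k x r = c.
Proof.
elim: k => [|k [r rE]]; first by exists c.
by exists r%:P => x /=; rewrite map_polyC /horner_eval hornerC; apply: rE.
Qed.

Lemma iter_eval_var k i : (i < k)%N -> exists r : iter_poly k, forall x, iter_eval k x r = x i.
Proof.
elim: k => // k IH; rewrite ltnS leq_eqVlt => /orP[/eqP->|/IH[r rE]].
  by exists 'X => x /=; rewrite map_polyX /horner_eval hornerX.
by exists r%:P => x /=; rewrite map_polyC /horner_eval hornerC; apply: rE.
Qed.

Variable V : finType.

Definition enum_point (x : V -> F) (p : nat) : F :=
  oapp (fun i : 'I_#|V| => x (enum_val i)) 0 (insub p).

Lemma enum_point_rank x v : enum_point x (enum_rank v) = x v.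
Proof. by rewrite /enum_point valK /= enum_rankK. Qed.

Lemma polyfun_iter_eval k (r : iter_poly k) : polyfun (fun x => iter_eval k (enum_point x) r).
Proof.
elim: k r => [|k IH] r; first exact: polyfun_const.
have pk : polyfun (enum_point^~ k).
  rewrite /enum_point; case: insubP => [i _ _|_]; [exact: polyfun_var | exact: polyfun_const].
have : polyfun (fun x => \sum_(l < size r)
    iter_eval k (enum_point x) r`_l * \prod_(j < l) enum_point x k).
  by apply: polyfun_sum => l; apply: polyfunM => //; apply: polyfun_prod.
apply: polyfun_ext => x /=; rewrite /horner_eval (@horner_coef_wide _ (size r)) ?size_poly //.
by apply: eq_bigr => l _; rewrite coef_map prodr_const card_ord.
Qed.

Lemma iter_eval_polyfun (f : (V -> F) -> F) : polyfun f ->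
  exists r : iter_poly #|V|, forall y, iter_eval #|V| y r = f (fun v => y (enum_rank v)).
Proof.
case=> L fL.
have mono (m : seq V) : exists r : iter_poly #|V|,
    forall y, iter_eval #|V| y r = \prod_(v <- m) y (enum_rank v).
  elim: m => [|v m [r rE]].
    by have [r rE] := iter_eval_const #|V| 1; exists r => y; rewrite rE big_nil.
  have [r' rE'] := iter_eval_var (ltn_ord (enum_rank v)).
  by exists (r' * r) => y; rewrite rmorphM big_cons -rE -rE'.
suff [r rE] : exists r : iter_poly #|V|, forall y,
    iter_eval #|V| y r = term_eval (fun v => y (enum_rank v)) L.
  by exists r => y; rewrite rE fL.
elim: L {fL} => [|t L [r rE]].
  by exists 0 => y; rewrite rmorph0 /term_eval big_nil.
have [r' rE'] := mono t.2; have [c cE] := iter_eval_const #|V| t.1.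
by exists (c * r' + r) => y; rewrite rmorphD rmorphM /= rE rE' cE /term_eval big_cons.
Qed.

Hypothesis charF0 : has_pchar0 F.

Lemma iter_eval_neq0 k (r : iter_poly k) : r != 0 -> exists x, iter_eval k x r != 0.
Proof.
elim: k r => [|k IH] r nz; first by exists (fun=> 0).
have [x lead_x] : exists x, iter_eval k x (lead_coef r) != 0 by apply: IH; rewrite lead_coef_eq0.
have /(poly_nonroot (natr_inj_pchar0 charF0))[l nroot] : map_poly (iter_eval k x) r != 0.
  apply: contraNneq lead_x => /(congr1 (fun p : {poly F} => p`_(size r).-1)).
  by rewrite coef_map coef0 => ->.
exists (fun i => if i == k then l%:R else x i); rewrite /= /horner_eval eqxx.
rewrite (eq_map_poly (g := iter_eval k x)) // => c; apply: eq_iter_eval => i.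
by case: eqP => // ->; rewrite ltnn.
Qed.

Lemma iter_eval_eq0 k (r : iter_poly k) : (forall x, iter_eval k x r = 0) -> r = 0.
Proof.
move=> r0; apply/eqP; apply: contraT => /iter_eval_neq0[x].
by rewrite r0 eqxx.
Qed.

Lemma iter_eval_enum_point (f : (V -> F) -> F) (r : iter_poly #|V|) : polyfun f ->
    (forall y, iter_eval #|V| y r = f (fun v => y (enum_rank v))) ->
  forall x, iter_eval #|V| (enum_point x) r = f x.
Proof. by move=> pf fE x; rewrite fE; apply: polyfun_eq => // v; rewrite enum_point_rank. Qed.

Lemma polyfun_eq0_or_neq0 (f : (V -> F) -> F) : polyfun f ->
  (forall x, f x = 0) \/ exists x, f x != 0.
Proof.
move=> pf; have [r fE] := iter_eval_polyfun pf.
have [r0|/iter_eval_neq0[y]] := eqVneq r 0; last by rewrite fE => nz; right; eexists; apply: nz.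
by left=> x; rewrite -(iter_eval_enum_point pf fE) r0 rmorph0.
Qed.

Lemma polyfun_family_eq0_or_neq0 (I : finType) (a : I -> (V -> F) -> F) :
  (forall i, polyfun (a i)) -> (forall i x, a i x = 0) \/ exists i x, a i x != 0.
Proof.
move=> pa; have [zero zeroP] : exists zero : I -> bool,
    forall i, if zero i then forall x, a i x = 0 else exists x, a i x != 0.
  apply: (@fin_all_exists _ (fun=> bool)
    (fun i z => if z then forall x, a i x = 0 else exists x, a i x != 0)) => i.
  by have [a0|nz] := polyfun_eq0_or_neq0 (pa i); [exists true | exists false].
have [/forallP all0|] := boolP [forall i, zero i].
  by left=> i; have := zeroP i; rewrite all0.
by rewrite negb_forall => /existsP[i /negPf nz]; right; exists i; have := zeroP i; rewrite nz.
Qed.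

Theorem polyfun_rank_one_free (I : finType) (a : I -> (V -> F) -> F) :
  (forall i, polyfun (a i)) -> (exists i x, a i x != 0) ->
  exists mu : I -> (V -> F) -> F, (forall i, polyfun (mu i)) /\
    forall b : I -> (V -> F) -> F, (forall i, polyfun (b i)) ->
      (forall x, proportional (a^~ x) (b^~ x)) ->
      exists k, polyfun k /\ forall i x, b i x = k x * mu i x.
Proof.
move=> pa [i0 [x0 nz]]; pose k := #|V|.
have [ra raE] := fin_all_exists (fun i => iter_eval_polyfun (pa i)).
have [|nu gen] := @rank_one_free_iter k I ra.
  exists i0; apply: contraNneq nz => r0.
  by rewrite -(iter_eval_enum_point (pa i0) (raE i0)) r0 rmorph0.
exists (fun i x => iter_eval k (enum_point x) (nu i)).
split=> [i|b pb ab]; first exact: polyfun_iter_eval.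
have [rb rbE] := fin_all_exists (fun i => iter_eval_polyfun (pb i)).
have [|q qE] := gen rb.
  move=> i j; apply/subr0_eq/iter_eval_eq0 => y.
  by rewrite rmorphB !rmorphM /= !raE !rbE ab subrr.
exists (fun x => iter_eval k (enum_point x) q); split=> [|i x]; first exact: polyfun_iter_eval.
by rewrite -(iter_eval_enum_point (pb i) (rbE i)) qE rmorphM.
Qed.

End PolynomialRing.

(** * Schur-Weyl duality *)

Lemma mulmx_delta_entry (R : comPzSemiRingType) n (A : 'M[R]_n) (i j u v : 'I_n) :
  (A *m delta_mx i j) u v = (v == j)%:R * A u i.
Proof.
rewrite mxE; under eq_bigr do rewrite mxE mulrC -mulnb natrM -mulrA.
by rewrite sum_eq_mul.
Qed.

Section DoubleCentralizer.
Variables (F : fieldType) (gT : finGroupType) (G : {group gT}) (n : nat).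
Variable rG : mx_representation F G n.
Hypothesis nzG : #|G|%:R != 0 :> F.

Local Notation repr_span := (\sum_(x in G) <[rG x]>)%VS.

Lemma averaged_projection : exists p : 'End('M[F]_n), [/\ forall X, p X \in repr_span,
  p 1%:M = 1%:M & forall x X, x \in G -> p (rG x *m X) = rG x *m p X].
Proof.
pose lmul (A : 'M[F]_n) : 'End('M[F]_n) := linfun (mulmx A).
have spanG x : x \in G -> rG x \in repr_span.
  by move=> Gx; rewrite (subvP (sumv_sup x Gx (subvv _))) ?memv_line.
have mulG x X : x \in G -> X \in repr_span -> rG x *m X \in repr_span.
  move=> Gx /memv_sumP[Xs Xs_line ->]; rewrite mulmx_sumr; apply: memv_suml => y Gy.
  have /vlineP[k ->] := Xs_line y Gy.
  by rewrite -scalemxAr -repr_mxM // memvZ // spanG // groupM.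
exists (#|G|%:R^-1 *: \sum_(x in G) (lmul (rG x) \o projv repr_span \o lmul (rG x^-1%g))%VF).
split=> [X||y X Gy]; rewrite !scale_lfunE !sum_lfunE.
- by rewrite memvZ // memv_suml // => x Gx; rewrite !comp_lfunE !lfunE mulG ?memv_proj.
- rewrite (eq_bigr (fun=> 1%:M)) => [|x Gx].
    by rewrite sumr_const -scaler_nat scalerA mulVf ?scale1r.
  rewrite !comp_lfunE !lfunE /= mulmx1 projv_id ?spanG ?groupV //.
  by rewrite -repr_mxM ?groupV // mulgV repr_mx1.
- rewrite -scalemxAr mulmx_sumr; congr (_ *: _).
  rewrite (reindex_inj (mulgI y)); apply: eq_big => [x|x]; first by rewrite groupMl.
  rewrite groupMl // => Gx; rewrite !comp_lfunE !lfunE /= invMg.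
  rewrite [rG (y * x)%g]repr_mxM // -mulmxA; congr (_ *m (_ *m projv _ _)).
  by rewrite mulmxA -repr_mxM ?groupM ?groupV // mulgKV.
Qed.

(* A linear endomorphism of the matrices is [X |-> (\sum_y (Y v y *m X) u y)_(u, v)];
   if it is left [G]-linear then every [Y v y] centralizes [rG]. *)
Lemma left_linear_centralizer (p : 'End('M[F]_n)) (T : 'M[F]_n) :
    (forall x X, x \in G -> p (rG x *m X) = rG x *m p X) ->
    (forall Y, centgmx rG Y -> T *m Y = Y *m T) ->
  forall X, p (T *m X) = T *m p X.
Proof.
move=> pG centT; pose Y v y : 'M[F]_n := \matrix_(u, x) p (delta_mx x y) u v.
have pE X u v : p X u v = \sum_y (Y v y *m X) u y.
  rewrite {1}(matrix_sum_delta X) linear_sum summxE.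
  under eq_bigr do rewrite linear_sum summxE.
  rewrite exchange_big /=; apply: eq_bigr => y _; rewrite mxE; apply: eq_bigr => x _.
  by rewrite linearZ !mxE mulrC.
have centY v y : centgmx rG (Y v y).
  apply/centgmxP => x Gx; apply/matrixP => u w; rewrite [RHS]mxE.
  transitivity ((rG x *m p (delta_mx w y)) u v); last first.
    by rewrite mxE; apply: eq_bigr => z _; rewrite [Y v y z w]mxE.
  rewrite -pG // pE; under eq_bigr do rewrite mulmxA mulmx_delta_entry.
  by rewrite sum_eq_mul.
move=> X; apply/matrixP=> u v; rewrite pE mxE.
under [RHS]eq_bigr do rewrite pE mulr_sumr.
rewrite [RHS]exchange_big; apply: eq_bigr => y _ /=.
by rewrite mulmxA -centT // -mulmxA [LHS]mxE.
Qed.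

Theorem double_centralizer (T : 'M[F]_n) :
    (forall Y, centgmx rG Y -> T *m Y = Y *m T) ->
  exists c : gT -> F, T = \sum_(x in G) c x *: rG x.
Proof.
move=> centT; have [p [p_span p1 pG]] := averaged_projection.
have := p_span (T *m 1%:M); rewrite left_linear_centralizer // p1 mulmx1.
case/memv_sumP => Ts Ts_line ->.
have [c cE] : exists c : gT -> F, forall x, x \in G -> Ts x = c x *: rG x.
  apply: (@fin_all_exists _ (fun=> F) (fun x k => x \in G -> Ts x = k *: rG x)) => x.
  by case: (boolP (x \in G)) => [/Ts_line/vlineP[k ->]|_]; [exists k | exists 0].
by exists c; apply: eq_bigr.
Qed.

End DoubleCentralizer.

Section FinTypeMatrices.
Variables (F : fieldType) (K : finType).
Implicit Types (A B : 'M[F]_#|K|) (f : K -> K -> F) (a b c : K).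

Definition finmx f : 'M[F]_#|K| := \matrix_(x, y) f (enum_val x) (enum_val y).

Definition finmx_entry A a b : F := A (enum_rank a) (enum_rank b).

Lemma finmxE f a b : finmx_entry (finmx f) a b = f a b.
Proof. by rewrite /finmx_entry mxE !enum_rankK. Qed.

Lemma finmxP A B : (forall a b, finmx_entry A a b = finmx_entry B a b) -> A = B.
Proof.
by move=> eqAB; apply/matrixP => x y; rewrite -[x]enum_valK -[y]enum_valK; apply: eqAB.
Qed.

Lemma finmx1E a b : finmx_entry 1%:M a b = (a == b)%:R.
Proof. by rewrite /finmx_entry mxE (inj_eq enum_rank_inj). Qed.

Lemma finmxME A B a c : finmx_entry (A *m B) a c = \sum_b finmx_entry A a b * finmx_entry B b c.
Proof.
rewrite /finmx_entry mxE (reindex enum_rank) //.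
by exists enum_val => x _; rewrite ?enum_valK ?enum_rankK.
Qed.

End FinTypeMatrices.

Section PairFfun.
Variables (I S T : finType).
Implicit Types (a : {ffun I -> S}) (b : {ffun I -> T}) (f : {ffun I -> S * T}).

Definition pair_ffun a b : {ffun I -> S * T} := [ffun i => (a i, b i)].

Definition fst_ffun f : {ffun I -> S} := [ffun i => (f i).1].

Definition snd_ffun f : {ffun I -> T} := [ffun i => (f i).2].

Lemma fst_pair_ffun a b : fst_ffun (pair_ffun a b) = a.
Proof. by apply/ffunP => i; rewrite !ffunE. Qed.

Lemma snd_pair_ffun a b : snd_ffun (pair_ffun a b) = b.
Proof. by apply/ffunP => i; rewrite !ffunE. Qed.

Lemma pair_ffunK f : pair_ffun (fst_ffun f) (snd_ffun f) = f.
Proof. by apply/ffunP => i; rewrite !ffunE; case: (f i). Qed.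

Lemma permf_pair_ffun a b t : permf (pair_ffun a b) t = pair_ffun (permf a t) (permf b t).
Proof. by apply/ffunP => i; rewrite !ffunE. Qed.

Lemma sum_pair_ffun (R : nmodType) (G : {ffun I -> S * T} -> R) :
  \sum_f G f = \sum_a \sum_b G (pair_ffun a b).
Proof.
rewrite pair_bigA [LHS](reindex (fun ab => pair_ffun ab.1 ab.2)) //=.
exists (fun f => (fst_ffun f, snd_ffun f)) => [[a b]|f] _ /=; last exact: pair_ffunK.
by rewrite fst_pair_ffun snd_pair_ffun.
Qed.

End PairFfun.

Section SchurWeyl.
Variables (F : fieldType) (m n : nat).
Local Notation index := {ffun 'I_m -> 'I_n}.
Implicit Types (s t : 'S_m) (a b c : index) (g h : 'M[F]_n) (T X Y : 'M[F]_#|{: index}|).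

Definition tensor_mx g : 'M[F]_#|{: index}| := finmx (fun a b => \prod_i g (a i) (b i)).

Definition tensor_perm_mx s : 'M[F]_#|{: index}| := finmx (fun a b => (a == permf b s)%:R).

Lemma tensor_mxM g h : tensor_mx (g *m h) = tensor_mx g *m tensor_mx h.
Proof.
apply: finmxP => a c; rewrite finmxME finmxE; under eq_bigr do rewrite mxE.
rewrite bigA_distr_bigA /=; apply: eq_bigr => b _.
by rewrite !finmxE -big_split.
Qed.

Lemma tensor_mx1 : tensor_mx 1%:M = 1%:M.
Proof.
apply: finmxP => a b; rewrite finmxE finmx1E -prodr_eq_nat.
by apply: eq_bigr => i _; rewrite mxE.
Qed.

Lemma mulmx_tensor_permr X s a b :
  finmx_entry (X *m tensor_perm_mx s) a b = finmx_entry X a (permf b s).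
Proof. by rewrite finmxME; under eq_bigr do rewrite finmxE mulrC; rewrite sum_eq_mul. Qed.

Lemma mulmx_tensor_perml X s a b :
  finmx_entry (tensor_perm_mx s *m X) (permf a s) b = finmx_entry X a b.
Proof.
rewrite finmxME; under eq_bigr do rewrite finmxE eq_sym (bij_eq (permf_bij _ s)).
by rewrite sum_eq_mul.
Qed.

Lemma tensor_perm_mx_repr : mx_repr [set: 'S_m] tensor_perm_mx.
Proof.
split=> [|s t _ _]; apply: finmxP => a b.
  by rewrite finmxE finmx1E permf1.
by rewrite mulmx_tensor_permr !finmxE permfM.
Qed.

Canonical tensor_perm_repr := MxRepresentation tensor_perm_mx_repr.

Hypothesis charF0 : has_pchar0 F.

Lemma comm_tensor_centralizer T Y : (forall g, T *m tensor_mx g = tensor_mx g *m T) ->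
  (forall s, Y *m tensor_perm_mx s = tensor_perm_mx s *m Y) -> T *m Y = Y *m T.
Proof.
move=> Tg Ys; apply: finmxP => x z.
have Yinv s a b : finmx_entry Y (permf a s) (permf b s) = finmx_entry Y a b.
  by rewrite -mulmx_tensor_permr Ys mulmx_tensor_perml.
pose G a b := (b == z)%:R * finmx_entry T x a - (a == x)%:R * finmx_entry T b z.
have sum_commutator A : \sum_a \sum_b G a b * finmx_entry A a b =
    \sum_b finmx_entry T x b * finmx_entry A b z - \sum_b finmx_entry A x b * finmx_entry T b z.
  under [X in _ - X]eq_bigr do rewrite mulrC.
  under [LHS]eq_bigr do under eq_bigr do rewrite mulrBl -!mulrA.
  under [LHS]eq_bigr do rewrite sumrB sum_eq_mul -mulr_sumr.
  by rewrite sumrB sum_eq_mul.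
have symG0 a b : \sum_(s : 'S_m) G (permf a s) (permf b s) = 0.
  pose form_G (f : {ffun 'I_m -> 'I_n * 'I_n}) := G (fst_ffun f) (snd_ffun f).
  rewrite -[RHS](symmetrize_eq0 (T := form_G) charF0 _ (pair_ffun a b)) => [|g].
    by apply: eq_bigr => s _; rewrite permf_pair_ffun /form_G fst_pair_ffun snd_pair_ffun.
  pose g_mx : 'M_n := \matrix_(i, j) g (i, j).
  have formE : form form_G g =
      \sum_a' \sum_b' G a' b' * finmx_entry (tensor_mx g_mx) a' b'.
    rewrite /form sum_pair_ffun; apply: eq_bigr => a' _; apply: eq_bigr => b' _.
    rewrite /form_G fst_pair_ffun snd_pair_ffun finmxE; congr (_ * _).
    by apply: eq_bigr => i _; rewrite mxE ffunE.
  have := congr1 (fun A => finmx_entry A x z) (Tg g_mx); rewrite !finmxME => /eqP.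
  by rewrite formE sum_commutator -subr_eq0 => /eqP.
have nz := natr_neq0_pchar0 charF0 (fact_gt0 m); apply: (mulfI nz).
apply/subr0_eq; rewrite -mulrBr !finmxME -sum_commutator -sum_perm_const.
rewrite -[RHS](_ : \sum_a \sum_b (\sum_(s : 'S_m) G (permf a s) (permf b s)) *
    finmx_entry Y a b = _); last first.
  by rewrite big1 // => a _; rewrite big1 // => b _; rewrite symG0 mul0r.
under [RHS]eq_bigr do under eq_bigr do rewrite mulr_suml.
under [RHS]eq_bigr do rewrite exchange_big.
rewrite [RHS]exchange_big; apply: eq_bigr => s _ /=.
rewrite [LHS](reindex _ (onW_bij _ (permf_bij _ s))); apply: eq_bigr => a _.
rewrite [LHS](reindex _ (onW_bij _ (permf_bij _ s))); apply: eq_bigr => b _ /=.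
by rewrite Yinv.
Qed.

Theorem schur_weyl T : (forall g, T *m tensor_mx g = tensor_mx g *m T) ->
  exists c : 'S_m -> F, T = \sum_s c s *: tensor_perm_mx s.
Proof.
move=> Tg; have [||c ->] := @double_centralizer _ _ _ _ tensor_perm_repr _ T.
- by rewrite cardsT card_Sn natr_neq0_pchar0 ?fact_gt0.
- move=> Y /centgmxP centY; apply: comm_tensor_centralizer => // s.
  by rewrite -[tensor_perm_mx s]/(tensor_perm_repr s) centY ?inE.
- by exists c; apply: eq_bigl => s; rewrite inE.
Qed.

End SchurWeyl.

(** * Generation of the matrices by elementary matrices *)

Section ElementaryMatrices.
Variable F : fieldType.

Definition elem_mx n (i j : 'I_n) (s : F) : 'M[F]_n := 1%:M + s *: delta_mx i j.

Lemma elem_mxM n (i j : 'I_n) s r : i != j ->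
  elem_mx i j s *m elem_mx i j r = elem_mx i j (s + r).
Proof.
move=> nij; rewrite /elem_mx mulmxDr mulmx1 mulmxDl mul1mx -scalemxAl -scalemxAr.
by rewrite mul_delta_mx_0 1?eq_sym // !scaler0 addr0 scalerDl addrA.
Qed.

Lemma elem_mx0 n (i j : 'I_n) : elem_mx i j 0 = 1%:M.
Proof. by rewrite /elem_mx scale0r addr0. Qed.

Section Block.
Variables (n : nat) (G : 'M[F]_(1 + n) -> Prop).
Hypothesis GM : forall A B, G A -> G B -> G (A *m B).
Hypothesis G_elem : forall i j s, G (elem_mx i j s).
Hypothesis G_drblock : forall B, G (block_mx 1%:M 0 0 B).

Lemma block_col_elem_ind c : G (block_mx 1%:M 0 c 1%:M).
Proof.
rewrite [c]matrix_sum_delta; elim/big_rec: _ => [|i x _ Gx]; first exact: G_drblock.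
rewrite big_ord1; have := GM (G_elem (rshift 1 i) (lshift n 0) (c i 0)) Gx.
rewrite /elem_mx delta_mx_dshift delta_mx_lshift -[X in col_mx X _]row_mx0 -/(block_mx _ _ _ _).
rewrite [1%:M in X in X *m _](scalar_mx_block 1 n) scale_block_mx add_block_mx mulmx_block.
by rewrite !(scaler0, mulmx0, mul0mx, mulmx1, mul1mx, addr0, add0r).
Qed.

Lemma block_row_elem_ind r : G (block_mx 1%:M r 0 1%:M).
Proof.
rewrite [r]matrix_sum_delta big_ord1; elim/big_rec: _ => [|i x _ Gx]; first exact: G_drblock.
have := GM Gx (G_elem (lshift n 0) (rshift 1 i) (r 0 i)).
rewrite /elem_mx delta_mx_ushift delta_mx_rshift -[X in col_mx _ X]row_mx0 -/(block_mx _ _ _ _).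
rewrite [1%:M in X in _ *m X](scalar_mx_block 1 n) scale_block_mx add_block_mx mulmx_block.
by rewrite !(scaler0, mulmx0, mul0mx, mulmx1, mul1mx, addr0, add0r).
Qed.

Lemma block_scalar_elem_ind a : G (block_mx a%:M 0 0 1%:M).
Proof.
have := G_elem (lshift n 0) (lshift n 0) (a - 1).
rewrite /elem_mx delta_mx_ushift delta_mx_lshift -[X in col_mx _ X]row_mx0 -/(block_mx _ _ _ _).
rewrite [1%:M](scalar_mx_block 1 n) scale_block_mx add_block_mx !(scaler0, addr0).
congr (G (block_mx _ _ _ _)).
by apply/matrixP=> x y; rewrite !ord1 !mxE !eqxx !mulr1n mulr1 addrC subrK.
Qed.

Lemma block_pivot_elem_ind a r c B : a != 0 -> G (block_mx a%:M r c B).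
Proof.
move=> nz; have := GM (GM (block_col_elem_ind (a^-1 *: c)) (GM (block_scalar_elem_ind a)
  (G_drblock (B - a^-1 *: (c *m r))))) (block_row_elem_ind (a^-1 *: r)).
rewrite !mulmx_block !(mulmx0, mul0mx, mulmx1, mul1mx, addr0, add0r).
rewrite -!scalemxAl -!scalemxAr !mul_scalar_mx !mul_mx_scalar !scalerA.
by rewrite -scalemxAl scalerA divfK // mulVf // !scale1r [_ + (B - _)]addrC subrK.
Qed.

End Block.

Theorem elem_mx_ind n (G : 'M[F]_n -> Prop) :
  G 1%:M -> (forall A B, G A -> G B -> G (A *m B)) ->
  (forall i j s, G (elem_mx i j s)) ->
  (forall A B, (forall s, s != 0 -> G (A + s *: B)) -> G A) ->
  forall A, G A.
Proof.
elim: n G => [|n IH]; first by move=> G G1 _ _ _ A; rewrite (flatmx0 A) -(flatmx0 1%:M).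
rewrite -[n.+1]/(1 + n)%N => G G1 GM G_elem G_limit A.
have G_drblock B : G (block_mx 1%:M 0 0 B : 'M[F]_(1 + n)).
  move: B; apply: IH => [|B C GB GC|i j s|B C GBC].
  - by rewrite -scalar_mx_block.
  - by have := GM _ _ GB GC; rewrite mulmx_block !(mulmx0, mul0mx, mulmx1, addr0, add0r).
  - have := G_elem (rshift 1 i) (rshift 1 j) s; rewrite /elem_mx delta_mx_dshift delta_mx_rshift.
    rewrite -[X in col_mx X _]row_mx0 -/(block_mx _ _ _ _) [1%:M](scalar_mx_block 1 n).
    by rewrite scale_block_mx add_block_mx !(scaler0, addr0).
  - apply: (G_limit _ (block_mx 0 0 0 C)) => s /GBC.
    by rewrite scale_block_mx add_block_mx !(scaler0, addr0).
have pivot := block_pivot_elem_ind GM G_elem G_drblock.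
rewrite -[A](@submxK _ 1 n 1 n) [ulsubmx A]mx11_scalar; set a := ulsubmx A 0 0.
case: (eqVneq a 0) => [->|]; last exact: pivot.
apply: (G_limit _ (block_mx 1%:M 0 0 0)) => s nz.
rewrite scale_block_mx add_block_mx !(scaler0, addr0) scale_scalar_mx mulr1 -raddfD add0r.
exact: pivot.
Qed.

End ElementaryMatrices.

Lemma comm_tensor_line (F : fieldType) m n (T : 'M[F]_#|{: {ffun 'I_m -> 'I_n}}|)
    (A B : 'M[F]_n) (f : nat -> F) : injective f ->
    (forall k, T *m tensor_mx m (A + f k *: B) = tensor_mx m (A + f k *: B) *m T) ->
  forall s, T *m tensor_mx m (A + s *: B) = tensor_mx m (A + s *: B) *m T.
Proof.
move=> injf commT s; apply: finmxP => a c.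
pose P (a b : {ffun 'I_m -> 'I_n}) : {poly F} :=
  \prod_i ((A (a i) (b i))%:P + (B (a i) (b i))%:P * 'X).
have PE a' b' u : (P a' b').[u] = finmx_entry (tensor_mx m (A + u *: B)) a' b'.
  rewrite horner_prod finmxE; apply: eq_bigr => i _; rewrite !mxE.
  by rewrite hornerD hornerM !hornerC hornerX mulrC.
pose p := \sum_b ((finmx_entry T a b)%:P * P b c - P a b * (finmx_entry T b c)%:P).
have pE u : p.[u] = finmx_entry (T *m tensor_mx m (A + u *: B)) a c -
    finmx_entry (tensor_mx m (A + u *: B) *m T) a c.
  rewrite horner_sum !finmxME -sumrB; apply: eq_bigr => b _.
  by rewrite hornerD hornerN !hornerM !hornerC !PE.
apply/subr0_eq; rewrite -pE (_ : p = 0) ?horner0 //.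
by apply: (poly_eq0_inj_roots injf) => k; rewrite pE commT subrr.
Qed.

(** * The kernel of the action of the symmetric group on tensors *)

Section PermutationOrder.
Variable M : nat.
Implicit Types (s t p : 'S_M) (I : {set 'I_M}).

Definition perm_lex s : M.-tuplelexi 'I_M := [tuple s i | i < M].

Lemma perm_lex_inj : injective perm_lex.
Proof.
move=> s t eq_st; apply/permP => i.
by have := congr1 (fun u : M.-tuple _ => tnth u i) eq_st; rewrite !tnth_mktuple.
Qed.

Lemma perm_lex_ltP s t : reflect
  (exists2 k : 'I_M, forall i : 'I_M, (i < k)%N -> s i = t i & (s k < t k)%N)
  (perm_lex s < perm_lex t)%O.
Proof.
apply: (iffP ltxi_tuplePlt) => -[k eq_st lt_st]; exists k.
- by move=> i /eq_st; rewrite !tnth_mktuple.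
- by move: lt_st; rewrite !tnth_mktuple ltEord.
- by move=> i /eq_st; rewrite !tnth_mktuple.
- by rewrite !tnth_mktuple ltEord.
Qed.

Definition perm_rank s := #|[set t | (perm_lex t < perm_lex s)%O]|.

Lemma leq_perm_rank s t : (perm_rank s <= perm_rank t)%N = (perm_lex s <= perm_lex t)%O.
Proof.
have rank_lt s' t' : (perm_lex s' < perm_lex t')%O -> (perm_rank s' < perm_rank t')%N.
  move=> lt_st; apply/proper_card/properP; split.
    by apply/subsetP => u; rewrite !inE => /lt_trans; apply.
  by exists s'; rewrite !inE ?lt_st ?ltxx.
apply/idP/idP => [|]; last first.
  by rewrite le_eqVlt => /predU1P[/perm_lex_inj->|/rank_lt/ltnW].
by rewrite leqNgt; apply: contraR; rewrite -ltNge => /rank_lt.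
Qed.

Definition decreasing_on s I := [forall i in I, forall j in I, (i < j)%N ==> (s j < s i)%N].

Lemma decreasing_onP s I : reflect
  (forall i j : 'I_M, i \in I -> j \in I -> (i < j)%N -> (s j < s i)%N) (decreasing_on s I).
Proof.
apply: (iffP forall_inP) => [decr i j iI jI|decr i iI].
  by move/forall_inP: (decr i iI) => /(_ j jI) /implyP.
by apply/forall_inP=> j jI; apply/implyP; apply: decr.
Qed.

Lemma decreasing_perm_lex_lt s I p :
  decreasing_on s I -> perm_on I p -> p != 1%g -> (perm_lex (p * s) < perm_lex s)%O.
Proof.
move=> /decreasing_onP decr pI np.
have [k fix_p lt_k] : exists2 k : 'I_M, forall i : 'I_M, (i < k)%N -> p i = i & (k < p k)%N.
  have := np; rewrite -(inj_eq perm_lex_inj) => /lt_total/orP[]/perm_lex_ltP[k eq_p lt_p];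
    rewrite perm1 in lt_p; last by exists k => // i /eq_p; rewrite perm1.
  have := eq_p _ lt_p; rewrite perm1 => /perm_inj e.
  by rewrite e ltnn in lt_p.
have kI : k \in I by apply: contraTT lt_k => /(out_perm pI)->; rewrite ltnn.
apply/perm_lex_ltP; exists k => [i /fix_p e|]; rewrite permM; first by rewrite e.
by apply: decr; rewrite ?(perm_closed _ pI).
Qed.

Lemma colouring_perm_lex_lt (T : finType) s t (a b : {ffun 'I_M -> T}) :
    (forall i j : 'I_M, (i < j)%N -> b i = b j -> (s i < s j)%N) ->
    b = permf a s -> b = permf a t -> s != t ->
  (perm_lex s < perm_lex t)%O.
Proof.
move=> incr bs bt; rewrite -(inj_eq perm_lex_inj) => /lt_total/orP[//|].
case/perm_lex_ltP => k eq_ts lt_ts; pose j := s^-1%g (t k).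
have sj : s j = t k by rewrite permKV.
have bjk : b k = b j by rewrite {1}bt bs !ffunE sj.
case: (ltngtP k j) => [/incr/(_ bjk)|jk|/val_inj kj].
- by rewrite sj ltnNge ltnW.
- by have := eq_ts j jk; rewrite sj => /perm_inj e; rewrite e ltnn in jk.
- by move: lt_ts; rewrite -sj -kj ltnn.
Qed.

Definition decreasing_ending s i I :=
  [&& decreasing_on s I, i \in I & [forall j in I, (j <= i)%N]].

Definition decreasing_length s i := (\max_(I | decreasing_ending s i I) #|I|)%N.

Lemma decreasing_ending_set1 s i : decreasing_ending s i [set i].
Proof.
apply/and3P; split; rewrite ?set11 //; last by apply/forall_inP => j /set1P->.
by apply/decreasing_onP => j k /set1P-> /set1P->; rewrite ltnn.
Qed.

Lemma decreasing_length_gt0 s i : (0 < decreasing_length s i)%N.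
Proof.
by apply: leq_trans (leq_bigmax_cond _ (decreasing_ending_set1 s i)); rewrite cards1.
Qed.

Lemma decreasing_length_le n s i : (forall I, #|I| = n.+1 -> ~~ decreasing_on s I) ->
  (decreasing_length s i <= n)%N.
Proof.
move=> nodecr; apply/bigmax_leqP=> I /and3P[/decreasing_onP decr _ _].
rewrite leqNgt; apply/negP=> big; pose J := [set x in take n.+1 (enum I)].
have JI : {subset J <= I} by move=> x; rewrite inE => /mem_take; rewrite mem_enum.
have cardJ : #|J| = n.+1.
  rewrite cardsE (card_uniqP _) ?take_uniq ?enum_uniq // size_takel //.
  by rewrite -cardE.
case/negP: (nodecr J cardJ); apply/decreasing_onP => j k /JI jI /JI kI.
exact: decr.
Qed.

Lemma decreasing_length_lt s (i j : 'I_M) : (i < j)%N -> (s j < s i)%N ->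
  (decreasing_length s i < decreasing_length s j)%N.
Proof.
move=> lt_ij lt_sji.
have ex_ending : (0 < #|decreasing_ending s i|)%N.
  by apply/card_gt0P; exists [set i]; apply: decreasing_ending_set1.
have [I endI lenI] := eq_bigmax_cond (fun I : {set 'I_M} => #|I|) ex_ending.
case/and3P: endI => /decreasing_onP decr iI /forall_inP max_i.
have jI : j \notin I by apply/negP=> /max_i; rewrite leqNgt lt_ij.
rewrite [decreasing_length s i]lenI; have := cardsU1 j I; rewrite jI add1n => <-.
apply: (leq_bigmax_cond (P := decreasing_ending s j)); apply/and3P; split.
- apply/decreasing_onP=> x y; rewrite !inE => /predU1P[->|xI] /predU1P[->|yI].
  + by rewrite ltnn.
  + by move=> h; have := max_i _ yI; lia.
  + move=> _; case: (ltngtP x i) (max_i _ xI) => // [h|/val_inj->] _ //.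
    exact: ltn_trans lt_sji (decr _ _ xI iI h).
  + exact: decr.
- by rewrite !inE eqxx.
- apply/forall_inP=> k; rewrite !inE => /predU1P[->//|/max_i h].
  exact: leq_trans h (ltnW lt_ij).
Qed.

Lemma increasing_colouring n s : (forall I, #|I| = n.+1 -> ~~ decreasing_on s I) ->
  exists b : {ffun 'I_M -> 'I_n}, forall i j : 'I_M, (i < j)%N -> b i = b j -> (s i < s j)%N.
Proof.
move=> nodecr.
have lt_len i : ((decreasing_length s i).-1 < n)%N.
  by rewrite prednK ?decreasing_length_gt0 // decreasing_length_le.
exists [ffun i => Ordinal (lt_len i)] => i j lt_ij; rewrite !ffunE => /(congr1 val)/= eq_len.
have {}eq_len : decreasing_length s i = decreasing_length s j.
  by rewrite -(prednK (decreasing_length_gt0 s i)) -(prednK (decreasing_length_gt0 s j)) eq_len.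
have nij : s i != s j by rewrite (inj_eq perm_inj); apply: contraTneq lt_ij => ->; rewrite ltnn.
rewrite ltn_neqAle nij leqNgt; apply/negP => /(decreasing_length_lt lt_ij).
by rewrite eq_len ltnn.
Qed.

End PermutationOrder.

Section TensorKernel.
Variables (F : fieldType) (M n : nat).
Hypothesis charF0 : has_pchar0 F.
Implicit Types (s t p : 'S_M) (I : {set 'I_M}) (c : {ffun 'S_M -> F}).

Definition kills_tensors c := forall a b : {ffun 'I_M -> 'I_n},
  \sum_s c s * (b == permf a s)%:R = 0.

Lemma kills_tensors_sum c : kills_tensors c ->
  forall (Y : {ffun 'I_M -> 'I_n} -> F) a, \sum_s c s * Y (permf a s) = 0.
Proof.
move=> c0 Y a.
transitivity (\sum_b Y b * \sum_s c s * (b == permf a s)%:R); last first.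
  by rewrite big1 // => b _; rewrite c0 mulr0.
under [RHS]eq_bigr do rewrite mulr_sumr; rewrite exchange_big; apply: eq_bigr => s _ /=.
rewrite -(sum_eq_mul (permf a s) Y) mulr_sumr; apply: eq_bigr => b _.
by rewrite mulrA mulrC.
Qed.

Definition antisymmetrizer I t : {ffun 'S_M -> F} :=
  [ffun s => if perm_on I (s * t^-1)%g then (-1) ^+ odd_perm (s * t^-1)%g else 0].

Lemma sum_antisymmetrizer I t (X : 'S_M -> F) : \sum_s antisymmetrizer I t s * X s =
  \sum_(p | perm_on I p) (-1) ^+ odd_perm p * X (p * t)%g.
Proof.
rewrite (reindex_inj (mulIg t)) [RHS]big_mkcond /=; apply: eq_bigr => p _.
by rewrite ffunE mulgK; case: ifP => //; rewrite mul0r.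
Qed.

(* Two of the [n.+1] indices in [I] carry the same value of [a]. *)
Lemma antisymmetrizer_kills_tensors I t : #|I| = n.+1 -> kills_tensors (antisymmetrizer I t).
Proof.
move=> cardI a b; rewrite sum_antisymmetrizer.
have [i [j [iI jI nij eq_ij]]] : exists i j, [/\ i \in I, j \in I, i != j & a (t i) = a (t j)].
  pose g (x : {x | x \in I}) := a (t (val x)).
  have : ~~ injectiveb g.
    by apply/negP=> /injectiveP/leq_card; rewrite card_sig cardI card_ord ltnn.
  case/injectivePn=> -[i iI] [[j jI]] nij e.
  by exists i, j; split=> //; apply: contraNneq nij => e'; apply/eqP/val_inj.
set S := \sum_(p | _) _.
have : S = - S.
  rewrite {1}/S (reindex_inj (mulIg (tperm i j))) /= /S -sumrN.
  have tI : perm_on I (tperm i j).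
    by apply/subsetP=> x; rewrite inE; case: tpermP => [->|->|]; rewrite ?eqxx.
  apply: eq_big => p.
    apply/idP/idP => pI; last exact: perm_onM.
    by rewrite -[p](mulgK (tperm i j)) perm_onM // tpermV.
  move=> _; rewrite odd_permM odd_tperm nij addbT -mulNr; congr (_ * _).
    by case: odd_perm; rewrite ?opprK.
  congr (b == _)%:R; apply/ffunP => x.
  by rewrite !ffunE !permM; case: tpermP => // ->.
move/eqP; rewrite -subr_eq0 opprK -mulr2n -mulr_natl mulf_eq0.
by rewrite (negPf (natr_neq0_pchar0 charF0 _)) // => /eqP.
Qed.

Lemma kills_tensors_lead_decreasing c s : kills_tensors c -> c s != 0 ->
    (forall t, c t != 0 -> (perm_lex t <= perm_lex s)%O) ->
  exists2 I : {set 'I_M}, #|I| = n.+1 & decreasing_on s I.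
Proof.
move=> c0 cs max_s.
case: (pickP (fun I : {set 'I_M} => (#|I| == n.+1) && decreasing_on s I)) => [I|nodecr].
  by case/andP => /eqP cardI decr; exists I.
have [|b incr] := @increasing_colouring _ n s.
  by move=> I cardI; have := nodecr I; rewrite cardI eqxx /= => ->.
pose a := permf b s^-1; have bs : b = permf a s by rewrite -permfM mulgV permf1.
case/eqP: cs; rewrite -[RHS](c0 a b) (bigD1 s) //= -bs eqxx mulr1 big1 ?addr0 // => t nts.
case: (eqVneq b (permf a t)) => [bt|]; last by rewrite mulr0.
apply/eqP; rewrite mulr1; apply: contraT => /max_s.
by rewrite leNgt (colouring_perm_lex_lt incr bs bt) // eq_sym.
Qed.

Theorem tensor_kernel (Z : {ffun 'S_M -> F} -> Prop) :
  Z 0 -> (forall c c', Z c -> Z c' -> Z (c + c')) ->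
  (forall k c, Z c -> Z [ffun s => k * c s]) ->
  (forall I t, #|I| = n.+1 -> Z (antisymmetrizer I t)) -> forall c, kills_tensors c -> Z c.
Proof.
move=> Z0 ZD ZZ Zantisym c c0.
have [k] : exists k, forall s, c s != 0 -> (perm_rank s < k)%N.
  by exists #|{: 'S_M}|.+1 => s _; rewrite ltnS max_card.
elim: k c c0 => [|k IH] c c0 rank_c.
  suff -> : c = 0 by [].
  by apply/ffunP=> s; rewrite ffunE; apply/eqP; apply: contraT => /rank_c.
case: (pickP (fun s => (c s != 0) && (perm_rank s == k))) => [s /andP[cs /eqP rank_s]|none].
  have max_s t : c t != 0 -> (perm_lex t <= perm_lex s)%O.
    by move=> /rank_c; rewrite ltnS -rank_s leq_perm_rank.
  have [I cardI decr] := kills_tensors_lead_decreasing c0 cs max_s.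
  pose lead : {ffun 'S_M -> F} := [ffun t => c s * antisymmetrizer I s t].
  rewrite -[c](subrK lead); apply: ZD; last exact/ZZ/Zantisym.
  apply: IH => [a b|t].
    under eq_bigr do rewrite 3!ffunE mulrBl -mulrA.
    by rewrite sumrB c0 sub0r -mulr_sumr antisymmetrizer_kills_tensors // mulr0 oppr0.
  rewrite !ffunE -rank_s => nz; rewrite ltnNge leq_perm_rank -ltNge.
  have [e|nts] := eqVneq t s.
    by rewrite e mulgV perm_on1 odd_perm1 mulr1 subrr eqxx in nz.
  have [ct|/max_s] := eqVneq (c t) 0; last first.
    by rewrite le_eqVlt (inj_eq (@perm_lex_inj M)) (negPf nts).
  move: nz; rewrite ct; case: ifP => [onI _|]; last by rewrite mulr0 subrr eqxx.
  rewrite -[t](mulgKV s); apply: decreasing_perm_lex_lt decr onI _.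
  by apply: contraNneq nts => e; rewrite -[t](mulgKV s) e mul1g.
apply: IH => // s cs; have := rank_c s cs; rewrite ltnS leq_eqVlt.
by have := none s; rewrite cs /= => ->.
Qed.

End TensorKernel.

(** * Products of traces along the cycles of a permutation *)

Section LiftPerm.
Variables (M : nat) (j : 'I_M.+1).

Lemma lift_perm_fix (s : 'S_M.+1) : s j = j -> exists r, s = lift_perm j j r.
Proof.
move=> sj; have [r rE] : exists r : 'I_M -> 'I_M, forall i, s (lift j i) = lift j (r i).
  apply: (@fin_all_exists _ (fun=> 'I_M) (fun i x => s (lift j i) = lift j x)) => i.
  have [k ->|] := unliftP j (s (lift j i)); first by exists k.
  by rewrite -[RHS]sj => /perm_inj/eqP; rewrite eq_sym (negPf (neq_lift _ _)).
have inj_r : injective r.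
  by move=> i i' e; apply/(@lift_inj _ j)/(@perm_inj _ s); rewrite !rE e.
exists (perm inj_r); apply/permP => i; case: (unliftP j i) => [k ->|->].
  by rewrite lift_perm_lift permE rE.
by rewrite lift_perm_id.
Qed.

Variant lift_perm_spec : 'S_M.+1 -> Prop :=
  | LiftPermFix r : lift_perm_spec (lift_perm j j r)
  | LiftPermCut r i : lift_perm_spec (lift_perm j j r * tperm j (lift j i)).

Lemma lift_permP s : lift_perm_spec s.
Proof.
have [r rE] : exists r, (s * tperm j (s j))%g = lift_perm j j r.
  by apply: lift_perm_fix; rewrite permM tpermR.
have -> : s = (lift_perm j j r * tperm j (s j))%g by rewrite -rE -mulgA tperm2 mulg1.
have [i ->|->] := unliftP j (s j); first exact: LiftPermCut.
by rewrite tperm1 mulg1; apply: LiftPermFix.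
Qed.

Lemma perm_on_lift_perm (I : {set 'I_M.+1}) p :
  perm_on I (lift_perm j j p) = perm_on (lift j @^-1: I) p.
Proof.
apply/subsetP/subsetP => pI i; rewrite !inE => ni.
  by apply: pI; rewrite inE lift_perm_lift (inj_eq lift_inj).
case: (unliftP j i) ni => [k ->|->]; last by rewrite lift_perm_id eqxx.
by rewrite lift_perm_lift (inj_eq lift_inj) => nk; have := pI k; rewrite !inE; apply.
Qed.

Lemma lift_perm_inj : injective (lift_perm j j).
Proof.
move=> s t e; apply/permP => i; apply: (@lift_inj _ j).
by rewrite -!(lift_perm_lift j) e.
Qed.

Lemma sum_perm_on_lift (R : nmodType) (I : {set 'I_M.+1}) (X : 'S_M.+1 -> R) : j \notin I ->
  \sum_(s | perm_on I s) X s = \sum_(r | perm_on (lift j @^-1: I) r) X (lift_perm j j r).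
Proof.
move=> jI; pose down (s : 'S_M.+1) := odflt 1%g [pick r | lift_perm j j r == s].
rewrite (reindex_onto (lift_perm j j) down) => [|s sI].
  apply: eq_bigl => r; rewrite perm_on_lift_perm /down; case: pickP => [t /eqP/lift_perm_inj->|].
    by rewrite eqxx andbT.
  by move/(_ r); rewrite eqxx.
have [r ->] := lift_perm_fix (out_perm sI jI).
by rewrite /down; case: pickP => [t /eqP|/(_ r)]; rewrite ?eqxx.
Qed.

Lemma card_preim_lift (I : {set 'I_M.+1}) : j \notin I -> #|lift j @^-1: I| = #|I|.
Proof.
move=> jI; rewrite -(card_imset _ (@lift_inj _ j)); apply: eq_card => i.
apply/imsetP/idP => [[k]|iI]; first by rewrite inE => kI ->.
case: (unliftP j i) iI => [k ->|->] iI; last by rewrite iI in jI.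
by exists k; rewrite ?inE.
Qed.

Variable T : finType.

Definition insert_ffun (x : T) (b : {ffun 'I_M -> T}) : {ffun 'I_M.+1 -> T} :=
  [ffun i => oapp b x (unlift j i)].

Lemma insert_ffun_id x b : insert_ffun x b j = x.
Proof. by rewrite ffunE unlift_none. Qed.

Lemma insert_ffun_lift x b i : insert_ffun x b (lift j i) = b i.
Proof. by rewrite ffunE liftK. Qed.

Lemma sum_insert_ffun (R : nmodType) (G : {ffun 'I_M.+1 -> T} -> R) :
  \sum_a G a = \sum_x \sum_b G (insert_ffun x b).
Proof.
rewrite pair_bigA [LHS](reindex (fun xb => insert_ffun xb.1 xb.2)) //=.
exists (fun a => (a j, [ffun i => a (lift j i)])) => [[x b]|a] _ /=.
  by rewrite insert_ffun_id; congr (_, _); apply/ffunP => i; rewrite ffunE insert_ffun_lift.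
apply/ffunP => i; case: (unliftP j i) => [k ->|->]; first by rewrite insert_ffun_lift ffunE.
by rewrite insert_ffun_id.
Qed.

End LiftPerm.

Section MatrixWords.
Variables (R : comPzRingType) (d : nat) (I : Type).
Implicit Types (H : I -> 'M[R]_d) (w : seq I).

Definition mx_word H w : 'M[R]_d := foldr (fun i A => H i *m A) 1%:M w.

Lemma mx_word_cat H w w' : mx_word H (w ++ w') = mx_word H w *m mx_word H w'.
Proof. by elim: w => [|i w IH] /=; rewrite ?mul1mx // IH mulmxA. Qed.

Lemma mx_word_rcons H w i : mx_word H (rcons w i) = mx_word H w *m H i.
Proof. by rewrite -cats1 mx_word_cat /= mulmx1. Qed.

Lemma eq_mx_word H H' w : H =1 H' -> mx_word H w = mx_word H' w.
Proof. by move=> eqH; elim: w => //= i w ->; rewrite eqH. Qed.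

End MatrixWords.

Lemma mx_word_map (R : comPzRingType) d (I J : Type) (h : I -> J) (H : J -> 'M[R]_d) w :
  mx_word H (map h w) = mx_word (H \o h) w.
Proof. by elim: w => //= i w ->. Qed.

Lemma eq_in_mx_word (R : comPzRingType) d (I : eqType) (H H' : I -> 'M[R]_d) w :
  {in w, H =1 H'} -> mx_word H w = mx_word H' w.
Proof.
elim: w => //= i w IH eqH; rewrite eqH ?mem_head // IH // => k kw; apply: eqH.
by rewrite inE kw orbT.
Qed.

Section PermTrace.
Variables (R : comPzRingType) (d : nat).

(* The sum is the product of [\tr (H i *m H (s i) *m H (s (s i)) *m ...)] over the
   cycles of [s]; see [perm_trace_porbits]. *)
Definition perm_trace M (s : 'S_M) (H : 'I_M -> 'M[R]_d) : R :=
  \sum_(a : {ffun 'I_M -> 'I_d}) \prod_i H i (a i) (a (s i)).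

Lemma eq_perm_trace M (s : 'S_M) H H' : H =1 H' -> perm_trace s H = perm_trace s H'.
Proof. by move=> e; apply: eq_bigr => a _; apply: eq_bigr => i _; rewrite e. Qed.

Lemma perm_trace_conj M (s t : 'S_M) H : perm_trace (s ^ t) H = perm_trace s (H \o t).
Proof.
rewrite /perm_trace (reindex _ (onW_bij _ (permf_bij _ t^-1))) /=; apply: eq_bigr => a _.
rewrite (reindex_inj (@perm_inj _ t)) /=; apply: eq_bigr => i _.
by rewrite !ffunE conjgE !permM !permK.
Qed.

Lemma perm_trace_lift M (j : 'I_M.+1) (r : 'S_M) H :
  perm_trace (lift_perm j j r) H = \tr (H j) * perm_trace r (H \o lift j).
Proof.
rewrite /perm_trace (sum_insert_ffun j) /mxtrace mulr_suml; apply: eq_bigr => x _.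
rewrite mulr_sumr; apply: eq_bigr => b _; rewrite (bigD1_ord j) //=.
rewrite lift_perm_id insert_ffun_id; congr (_ * _).
by apply: eq_bigr => i _; rewrite lift_perm_lift !insert_ffun_lift.
Qed.

Lemma perm_trace_cut M (j : 'I_M.+1) (r : 'S_M) (i : 'I_M) H :
  perm_trace (lift_perm j j r * tperm j (lift j i)) H =
  perm_trace r (fun k => if k == i then H j *m H (lift j i) else H (lift j k)).
Proof.
rewrite /perm_trace (reindex _ (onW_bij _ (permf_bij _ (tperm j (lift j i))))) /=.
rewrite (sum_insert_ffun j) exchange_big; apply: eq_bigr => b _ /=.
rewrite (bigD1 i) //= eqxx mxE mulr_suml; apply: eq_bigr => x _.
rewrite (bigD1_ord j) //= (bigD1 i) //= !permfE !permM !tpermK mulrA.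
rewrite tpermL tpermR lift_perm_id lift_perm_lift insert_ffun_id !insert_ffun_lift.
congr (_ * _); apply: eq_bigr => k ki; rewrite (negPf ki) !permfE permM tpermK.
by rewrite tpermD ?neq_lift ?(inj_eq lift_inj) 1?eq_sym // lift_perm_lift !insert_ffun_lift.
Qed.

Lemma perm_trace_merge M (s : 'S_M) H H' j : s j != j ->
    H j *m H (s j) = H' j *m H' (s j) -> (forall i, i != j -> i != s j -> H i = H' i) ->
  perm_trace s H = perm_trace s H'.
Proof.
case: M s H H' j => [|M] s H H' j; first by case: j.
case: (lift_permP j s) => [r|r i]; first by rewrite lift_perm_id eqxx.
rewrite permM lift_perm_id tpermL => nij eq_mul eqH; rewrite !perm_trace_cut eq_mul.
apply: eq_perm_trace => k; case: eqVneq => // ki; apply: eqH.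
  by rewrite eq_sym neq_lift.
by rewrite (inj_eq lift_inj).
Qed.

End PermTrace.

Lemma porbit_constant (T : finType) (U : eqType) (s : {perm T}) (y : T) (a : T -> U) :
    {in porbit s y, forall i, i != y -> a (s i) = a i} ->
  {in porbit s y, forall i, a i = a y}.
Proof.
move=> eq_a i; rewrite -porbitV => /porbitP[k ->]; elim: k => [|k IH].
  by rewrite expg0 perm1.
set i' := (s^-1 ^+ k.+1)%g y; have si : s i' = (s^-1 ^+ k)%g y.
  by rewrite /i' expgSr permM permKV.
case: (eqVneq i' y) => [->//|ni]; rewrite -eq_a // ?si //.
by rewrite -porbitV; apply: mem_porbit.
Qed.

Lemma perm_mem_porbit (T : finType) (s : {perm T}) (y i : T) :
  (s i \in porbit s y) = (i \in porbit s y).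
Proof. by rewrite porbit_sym -[s]expg1 porbit_perm expg1 porbit_sym. Qed.

Lemma porbits_eq (T : finType) (s : {perm T}) (x : T) (O : {set T}) :
  O \in porbits s -> x \in O -> porbit s x = O.
Proof. by case/imsetP=> z _ ->; rewrite -eq_porbit_mem => /eqP. Qed.

Lemma mxtrace_delta (R : pzSemiRingType) d (p q : 'I_d) :
  \tr (delta_mx p q : 'M[R]_d) = (p == q)%:R.
Proof.
rewrite /mxtrace; under eq_bigr do rewrite mxE -mulnb natrM.
by rewrite sum_eq_mul.
Qed.

Lemma mx_word_idem (R : comPzRingType) d (I : Type) (E : 'M[R]_d) (w : seq I) : E *m E = E ->
  (0 < size w)%N -> mx_word (fun=> E) w = E.
Proof.
move=> EE; elim: w => // i w IH _; case: w IH => [|k w] IH /=; first by rewrite mulmx1.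
by rewrite -[RHS]EE; congr (_ *m _); apply: IH.
Qed.

Section PermTraceOrbit.
Variables (R : comPzRingType) (d M : nat) (s : 'S_M).
Implicit Types (H : 'I_M -> 'M[R]_d) (a : {ffun 'I_M -> 'I_d}).

Lemma perm_trace_traject H x k : (k < #|porbit s x|)%N ->
  perm_trace s H = perm_trace s (fun i => if i \in traject s x k then 1%:M else
    if i == iter k s x then mx_word H (traject s x k.+1) else H i).
Proof.
have uniq_orbit := uniq_traject_porbit s x.
elim: k => [|k IH] lt.
  by apply: eq_perm_trace => i /=; case: eqP => // ->; rewrite mulmx1.
rewrite IH; last exact: ltnW.
have : uniq (traject s x k.+2).
  have -> : traject s x k.+2 = take k.+2 (traject s x #|porbit s x|) by rewrite take_traject.
  exact: take_uniq.
rewrite trajectSr rcons_uniq => /andP[ny]; rewrite trajectSr rcons_uniq => /andP[nj _].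
rewrite trajectSr mem_rcons inE negb_or in ny; case/andP: ny => nyj nyk.
set j := iter k s x in nj nyj nyk *; rewrite -[iter k.+1 s x]/(s j) in nyj nyk *.
rewrite (mx_word_rcons _ _ (s j)); move: (mx_word H (rcons _ j)) => W.
apply: (perm_trace_merge (j := j)) => //=.
  by rewrite !mem_rcons !inE !eqxx (negPf nj) (negPf nyj) (negPf nyk) /= mul1mx.
by move=> i ni niy; rewrite mem_rcons inE (negPf ni) (negPf niy).
Qed.

Variables (j0 : 'I_d) (y : 'I_M).
Local Notation O := (porbit s y).
Local Notation offdiag_prod H a := (\prod_(i | i \notin O) H i (a i) (a (s i))).

Lemma prod_porbit_mx1 H a : {in O, forall i, i != y -> H i = 1%:M} ->
  \prod_(i in O) H i (a i) (a (s i)) = [forall i in O, a i == a y]%:R * H y (a y) (a y).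
Proof.
move=> H1; case: (boolP [forall i in O, a i == a y]) => [/forall_inP const|/forall_inP nconst].
  rewrite mul1r (bigD1 y) ?porbit_id //= (eqP (const _ _)) ?perm_mem_porbit ?porbit_id //.
  rewrite big1 ?mulr1 // => i /andP[iO ni].
  by rewrite H1 // mxE !(eqP (const _ _)) ?eqxx ?perm_mem_porbit.
have [i /and3P[iO niy nai]] : exists i, [&& i \in O, i != y & a (s i) != a i].
  apply/existsP; apply: contra_notT nconst; rewrite negb_exists => /forallP eq_a i iO.
  apply/eqP; apply: porbit_constant iO => k kO nk; apply/eqP.
  by have := eq_a k; rewrite kO nk /= negbK.
by rewrite mul0r (bigD1 i) //= H1 // mxE eq_sym (negPf nai) mul0r.
Qed.

Lemma sum_offdiag_prod H x :
  \sum_(a : {ffun 'I_M -> 'I_d} | [forall i in O, a i == x]) offdiag_prod H a =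
  \sum_(a : {ffun 'I_M -> 'I_d} | [forall i in O, a i == j0]) offdiag_prod H a.
Proof.
pose sw a : {ffun 'I_M -> 'I_d} := [ffun i => if i \in O then tperm x j0 (a i) else a i].
have swK : involutive sw.
  by move=> a; apply/ffunP=> i; rewrite !ffunE; case: (i \in O); rewrite ?tpermK.
rewrite (reindex_inj (inv_inj swK)) /=; apply: eq_big => a.
  apply: eq_forallb => i; case: (boolP (i \in O)) => //= iO.
  by rewrite ffunE iO -{2}(tpermR x j0) (inj_eq perm_inj).
by move=> _; apply: eq_bigr => i niO; rewrite !ffunE perm_mem_porbit (negPf niO).
Qed.

Lemma perm_trace_porbit_mx1 H : {in O, forall i, i != y -> H i = 1%:M} ->
  perm_trace s H =
    \tr (H y) * \sum_(a : {ffun 'I_M -> 'I_d} | [forall i in O, a i == j0]) offdiag_prod H a.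
Proof.
move=> H1; rewrite /mxtrace mulr_suml.
transitivity (\sum_(a : {ffun 'I_M -> 'I_d} | [forall i in O, a i == a y])
    H y (a y) (a y) * offdiag_prod H a).
  rewrite [RHS]big_mkcond; apply: eq_bigr => a _.
  rewrite (bigID [in O]) /= prod_porbit_mx1 //.
  by case: ifP => _; rewrite ?mul1r ?mul0r.
rewrite (partition_big (fun a : {ffun 'I_M -> 'I_d} => a y) xpredT) //=.
apply: eq_bigr => x _; rewrite -(sum_offdiag_prod H x) mulr_sumr; apply: eq_big => a.
  apply/andP/forall_inP => [[/forall_inP const /eqP <-]//|const].
  by have /eqP ay := const y (porbit_id _ _); rewrite ay; split=> //; apply/forall_inP.
by case/andP=> _ /eqP ->.
Qed.

End PermTraceOrbit.

Section PermTracePorbits.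
Variables (R : comPzRingType) (d M : nat) (s : 'S_M).
Implicit Types H : 'I_M -> 'M[R]_d.

Lemma perm_trace_porbit (j0 : 'I_d) H x : perm_trace s H =
  \tr (mx_word H (traject s x #|porbit s x|)) *
    perm_trace s (fun i => if i \in porbit s x then delta_mx j0 j0 else H i).
Proof.
set k := #|porbit s x|; have k0 : (0 < k)%N by rewrite lt0n card_porbit_neq0.
pose y := iter k.-1 s x.
have orbit_y : porbit s y = porbit s x by rewrite /y -permX porbit_perm.
have traj : traject s x k = rcons (traject s x k.-1) y by rewrite -trajectSr prednK.
have factor H' : perm_trace s H' = \tr (mx_word H' (traject s x k)) *
    \sum_(a : {ffun 'I_M -> 'I_d} | [forall i in porbit s x, a i == j0])
    \prod_(i | i \notin porbit s x) H' i (a i) (a (s i)).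
  rewrite (@perm_trace_traject _ _ _ _ H' x k.-1) ?prednK //.
  rewrite (perm_trace_porbit_mx1 j0 (y := y)) orbit_y => [|i].
    have := uniq_traject_porbit s x; rewrite -/k traj rcons_uniq => /andP[/negPf-> _].
    rewrite eqxx; congr (_ * _); apply: eq_bigr => a _; apply: eq_bigr => i.
    rewrite porbit_traject -/k traj mem_rcons inE negb_or => /andP[ny nt].
    by rewrite (negPf nt) (negPf ny).
  by rewrite porbit_traject -/k traj mem_rcons inE => /orP[->//|-> //].
rewrite factor [in RHS]factor; congr (_ * _); rewrite (_ : mx_word _ _ = delta_mx j0 j0).
  rewrite mxtrace_delta eqxx mul1r; apply: eq_bigr => a _; apply: eq_bigr => i /negPf.
  by move=> ->.
rewrite (eq_in_mx_word (H' := fun=> delta_mx j0 j0)) => [|i]; last first.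
  by rewrite -porbit_traject => ->.
by rewrite mx_word_idem ?size_traject // mul_delta_mx.
Qed.

Variable x : {set 'I_M} -> 'I_M.
Hypothesis xP : forall O, O \in porbits s -> x O \in O.

Let porbit_x O (Os : O \in porbits s) : porbit s (x O) = O := porbits_eq Os (xP Os).

Lemma perm_trace_some_porbits (j0 : 'I_d) H (r : seq {set 'I_M}) :
    uniq r -> {subset r <= porbits s} ->
  perm_trace s H = \prod_(O <- r) \tr (mx_word H (traject s (x O) #|O|)) *
    perm_trace s (fun i => if porbit s i \in r then delta_mx j0 j0 else H i).
Proof.
elim: r => [|O r IH] /=; first by rewrite big_nil mul1r.
move=> /andP[nO ur] sub; have Os : O \in porbits s by apply: sub; rewrite mem_head.
rewrite IH //; last by move=> O' h; apply: sub; rewrite inE h orbT.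
rewrite big_cons (perm_trace_porbit j0 _ (x O)) porbit_x // mulrCA mulrA.
congr (\tr _ * _ * _).
  apply: eq_in_mx_word => i; have -> : #|O| = #|porbit s (x O)| by rewrite porbit_x.
  by rewrite -porbit_traject -eq_porbit_mem porbit_x // => /eqP ->; rewrite (negPf nO).
apply: eq_perm_trace => i; rewrite inE -[in X in _ = if X || _ then _ else _](porbit_x Os).
by rewrite eq_porbit_mem porbit_x //; case: (i \in O).
Qed.

Theorem perm_trace_porbits H :
  perm_trace s H = \prod_(O in porbits s) \tr (mx_word H (traject s (x O) #|O|)).
Proof.
have [d0|[j0 _]] := set_0Vmem [set: 'I_d].
  have no_index : 'I_d -> False by move=> j; have := in_setT j; rewrite d0 inE.
  case: (pickP [pred i : 'I_M | true]) => [i _|M0].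
    rewrite [LHS]big1 => [|a]; last by case: (no_index (a i)).
    by rewrite (bigD1 (porbit s i)) ?imset_f //= /mxtrace big1 ?mul0r // => j; case: (no_index j).
  rewrite big_pred0 => [|O]; last by apply/imsetP => -[i]; have := M0 i.
  rewrite /perm_trace (eq_bigr (fun=> 1)) => [|a _]; last by rewrite big1 // => i; have := M0 i.
  by rewrite sumr_const card_ffun (eq_card0 M0).
have sub : {subset enum (porbits s) <= porbits s} by move=> O; rewrite mem_enum.
rewrite (perm_trace_some_porbits j0 _ (enum_uniq _) sub) big_enum.
rewrite [X in _ * X](_ : _ = 1) ?mulr1 //.
rewrite (eq_perm_trace _ (H' := fun=> delta_mx j0 j0)) => [|i]; last by rewrite mem_enum imset_f.
rewrite /perm_trace (bigD1 [ffun=> j0]) //= big1 => [|i _]; last by rewrite !ffunE mxE eqxx.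
rewrite big1 ?addr0 // => a /ffun_neqP[i]; rewrite ffunE => ni.
by rewrite (bigD1 i) //= mxE (negPf ni) mul0r.
Qed.

End PermTracePorbits.

(** * Evaluation of quasi-polynomials *)

Definition entries (R : Type) (I : Type) n (A : I -> 'M[R]_n) (v : I * 'I_n * 'I_n) : R :=
  A v.1.1 v.1.2 v.2.

Section Evaluation.
Variables (F : fieldType) (n : nat).
Implicit Types (P Q : quasipoly F n) (w : word) (A : nat -> 'M[F]_n).

(* The coefficients are evaluated at [A], the words at [B]; [qeval A] is [eval2 A A]. *)
Definition eval2 A d (B : nat -> 'M[F]_d) P : 'M[F]_d :=
  \sum_(t <- P) (t.1.1 * \prod_(v <- t.1.2) entries A v) *: mx_word B t.2.

Lemma sum_gword A w i j :
  \sum_(m <- gword w i j) \prod_(v <- m) entries A v = mx_word A w i j.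
Proof.
elim: w i => [|k w IH] i /=.
  by rewrite mxE; case: eqP => _; rewrite ?big_seq1 ?big_nil.
rewrite big_flatten /= big_map /= mxE big_enum; apply: eq_bigr => l _.
by rewrite big_map -IH mulr_sumr; apply: eq_bigr => m _; rewrite big_cons.
Qed.

Section FixedPoint.
Variables (A : nat -> 'M[F]_n) (d : nat) (B : nat -> 'M[F]_d).
Local Notation ev := (eval2 A B).

Lemma eval2_zero : ev (qzero F n) = 0. Proof. exact: big_nil. Qed.

Lemma eval2_add P Q : ev (qadd P Q) = ev P + ev Q.
Proof. exact: big_cat. Qed.

Lemma eval2_scale c P : ev (qscale c P) = c *: ev P.
Proof.
by rewrite /eval2 big_map scaler_sumr; apply: eq_bigr => t _; rewrite scalerA mulrA.
Qed.

Lemma eval2_mul P Q : ev (qmul P Q) = ev P *m ev Q.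
Proof.
rewrite /eval2 big_allpairs_dep /= mulmx_suml; apply: eq_bigr => s _.
rewrite mulmx_sumr; apply: eq_bigr => t _; rewrite mx_word_cat big_cat /=.
by rewrite -scalemxAl -scalemxAr scalerA mulrACA.
Qed.

Lemma eval2_const c : ev (qconst n c) = c%:M.
Proof. by rewrite /eval2 big_seq1 big_nil mulr1 scale_scalar_mx mulr1. Qed.

Lemma eval2_word w : ev (qword F n w) = mx_word B w.
Proof. by rewrite /eval2 big_seq1 big_nil mulr1 scale1r. Qed.

Lemma eval2_sum (I : Type) (r : seq I) (f : I -> quasipoly F n) :
  ev (qsum [seq f i | i <- r]) = \sum_(i <- r) ev (f i).
Proof.
elim: r => [|i r IH]; first by rewrite big_nil eval2_zero.
by rewrite /= eval2_add IH big_cons.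
Qed.

Lemma eval2_Phi P i j : ev (qPhi P i j) = (eval2 A A P i j)%:M.
Proof.
rewrite /eval2 /qPhi big_flatten big_map summxE raddf_sum; apply: eq_bigr => t _.
rewrite big_map mxE -sum_gword /= -scaler_suml scale_scalar_mx mulr1; congr (_%:M).
by rewrite mulr_sumr; apply: eq_bigr => m _; rewrite big_cat /= mulrA.
Qed.

Lemma eval2_tr w : ev (qtr F n w) = (\tr (mx_word A w))%:M.
Proof.
rewrite /qtr eval2_sum raddf_sum big_enum; apply: eq_bigr => i _ /=.
by rewrite eval2_Phi /eval2 big_seq1 big_nil mulr1 scale1r.
Qed.

Lemma eval2_subst (H : nat -> quasipoly F n) P :
  ev (qsubst H P) = eval2 (fun k => eval2 A A (H k)) (fun k => ev (H k)) P.
Proof.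
rewrite /qsubst eval2_sum; apply: eq_bigr => t _.
rewrite eval2_scale eval2_mul -scalerA; congr (_ *: _).
have -> : ev (qprod [seq H k | k <- t.2]) = mx_word (fun k => ev (H k)) t.2.
  by elim: t.2 => [|k w IH] /=; rewrite ?eval2_const // eval2_mul IH.
rewrite -mul_scalar_mx; congr (_ *m _).
elim: t.1.2 => [|v m IH] /=; first by rewrite big_nil eval2_const.
by rewrite eval2_mul IH eval2_Phi big_cons scalar_mxM.
Qed.

Lemma eval2_is_coef P : is_coef P -> ev P = (term_eval (entries A) [seq t.1 | t <- P])%:M.
Proof.
move=> /allP Pc; rewrite /eval2 /term_eval big_map raddf_sum [LHS]big_seq [RHS]big_seq.
by apply: eq_bigr => t /Pc /eqP ->; rewrite /= scale_scalar_mx mulr1.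
Qed.

End FixedPoint.

Definition trace_compatible A d (B : nat -> 'M[F]_d) :=
  forall w, w != [::] -> \tr (mx_word A w) = \tr (mx_word B w).

(* [path_mx w] is the family of transition matrices of the automaton reading [w]. *)
Definition path_mx w (k : nat) : 'M[F]_((size w).+1) :=
  \matrix_(i, j) ((j == i.+1 :> nat) && (nth 0%N w i == k))%:R.

Lemma mx_word_path w w' (i j : 'I_(size w).+1) : mx_word (path_mx w) w' i j =
  ((j == i + size w' :> nat)%N && (take (size w') (drop i w) == w'))%:R.
Proof.
elim: w' i => [|k w' IH] i /=.
  by rewrite mxE addn0 take0 andbT eq_sym.
rewrite mxE; case: (ltnP i (size w)) => hi.
  have lt_i : (i.+1 < (size w).+1)%N by [].
  rewrite (bigD1 (Ordinal lt_i)) //= big1 ?addr0 => [|l nl]; last first.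
    rewrite mxE; case: eqP => [e|]; last by rewrite mul0r.
    by case/eqP: nl; apply: val_inj.
  rewrite IH mxE /= eqxx (drop_nth 0%N hi) /= eqseq_cons addnS addSn /=.
  by case: (_ == k); case: (_ == _) => /=; rewrite ?mul1r ?mul0r ?andbF.
rewrite big1 => [|l _].
  by case: eqP => // e; have := ltn_ord j; lia.
rewrite mxE; case: eqP => [e|]; last by rewrite mul0r.
by have := ltn_ord l; rewrite e ltnS ltnNge hi.
Qed.

Lemma mx_word_block d A (N : nat -> 'M[F]_d) w :
  mx_word (fun k => block_mx (A k) 0 0 (N k)) w = block_mx (mx_word A w) 0 0 (mx_word N w).
Proof.
elim: w => [|k w IH] /=; first by rewrite -scalar_mx_block.
by rewrite IH mulmx_block !(mul0mx, mulmx0, addr0, add0r).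
Qed.

Definition path_extension A w k := block_mx (A k) 0 0 (path_mx w k).

Lemma trace_compatible_path A w : trace_compatible A (path_extension A w).
Proof.
move=> w' nw; rewrite mx_word_block mxtrace_block [X in _ + X]big1 ?addr0 // => i _.
rewrite mx_word_path; case: eqP => // e; case: w' nw e => //= k w' _; lia.
Qed.

Lemma eval2_path_entry A w P :
  eval2 A (path_extension A w) P (rshift n ord0) (rshift n ord_max) =
  term_eval (entries A) [seq t.1 | t <- P & t.2 == w].
Proof.
rewrite /eval2 summxE /term_eval big_map big_filter [RHS]big_mkcond; apply: eq_bigr => t _.
rewrite mxE mx_word_block block_mxEdr mx_word_path /= add0n drop0.
have -> : (size w == size t.2) && (take (size t.2) w == t.2) = (t.2 == w).
  apply/andP/eqP => [[/eqP <-]|->]; first by rewrite take_size => /eqP.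
  by rewrite take_size !eqxx.
by case: eqP => _; rewrite ?mulr0 ?mulr1.
Qed.

Theorem qeq_eval2 P Q : has_pchar0 F ->
    (forall d A (B : nat -> 'M[F]_d), trace_compatible A B -> eval2 A B P = eval2 A B Q) ->
  qeq P Q.
Proof.
move=> charF0 PQ m w; pose terms R := [seq t.1 | t <- R & t.2 == w] : seq (F * cmono n).
have coef_terms R : \sum_(t <- terms R | perm_eq t.2 m) t.1 = qcoef R m w.
  by rewrite big_map big_filter_cond; apply: eq_bigl => t; rewrite andbC.
pose L := terms P ++ [seq (- t.1, t.2) | t <- terms Q].
have L0 x : term_eval x L = 0.
  pose A k : 'M[F]_n := \matrix_(i, j) x (k, i, j).
  have xA : x =1 entries A by move=> [[k i] j]; rewrite /entries mxE.
  rewrite (eq_term_eval _ xA) term_eval_cat term_evalN -!eval2_path_entry PQ ?subrr //.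
  exact: trace_compatible_path.
have := coef_eq0_term_eval charF0 L0 m; rewrite big_cat /= [X in _ + X]big_map /= sumrN !coef_terms.
exact: subr0_eq.
Qed.

Lemma perm_trace_words_compatible A d (B : nat -> 'M[F]_d) M (s : 'S_M) (W : 'I_M -> word) :
    trace_compatible A B -> (forall i, W i != [::]) ->
  perm_trace s (fun i => mx_word A (W i)) = perm_trace s (fun i => mx_word B (W i)).
Proof.
move=> cAB; elim: M s W => [|M IH] s W Wn.
  have perm_trace0 c (H : 'I_0 -> 'M[F]_c) : perm_trace s H = 1.
    rewrite /perm_trace (eq_bigr (fun=> 1)) => [|a _]; last by rewrite big_ord0.
    by rewrite sumr_const card_ffun !card_ord expn0.
  by rewrite !perm_trace0.
case: (lift_permP ord0 s) => [r|r i]; first by rewrite !perm_trace_lift cAB ?IH.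
rewrite !perm_trace_cut.
pose W' k := if k == i then W ord0 ++ W (lift ord0 i) else W (lift ord0 k).
have mergeE c (C : nat -> 'M[F]_c) : perm_trace r (fun k => if k == i then
      mx_word C (W ord0) *m mx_word C (W (lift ord0 i)) else mx_word C (W (lift ord0 k))) =
    perm_trace r (fun k => mx_word C (W' k)).
  by apply: eq_perm_trace => k; rewrite /W'; case: eqP => // _; rewrite mx_word_cat.
rewrite !mergeE IH // => k; rewrite /W'; case: (k == i) => //.
by case: (W ord0) (Wn ord0).
Qed.

End Evaluation.

(** * Antisymmetrized products of traces lie in the T-ideal *)

Section TraceOfQn.
Variables (F : fieldType) (n : nat).
Variables (A : nat -> 'M[F]_n) (d : nat) (B : nat -> 'M[F]_d).
Hypothesis cAB : trace_compatible A B.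

Lemma eval2_phi_perm (s : 'S_n.+1) : eval2 A B (phi_perm F s) =
  (\prod_(O in porbits s | ord_max \notin O)
    \tr (mx_word A (cycle_word s (odflt ord_max [pick x in O])))) *:
  mx_word B [seq nat_of_ord y | y <- traject s (s ord_max) #|porbit s ord_max|.-1].
Proof.
rewrite /phi_perm eval2_mul eval2_word -mul_scalar_mx; congr (_ *m _).
rewrite (big_morph (eval2 A B) (eval2_mul A B) (eval2_const A B 1)).
rewrite (big_morph (@scalar_mx F d) (@scalar_mxM F d) (erefl _)).
by apply: eq_bigr => O _; rewrite eval2_tr.
Qed.

Lemma mxtrace_phi_perm (s : 'S_n.+1) (X : 'M[F]_d) : \tr (eval2 A B (phi_perm F s) *m X) =
  perm_trace s (fun i : 'I_n.+1 => if i == ord_max then X else B i).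
Proof.
pose x (O : {set 'I_n.+1}) := if ord_max \in O then s ord_max else odflt ord_max [pick x in O].
have xO O : O \in porbits s -> x O \in O.
  move=> Os; rewrite /x; case: ifP => [h|_].
    by rewrite -(porbits_eq Os h) perm_mem_porbit porbit_id.
  case: pickP => [//|]; case/imsetP: Os => z _ -> /(_ z); by rewrite porbit_id.
rewrite eval2_phi_perm -scalemxAl mxtraceZ (perm_trace_porbits xO).
rewrite [RHS](bigID (fun O : {set 'I_n.+1} => ord_max \notin O)) /=; congr (_ * _).
  apply: eq_bigr => O /andP[Os nO]; rewrite /cycle_word cAB; last first.
    rewrite -size_eq0 size_map size_traject; exact: card_porbit_neq0.
  have -> : odflt ord_max [pick x0 in O] = x O by rewrite /x (negPf nO).
  have xO_orbit := porbits_eq Os (xO O Os).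
  rewrite mx_word_map xO_orbit; congr (\tr _); apply: eq_in_mx_word => i.
  rewrite -[in #|O|]xO_orbit -porbit_traject xO_orbit => iO /=.
  by case: eqP => // e; rewrite -e iO in nO.
rewrite (big_pred1 (porbit s ord_max)) => [|O]; last first.
  rewrite negbK; apply/andP/eqP => [[Os h]|->]; first by rewrite (porbits_eq Os h).
  by rewrite imset_f ?porbit_id.
rewrite /x porbit_id; set k := #|_|.
have k0 : (0 < k)%N by rewrite lt0n card_porbit_neq0.
have nmax : ord_max \notin traject s (s ord_max) k.-1.
  by have := uniq_traject_porbit s ord_max; rewrite -/k -(prednK k0) => /andP[].
have -> : traject s (s ord_max) k = rcons (traject s (s ord_max) k.-1) ord_max.
  by rewrite -{1}(prednK k0) trajectSr -iterSr prednK // iter_porbit.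
rewrite mx_word_rcons eqxx mx_word_map; congr (\tr (_ *m _)); apply: eq_in_mx_word => i il /=.
by case: eqP => // e; rewrite e (negPf nmax) in il.
Qed.

Lemma mxtrace_Qn (X : 'M[F]_d) : \tr (eval2 A B (Qn F n) *m X) = \sum_(s : 'S_n.+1)
  (-1) ^+ odd_perm s * perm_trace s (fun i : 'I_n.+1 => if i == ord_max then X else B i).
Proof.
rewrite /Qn eval2_sum big_enum mulmx_suml raddf_sum; apply: eq_bigr => s _ /=.
by rewrite eval2_scale -scalemxAl mxtraceZ mxtrace_phi_perm.
Qed.

End TraceOfQn.

Section TIdealTraces.
Variables (F : fieldType) (n : nat).
Implicit Types f g : forall d, (nat -> 'M[F]_d) -> 'M[F]_d -> F.

(* An element [P] of the T-ideal is tracked through the linear form [X |-> \tr (P X)],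
   where the words are evaluated at matrices of any size. *)
Definition TQn_trace f := exists P : quasipoly F n, in_TQn P /\
  forall d A (B : nat -> 'M[F]_d) X, trace_compatible A B -> \tr (eval2 A B P *m X) = f d B X.

Lemma TQn_trace_ext f g : TQn_trace f ->
    (forall d (A : nat -> 'M[F]_n) (B : nat -> 'M[F]_d) X,
      trace_compatible A B -> f d B X = g d B X) ->
  TQn_trace g.
Proof.
move=> [P [TP PE]] eq_fg; exists P; split=> // d A B X cAB.
by rewrite PE // (eq_fg d A).
Qed.

Lemma TQn_trace0 : TQn_trace (fun _ _ _ => 0).
Proof.
exists (qzero F n); split=> [|d A B X _]; first exact: TQ_zero.
by rewrite eval2_zero mul0mx mxtrace0.
Qed.

Lemma TQn_traceD f g : TQn_trace f -> TQn_trace g ->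
  TQn_trace (fun d B X => f d B X + g d B X).
Proof.
move=> [P [TP PE]] [Q [TQ QE]]; exists (qadd P Q); split=> [|d A B X cAB].
  exact: TQ_add.
by rewrite eval2_add mulmxDl mxtraceD PE // QE.
Qed.

Lemma TQn_trace_sum (I : Type) (r : seq I)
    (f : I -> forall d, (nat -> 'M[F]_d) -> 'M[F]_d -> F) :
  (forall i, TQn_trace (f i)) -> TQn_trace (fun d B X => \sum_(i <- r) f i d B X).
Proof.
move=> Tf; elim: r => [|i r IH].
  by apply: TQn_trace_ext TQn_trace0 _ => *; rewrite big_nil.
by apply: TQn_trace_ext (TQn_traceD (Tf i) IH) _ => *; rewrite big_cons.
Qed.

Lemma TQn_trace_mulr (c : quasipoly F n) (k : forall d, (nat -> 'M[F]_d) -> F) f :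
    (forall d A (B : nat -> 'M[F]_d), trace_compatible A B -> eval2 A B c = (k d B)%:M) ->
  TQn_trace f -> TQn_trace (fun d B X => k d B * f d B X).
Proof.
move=> cE [P [TP PE]]; exists (qmul (qmul c P) (qone F n)); split; first exact: TQ_mul.
move=> d A B X cAB; rewrite !eval2_mul eval2_const mulmx1 cE // mul_scalar_mx.
by rewrite -scalemxAl mxtraceZ PE.
Qed.

Lemma TQn_traceZ k f : TQn_trace f -> TQn_trace (fun d B X => k * f d B X).
Proof.
by apply: (TQn_trace_mulr (c := qconst n k) (k := fun _ _ => k)) => d A B _; rewrite eval2_const.
Qed.

Lemma TQn_trace_mul_trace w f : w != [::] -> TQn_trace f ->
  TQn_trace (fun d B X => \tr (mx_word B w) * f d B X).
Proof.
move=> nw; apply: (TQn_trace_mulr (c := qtr F n w) (k := fun _ B => \tr (mx_word B w))).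
by move=> d A B cAB; rewrite eval2_tr cAB.
Qed.

Lemma TQn_trace_sandwich u v f : TQn_trace f ->
  TQn_trace (fun d B X => f d B (mx_word B u *m X *m mx_word B v)).
Proof.
move=> [P [TP PE]]; exists (qmul (qmul (qword F n v) P) (qword F n u)); split.
  exact: TQ_mul.
move=> d A B X cAB; rewrite -(PE d A) // !eval2_mul !eval2_word.
by rewrite -!mulmxA mxtrace_mulC !mulmxA.
Qed.

Lemma TQn_trace_Qn_words (W : nat -> word) : (forall k, W k != [::]) ->
  TQn_trace (fun d B X => \sum_(s : 'S_n.+1) (-1) ^+ odd_perm s *
    perm_trace s (fun i : 'I_n.+1 => if i == ord_max then X else mx_word B (W i))).
Proof.
move=> Wn; exists (qsubst (fun k => qword F n (W k)) (Qn F n)); split.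
  exact/TQ_subst/TQ_gen.
move=> d A B X cAB; have flat c (C : nat -> 'M[F]_c) w :
    mx_word (fun k => eval2 A C (qword F n (W k))) w = mx_word C (flatten [seq W k | k <- w]).
  by elim: w => //= k w ->; rewrite eval2_word mx_word_cat.
rewrite eval2_subst mxtrace_Qn => [|w nw].
  by apply: eq_bigr => s _; congr (_ * _); apply: eq_perm_trace => i; rewrite eval2_word.
by rewrite !flat cAB //; case: w nw => //= k w _; case: (W k) (Wn k).
Qed.

End TIdealTraces.

Section Contraction.
Variables (F : fieldType) (n : nat).
Hypothesis charF0 : has_pchar0 F.

Lemma sum_antisymmetrizer_lift M (j : 'I_M.+1) (I : {set 'I_M.+1}) (X : 'S_M.+1 -> F) :
    j \notin I -> \sum_(r | perm_on I r) (-1) ^+ odd_perm r * X r =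
  \sum_(r | perm_on (lift j @^-1: I) r) (-1) ^+ odd_perm r * X (lift_perm j j r).
Proof.
move=> jI; rewrite (sum_perm_on_lift _ jI); apply: eq_bigr => r _.
by rewrite odd_lift_perm addbb.
Qed.

(* Compatibility turns the traces into traces of [n x n] matrices, which have too few
   indices for an antisymmetrizer of [n.+1] points. *)
Lemma antisymmetrized_words_eq0 M (I : {set 'I_M}) t d (A : nat -> 'M[F]_n) (B : nat -> 'M[F]_d)
    (W : 'I_M -> word) : trace_compatible A B -> #|I| = n.+1 -> (forall i, W i != [::]) ->
  \sum_(r | perm_on I r) (-1) ^+ odd_perm r * perm_trace (r * t) (fun i => mx_word B (W i)) = 0.
Proof.
move=> cAB cardI Wn.
under eq_bigr do rewrite -(perm_trace_words_compatible _ cAB Wn).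
rewrite -(sum_antisymmetrizer I t (fun s => perm_trace s _)); under eq_bigr do rewrite mulr_sumr.
rewrite exchange_big big1 // => a _ /=.
rewrite -[RHS](kills_tensors_sum (antisymmetrizer_kills_tensors charF0 t cardI)
  (fun b => \prod_i mx_word A (W i) (a i) (b i)) a).
by apply: eq_bigr => s _; congr (_ * _); apply: eq_bigr => i _; rewrite permfE.
Qed.

Definition special_slot M (i0 : 'I_M) (u v : word) (W : 'I_M -> word) d (B : nat -> 'M[F]_d)
    (X : 'M[F]_d) (i : 'I_M) : 'M[F]_d :=
  if i == i0 then mx_word B u *m X *m mx_word B v else mx_word B (W i).

Definition antisymmetrized_trace M (I : {set 'I_M}) (t : 'S_M) i0 u v W d
    (B : nat -> 'M[F]_d) X : F :=
  \sum_(r | perm_on I r) (-1) ^+ odd_perm r * perm_trace (r * t) (special_slot i0 u v W B X).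

Lemma TQn_trace_antisym_setT (t : 'S_n.+1) i0 u v W : (forall i, i != i0 -> W i != [::]) ->
  TQn_trace n (antisymmetrized_trace setT t i0 u v W).
Proof.
move=> Wn; pose c := tperm i0 ord_max : 'S_n.+1.
pose W' k := if (k < n)%N then W (c (inord k)) else [:: 0%N].
have W'n k : W' k != [::].
  rewrite /W'; case: ltnP => // kn; apply: Wn; rewrite -(tpermR i0 ord_max) (inj_eq perm_inj).
  by rewrite -(inj_eq val_inj) /= inordK ?ltn_eqF // ltnW.
apply: TQn_trace_ext (TQn_traceZ ((-1) ^+ odd_perm t)
  (TQn_trace_sandwich u v (TQn_trace_Qn_words F n W'n))) _ => d _ B X _.
have perm_onT (r : 'S_n.+1) : perm_on setT r by apply/subsetP => i _; rewrite inE.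
rewrite /antisymmetrized_trace [RHS](eq_bigl xpredT) => [|r]; last exact: perm_onT.
rewrite mulr_sumr [RHS](reindex_inj (mulIg t^-1%g)) [RHS](reindex_inj (conjg_inj c)).
apply: eq_bigr => s _ /=; rewrite mulgKV perm_trace_conj odd_permM odd_permV odd_permJ.
rewrite signr_addb mulrA [_ ^+ t * _]mulrC; congr (_ * _); apply: eq_perm_trace => i.
rewrite /special_slot /= -(inj_eq (@perm_inj _ c)) tpermR; case: (eqVneq (c i) i0) => // ni.
have lt_in : (i < n)%N.
  have := ltn_ord i; rewrite ltnS leq_eqVlt => /predU1P[e|//].
  by case/eqP: ni; rewrite (_ : i = ord_max) ?tpermR //; apply: val_inj.
by rewrite /W' lt_in inord_val.
Qed.

Section RemovePoint.
Variables (M : nat) (j : 'I_M.+1) (I : {set 'I_M.+1}) (r : 'S_M) (i0 : 'I_M.+1).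
Variables (u v : word) (W : 'I_M.+1 -> word).
Hypothesis jI : j \notin I.
Variables (d : nat) (B : nat -> 'M[F]_d) (X : 'M[F]_d).
Local Notation H := (special_slot i0 u v W B X).

Lemma antisymmetrized_trace_fix : antisymmetrized_trace I (lift_perm j j r) i0 u v W B X =
  \tr (H j) * \sum_(p | perm_on (lift j @^-1: I) p)
    (-1) ^+ odd_perm p * perm_trace (p * r) (H \o lift j).
Proof.
rewrite /antisymmetrized_trace (sum_antisymmetrizer_lift _ jI) mulr_sumr.
by apply: eq_bigr => p _; rewrite lift_permM perm_trace_lift mulrCA.
Qed.

Lemma antisymmetrized_trace_cut k :
  antisymmetrized_trace I (lift_perm j j r * tperm j (lift j k)) i0 u v W B X =
  \sum_(p | perm_on (lift j @^-1: I) p) (-1) ^+ odd_perm p * perm_trace (p * r)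
    (fun l => if l == k then H j *m H (lift j k) else H (lift j l)).
Proof.
rewrite /antisymmetrized_trace (sum_antisymmetrizer_lift _ jI).
by apply: eq_bigr => p _; rewrite mulgA lift_permM perm_trace_cut.
Qed.

End RemovePoint.

Definition antisym_in_TQn M := forall (I : {set 'I_M}) t i0 u v W, #|I| = n.+1 ->
  (forall i, i != i0 -> W i != [::]) -> TQn_trace n (antisymmetrized_trace I t i0 u v W).

Lemma antisym_in_TQn_outside M (I : {set 'I_M.+1}) t i0 u v W : antisym_in_TQn M ->
    #|I| = n.+1 -> (forall i, i != i0 -> W i != [::]) -> i0 \notin I ->
  TQn_trace n (antisymmetrized_trace I t i0 u v W).
Proof.
move=> IH cardI Wn i0I; have cardI' : #|lift i0 @^-1: I| = n.+1 by rewrite card_preim_lift.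
have Wlift k : W (lift i0 k) != [::] by rewrite Wn // eq_sym neq_lift.
have liftF k : (lift i0 k == i0) = false by rewrite eq_sym (negPf (neq_lift _ _)).
case: (lift_permP i0 t) => [r|r k].
  apply: TQn_trace_ext (TQn_trace0 F n) _ => d A B X cAB.
  rewrite antisymmetrized_trace_fix // [X in _ * X](_ : _ = 0) ?mulr0 //.
  rewrite -[RHS](antisymmetrized_words_eq0 r cAB cardI' Wlift).
  apply: eq_bigr => p _; congr (_ * _); apply: eq_perm_trace => l.
  by rewrite /special_slot /= liftF.
apply: TQn_trace_ext (IH _ r k u (v ++ W (lift i0 k)) (W \o lift i0) cardI'
  (fun l _ => Wlift l)) _ => d A B X _; rewrite antisymmetrized_trace_cut //.
apply: eq_bigr => p _; congr (_ * _); apply: eq_perm_trace => l.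
by rewrite /special_slot /= eqxx !liftF mx_word_cat !mulmxA.
Qed.

Lemma antisym_in_TQn_inside M (I : {set 'I_M.+1}) t i0 u v W j : antisym_in_TQn M ->
    #|I| = n.+1 -> (forall i, i != i0 -> W i != [::]) -> i0 \in I -> j \notin I ->
  TQn_trace n (antisymmetrized_trace I t i0 u v W).
Proof.
move=> IH cardI Wn i0I jI; have cardI' : #|lift j @^-1: I| = n.+1 by rewrite card_preim_lift.
have ji0 : j != i0 by apply: contraNneq jI => ->.
have [k0 i0E] : exists k0, i0 = lift j k0.
  by case: (unliftP j i0) ji0 => [k0 -> _|->]; [exists k0 | rewrite eqxx].
subst i0; have Wj := Wn j ji0.
have Wlift k : k != k0 -> W (lift j k) != [::] by move=> nk; rewrite Wn ?(inj_eq lift_inj).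
case: (lift_permP j t) => [r|r k].
  apply: TQn_trace_ext (TQn_trace_mul_trace Wj (IH _ r k0 u v (W \o lift j) cardI' Wlift)) _.
  move=> d A B X _; rewrite antisymmetrized_trace_fix // /special_slot (negPf ji0).
  congr (_ * _); apply: eq_bigr => p _; congr (_ * _); apply: eq_perm_trace => l.
  by rewrite /= (inj_eq lift_inj).
have [->|nk] := eqVneq k k0.
  apply: TQn_trace_ext (IH _ r k0 (W j ++ u) v (W \o lift j) cardI' Wlift) _ => d A B X _.
  rewrite antisymmetrized_trace_cut //.
  apply: eq_bigr => p _; congr (_ * _); apply: eq_perm_trace => l.
  rewrite /special_slot /= eqxx (negPf ji0) (inj_eq lift_inj) mx_word_cat !mulmxA.
  by case: (l == k0).
pose W' l := if l == k then W j ++ W (lift j k) else W (lift j l).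
have W'n l : l != k0 -> W' l != [::].
  by move=> /Wlift; rewrite /W'; case: (l == k) => // _; case: (W j) Wj.
apply: TQn_trace_ext (IH _ r k0 u v W' cardI' W'n) _ => d A B X _.
rewrite antisymmetrized_trace_cut //.
apply: eq_bigr => p _; congr (_ * _); apply: eq_perm_trace => l.
rewrite /special_slot /= (negPf ji0) !(inj_eq lift_inj) (negPf nk) /W'.
by case: (eqVneq l k) => [->|//]; rewrite (negPf nk) mx_word_cat.
Qed.

(* Induction on the number of points outside [I]: such a point [j] is removed by cutting
   the cycle of [r * t] at [j], where [r * t] agrees with [t]. *)
Theorem TQn_trace_antisym M : antisym_in_TQn M.
Proof.
elim: M => [|M IH] I t i0 u v W cardI Wn; first by case: i0 Wn => -[].
have [i0I|i0I] := boolP (i0 \in I); last exact: antisym_in_TQn_outside.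
have [I_full|[j]] := set_0Vmem (~: I); last first.
  by rewrite inE => jI; apply: antisym_in_TQn_inside jI.
have {}I_full : I = setT by rewrite -[I]setCK I_full setC0.
move: cardI; rewrite I_full cardsT card_ord => -[M_full]; subst M.
exact: TQn_trace_antisym_setT.
Qed.

End Contraction.

(** * Trace identities *)

Section GradedSums.
Variables (F : fieldType) (T : nat -> finType).
Implicit Types p : seq (F * {d & T d}).

Definition graded_coef p d (u : T d) : F := \sum_(t <- p | t.2 == Tagged T u) t.1.

Lemma sum_graded p : exists D, forall G : {d & T d} -> F,
  \sum_(t <- p) t.1 * G t.2 = \sum_(d < D) \sum_(u : T d) graded_coef p u * G (Tagged T u).
Proof.
exists (\max_(t <- p) tag t.2).+1 => G; set D := _.+1.
have ltD t : t \in p -> (tag t.2 < D)%N.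
  by move=> tp; rewrite ltnS; apply: (@leq_bigmax_seq _ p xpredT (fun t => tag t.2)).
under [RHS]eq_bigr do under eq_bigr do rewrite mulr_suml big_mkcond.
under [RHS]eq_bigr do rewrite exchange_big.
rewrite [RHS]exchange_big [LHS]big_seq [RHS]big_seq; apply: eq_bigr => -[x [d0 u0]] /ltD d0D.
rewrite (bigD1 (Ordinal d0D)) //= [X in _ + X]big1 ?addr0 => [|d nd]; last first.
  rewrite big1 // => u _; case: eqP => // -[e _].
  by case/eqP: nd; apply: val_inj.
rewrite (bigD1 u0) //= eqxx big1 ?addr0 // => u nu.
by rewrite eq_Tagged /= eq_sym (negPf nu).
Qed.

End GradedSums.

Lemma sum_expr_eq0 (F : fieldType) (D : nat) (c : nat -> F) : has_pchar0 F ->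
  (forall s, \sum_(d < D) s ^+ d * c d = 0) -> forall d : 'I_D, c d = 0.
Proof.
move=> charF0 c0 d; have : \poly_(l < D) c l = 0 :> {poly F}.
  apply: horner_inj_pchar0 => // s; rewrite horner0 horner_poly -[RHS](c0 s).
  by apply: eq_bigr => l _; rewrite mulrC.
by move/(congr1 (fun g : {poly F} => g`_d)); rewrite coef_poly ltn_ord coef0.
Qed.

Section TracePolynomials.
Variables (F : fieldType) (L : finType).

Definition trace_monomial := {M : nat & ({ffun 'I_M -> L} * 'S_M)%type}.

Definition trace_monomial_eval d (B : L -> 'M[F]_d) (u : trace_monomial) : F :=
  perm_trace (tagged u).2 (fun i => B ((tagged u).1 i)).

Definition trace_poly := seq (F * trace_monomial).

Definition trace_poly_eval d (B : L -> 'M[F]_d) (p : trace_poly) : F :=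
  \sum_(t <- p) t.1 * trace_monomial_eval B t.2.

Lemma eq_trace_poly_eval d (B B' : L -> 'M[F]_d) p : B =1 B' ->
  trace_poly_eval B p = trace_poly_eval B' p.
Proof. by move=> eqB; apply: eq_bigr => t _; congr (_ * _); apply: eq_perm_trace => i. Qed.

Lemma trace_poly_eval_flatten (I : Type) (r : seq I) (p : I -> trace_poly) d (B : L -> 'M[F]_d) :
  trace_poly_eval B (flatten [seq p i | i <- r]) = \sum_(i <- r) trace_poly_eval B (p i).
Proof. by rewrite /trace_poly_eval big_flatten big_map. Qed.

Section TraceForms.
Variable M : nat.
Implicit Types (k : {ffun 'I_M -> L}) (s t : 'S_M) (C : {ffun 'I_M -> L} -> 'S_M -> F).

Definition trace_form C d (B : L -> 'M[F]_d) : F :=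
  \sum_k \sum_s C k s * perm_trace s (fun i => B (k i)).

Lemma trace_formZ C d (B : L -> 'M[F]_d) c :
  trace_form C (fun l => c *: B l) = c ^+ M * trace_form C B.
Proof.
rewrite /trace_form mulr_sumr; apply: eq_bigr => k _; rewrite mulr_sumr; apply: eq_bigr => s _.
rewrite mulrCA; congr (_ * _); rewrite /perm_trace mulr_sumr; apply: eq_bigr => a _.
by under eq_bigr do rewrite mxE; rewrite big_split prodr_const card_ord.
Qed.

Lemma trace_form_poly C : exists p : trace_poly, forall d (B : L -> 'M[F]_d),
  trace_poly_eval B p = trace_form C B.
Proof.
pose monomial (u : {ffun 'I_M -> L} * 'S_M) : trace_monomial := existT _ M u.
exists [seq (C u.1 u.2, monomial u) | u <- enum {: {ffun 'I_M -> L} * 'S_M}] => d B.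
by rewrite /trace_poly_eval big_map big_enum /trace_form pair_bigA.
Qed.

Definition trace_form_coef C n (f : {ffun 'I_M -> L * 'I_n * 'I_n}) : F :=
  let ka := fst_ffun f in
  \sum_s C (fst_ffun ka) s * (snd_ffun f == permf (snd_ffun ka) s)%:R.

Lemma trace_form_coefE C n k (a b : {ffun 'I_M -> 'I_n}) :
  trace_form_coef C (pair_ffun (pair_ffun k a) b) = \sum_s C k s * (b == permf a s)%:R.
Proof. by rewrite /trace_form_coef !fst_pair_ffun !snd_pair_ffun. Qed.

Lemma trace_form_entries C n (B : L -> 'M[F]_n) :
  trace_form C B = form (@trace_form_coef C n) (entries B).
Proof.
rewrite /form sum_pair_ffun sum_pair_ffun; apply: eq_bigr => k _ /=.
under eq_bigr do rewrite mulr_sumr; rewrite exchange_big; apply: eq_bigr => a _.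
under [RHS]eq_bigr do rewrite trace_form_coefE mulr_suml.
rewrite [RHS]exchange_big; apply: eq_bigr => s _ /=.
under [RHS]eq_bigr do rewrite -mulrA; rewrite -mulr_sumr sum_eq_mul; congr (_ * _).
by apply: eq_bigr => i _; rewrite /entries !ffunE.
Qed.

Definition trace_form_sym C k s : F := \sum_(t : 'S_M) C (permf k t) (s ^ t^-1)%g.

Lemma symmetrize_trace_form_coef C n :
  symmetrize (@trace_form_coef C n) =1 @trace_form_coef (trace_form_sym C) n.
Proof.
move=> f; rewrite -[f]pair_ffunK -[fst_ffun f]pair_ffunK; set k := fst_ffun _.
set a := snd_ffun _; set b := snd_ffun _; rewrite trace_form_coefE /symmetrize.
under [RHS]eq_bigr do rewrite mulr_suml.
rewrite [RHS]exchange_big; apply: eq_bigr => t _; rewrite !permf_pair_ffun trace_form_coefE.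
rewrite [RHS](reindex_inj (conjg_inj t)); apply: eq_bigr => s _ /=; rewrite conjgK.
by rewrite -[in RHS](bij_eq (permf_bij _ t)) -!permfM conjgC.
Qed.

Lemma trace_form_symE C d (B : L -> 'M[F]_d) :
  trace_form (trace_form_sym C) B = (M`!)%:R * trace_form C B.
Proof.
rewrite !trace_form_entries -form_symmetrize; apply: eq_bigr => f _.
by rewrite symmetrize_trace_form_coef.
Qed.

Lemma trace_identity_kills_tensors C n : has_pchar0 F ->
    (forall B : L -> 'M[F]_n, trace_form C B = 0) ->
  forall k, kills_tensors n [ffun s => trace_form_sym C k s].
Proof.
move=> charF0 C0 k a b.
have C0' x : form (@trace_form_coef C n) x = 0.
  rewrite -[RHS](C0 (fun l => \matrix_(i, j) x (l, i, j))) trace_form_entries.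
  by apply: eq_form => -[[l i] j]; rewrite /entries mxE.
rewrite -[RHS](symmetrize_eq0 charF0 C0' (pair_ffun (pair_ffun k a) b)).
rewrite symmetrize_trace_form_coef trace_form_coefE.
by apply: eq_bigr => s _; rewrite ffunE.
Qed.

End TraceForms.

Lemma trace_poly_forms (p : trace_poly) : exists D (C : forall M, {ffun 'I_M -> L} -> 'S_M -> F),
  (forall d (B : L -> 'M[F]_d), trace_poly_eval B p = \sum_(M < D) trace_form (C M) B) /\
  forall M k s, C M k s != 0 -> exists2 t, t \in p & t.2 = existT _ M (k, s).
Proof.
have [D pE] := sum_graded (T := fun M => ({ffun 'I_M -> L} * 'S_M)%type) p.
exists D, (fun M k s => graded_coef p (k, s)); split=> [d B|M k s].
  rewrite /trace_poly_eval (pE (trace_monomial_eval B)); apply: eq_bigr => M _.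
  by rewrite /trace_form pair_bigA; apply: eq_bigr => -[k s] _.
have [|/hasPn none] := boolP (has (fun t => t.2 == existT _ M (k, s)) p).
  by case/hasP => t tp /eqP tE _; exists t.
rewrite /graded_coef big_seq_cond big1 ?eqxx // => t /andP[/none/negPf ne].
by move: ne; case: eqP.
Qed.

End TracePolynomials.

Section TraceIdentities.
Variables (F : fieldType) (n N : nat).
Hypothesis charF0 : has_pchar0 F.

(* [None] is the point [n+1] of the cycle notation, where the test matrix [X] sits. *)
Definition slot_eval d (B : nat -> 'M[F]_d) (X : 'M[F]_d) (o : option 'I_N) : 'M[F]_d :=
  oapp (fun l : 'I_N => B l) X o.

Definition linear_slot M (k : {ffun 'I_M -> option 'I_N}) :=
  [exists i0, forall i, (k i == None) == (i == i0)].

Lemma linear_slot_permf M (k : {ffun 'I_M -> option 'I_N}) t :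
  linear_slot (permf k t) -> linear_slot k.
Proof.
case/existsP => i0 /forallP none_i0; apply/existsP; exists (t i0); apply/forallP => i.
have := none_i0 (t^-1%g i); rewrite permfE permKV => /eqP->.
by rewrite -(inj_eq (@perm_inj _ t)) permKV.
Qed.

Lemma TQn_trace_kills_tensors M (k : {ffun 'I_M -> option 'I_N}) c :
    linear_slot k -> kills_tensors n c ->
  TQn_trace n (fun d B X => \sum_s c s * perm_trace s (fun i => slot_eval B X (k i))).
Proof.
case/existsP => i0 /forallP none_i0; move: c; apply: (tensor_kernel charF0).
- by apply: TQn_trace_ext (TQn_trace0 F n) _ => *; rewrite big1 // => s _; rewrite ffunE mul0r.
- move=> c c' Tc Tc'; apply: TQn_trace_ext (TQn_traceD Tc Tc') _ => d A B X _.
  by rewrite -big_split; apply: eq_bigr => s _; rewrite ffunE mulrDl.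
- move=> x c Tc; apply: TQn_trace_ext (TQn_traceZ x Tc) _ => d A B X _.
  by rewrite mulr_sumr; apply: eq_bigr => s _; rewrite ffunE mulrA.
move=> I t cardI; pose W i : word := if k i is Some l then [:: nat_of_ord l] else [::].
have Wn i : i != i0 -> W i != [::].
  by rewrite /W; case: (k i) (none_i0 i) => [//|] /eqP <-.
apply: TQn_trace_ext (TQn_trace_antisym charF0 t [::] [::] cardI Wn) _ => d A B X _.
rewrite sum_antisymmetrizer; apply: eq_bigr => r _; congr (_ * _); apply: eq_perm_trace => i.
rewrite /special_slot /W /slot_eval; have /eqP <- := none_i0 i.
by case: (k i) => [l|] /=; rewrite ?mul1mx mulmx1.
Qed.

Lemma TQn_trace_form M (C : {ffun 'I_M -> option 'I_N} -> 'S_M -> F) :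
    (forall k s, C k s != 0 -> linear_slot k) ->
    (forall B : option 'I_N -> 'M[F]_n, trace_form C B = 0) ->
  TQn_trace n (fun d B X => trace_form C (slot_eval B X)).
Proof.
move=> linC C0; have nz := natr_neq0_pchar0 charF0 (fact_gt0 M).
have T_k k : TQn_trace n (fun d B X =>
    \sum_s trace_form_sym C k s * perm_trace s (fun i => slot_eval B X (k i))).
  have [lin_k|nlin_k] := boolP (linear_slot k).
    have := TQn_trace_kills_tensors lin_k (trace_identity_kills_tensors charF0 C0 k).
    by move/TQn_trace_ext; apply=> d A B X _; apply: eq_bigr => s _; rewrite ffunE.
  apply: TQn_trace_ext (TQn_trace0 F n) _ => d A B X _; rewrite big1 // => s _.
  rewrite /trace_form_sym big1 ?mul0r // => t _.
  by apply/eqP; apply: contraNT nlin_k => /linC/linear_slot_permf.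
have sumT := TQn_trace_sum (enum {ffun 'I_M -> option 'I_N}) T_k.
apply: TQn_trace_ext (TQn_traceZ (M`!)%:R^-1 sumT) _ => d A B X _.
by rewrite big_enum -/(trace_form _ _) trace_form_symE mulKf.
Qed.

Theorem trace_identity_TQn_trace (p : trace_poly F (option 'I_N)) :
    (forall t, t \in p -> linear_slot (tagged t.2).1) ->
    (forall (B : nat -> 'M[F]_n) X, trace_poly_eval (slot_eval B X) p = 0) ->
  TQn_trace n (fun d B X => trace_poly_eval (slot_eval B X) p).
Proof.
move=> lin_p p0; have [D [C [pE Cp]]] := trace_poly_forms p.
have C0 (M : 'I_D) (B : option 'I_N -> 'M[F]_n) : trace_form (C M) B = 0.
  apply: (sum_expr_eq0 (c := fun M => trace_form (C M) B)) => // s.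
  under eq_bigr do rewrite -trace_formZ.
  pose B' l := oapp (fun i : 'I_N => s *: B (Some i)) 0 (insub l).
  rewrite -pE -[RHS](p0 B' (s *: B None)); apply: eq_trace_poly_eval => -[l|] //=.
  by rewrite /slot_eval /B' /= valK.
have linC (M : 'I_D) k s : C M k s != 0 -> linear_slot k.
  by case/Cp => t tp tE; have := lin_p t tp; rewrite tE.
have := TQn_trace_sum (enum 'I_D) (fun M => TQn_trace_form (@linC M) (C0 M)).
by move/TQn_trace_ext; apply=> d A B X _; rewrite pE big_enum.
Qed.

End TraceIdentities.

(** * Invariants of matrices are trace polynomials *)

Section Dilations.
Variables (F : fieldType) (n : nat).

Lemma elem_mx_unit (i j : 'I_n) (s : F) : i != j -> elem_mx i j s \in unitmx.
Proof.
by move=> nij; case: (mulmx1_unit (etrans (elem_mxM s (- s) nij) _)); rewrite ?subrr ?elem_mx0.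
Qed.

Definition dilation (i : 'I_n) (s : F) : 'M[F]_n := elem_mx i i (s - 1).

Lemma dilationM i s r : dilation i s *m dilation i r = dilation i (s * r).
Proof.
rewrite /dilation /elem_mx mulmxDr mulmx1 mulmxDl mul1mx -scalemxAl -scalemxAr mul_delta_mx.
by rewrite scalerA -!addrA -!scalerDl; congr (_ + _ *: _); ring.
Qed.

Lemma dilation1 i : dilation i 1 = 1%:M.
Proof. by rewrite /dilation subrr elem_mx0. Qed.

Lemma dilation_unit i s : s != 0 -> dilation i s \in unitmx.
Proof.
move=> nz; case: (mulmx1_unit (etrans (dilationM i s s^-1) _)) => //.
by rewrite mulfV ?dilation1.
Qed.

End Dilations.

Section FirstFundamentalTheorem.
Variables (F : fieldType) (n : nat) (L : finType).
Local Notation V := (L * 'I_n * 'I_n)%type.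
Implicit Types (B : L -> 'M[F]_n) (g : 'M[F]_n).

Definition conj_family g B (l : L) : 'M[F]_n := g *m B l *m invmx g.

Definition conj_invariant (f : (V -> F) -> F) g :=
  forall B, f (entries (conj_family g B)) = f (entries B).

Definition sandwich_coef g g' (v u : V) : F :=
  (u.1.1 == v.1.1)%:R * (g v.1.2 u.1.2 * g' u.2 v.2).

Lemma entries_sandwich g g' B v :
  entries (fun l => g *m B l *m g') v = \sum_u sandwich_coef g g' v u * entries B u.
Proof.
transitivity (\sum_k \sum_i \sum_j sandwich_coef g g' v (k, i, j) * entries B (k, i, j)).
  rewrite /sandwich_coef /=; under eq_bigr do under eq_bigr do under eq_bigr do rewrite -mulrA.
  under eq_bigr do under eq_bigr do rewrite -mulr_sumr.
  under eq_bigr do rewrite -mulr_sumr.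
  rewrite sum_eq_mul /entries mxE exchange_big; apply: eq_bigr => j _ /=.
  by rewrite mxE mulr_suml; apply: eq_bigr => i _; rewrite mulrAC.
rewrite pair_bigA pair_bigA; by apply: eq_bigr => -[[k i] j].
Qed.

Section Degree.
Variable d : nat.
Implicit Types (T S : {ffun 'I_d -> V} -> F) (k : {ffun 'I_d -> L}).

Definition form_slice S k : 'M[F]_#|{: {ffun 'I_d -> 'I_n}}| :=
  finmx (fun b a => S (pair_ffun (pair_ffun k a) b)).

Lemma form_subst_sandwich S g g' k a b :
  form_subst (sandwich_coef g g') S (pair_ffun (pair_ffun k a) b) =
  finmx_entry (tensor_mx d g' *m form_slice S k *m tensor_mx d g) b a.
Proof.
have coefE k' p q : \prod_j sandwich_coef g g' (pair_ffun (pair_ffun k' p) q j)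
      (pair_ffun (pair_ffun k a) b j) =
    (k' == k)%:R * ((\prod_j g (p j) (a j)) * (\prod_j g' (b j) (q j))).
  rewrite -prodr_eq_nat -!big_split; apply: eq_bigr => j _.
  by rewrite /sandwich_coef !ffunE eq_sym.
rewrite /form_subst sum_pair_ffun sum_pair_ffun.
under eq_bigr do under eq_bigr do under eq_bigr do rewrite coefE mulrCA.
under eq_bigr do under eq_bigr do rewrite -mulr_sumr.
under eq_bigr do rewrite -mulr_sumr.
rewrite sum_eq_mul finmxME; apply: eq_bigr => p _.
rewrite finmxME mulr_suml; apply: eq_bigr => q _; rewrite !finmxE.
by rewrite mulrA mulrC mulrA.
Qed.

Hypothesis charF0 : has_pchar0 F.

Lemma form_slice_comm T g : g \in unitmx -> conj_invariant (form T) g ->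
  forall k, form_slice (symmetrize T) k *m tensor_mx d g =
            tensor_mx d g *m form_slice (symmetrize T) k.
Proof.
move=> Ug inv k.
have inv_sym f : form_subst (sandwich_coef g (invmx g)) (symmetrize T) f = symmetrize T f.
  apply/subr0_eq; rewrite -symmetrize_form_subst /symmetrize -sumrB.
  apply: (symmetrize_eq0 (T := fun f => form_subst (sandwich_coef g (invmx g)) T f - T f)) => // x.
  rewrite formB -form_linear_subst; apply/eqP; rewrite subr_eq0; apply/eqP.
  pose B l : 'M[F]_n := \matrix_(i, j) x (l, i, j).
  have xB : x =1 entries B by move=> [[l i] j]; rewrite /entries mxE.
  rewrite [RHS](eq_form _ xB) -inv; apply: eq_form => v.
  by rewrite entries_sandwich; apply: eq_bigr => u _; rewrite xB.
have sandwich_slice : tensor_mx d (invmx g) *m form_slice (symmetrize T) k *m tensor_mx d g =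
    form_slice (symmetrize T) k.
  by apply: finmxP => b a; rewrite -form_subst_sandwich inv_sym finmxE.
by rewrite -{2}sandwich_slice !mulmxA -tensor_mxM mulmxV // tensor_mx1 mul1mx.
Qed.

Variable T : {ffun 'I_d -> V} -> F.
Hypothesis transvection_inv : forall i j s, i != j -> conj_invariant (form T) (elem_mx i j s).
Hypothesis dilation_inv : forall i s, s != 0 -> conj_invariant (form T) (dilation i (s ^+ n)).

Lemma form_slice_comm_tensor k g : form_slice (symmetrize T) k *m tensor_mx d g =
  tensor_mx d g *m form_slice (symmetrize T) k.
Proof.
move: g; apply: elem_mx_ind.
- by rewrite tensor_mx1 mul1mx mulmx1.
- by move=> g h cg ch; rewrite tensor_mxM mulmxA cg -!mulmxA ch.
- move=> i j s; case: (eqVneq i j) => [<-|nij]; last first.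
    exact: form_slice_comm (elem_mx_unit s nij) (transvection_inv s nij) k.
  apply: (comm_tensor_line (f := fun l => l.+1%:R ^+ n - 1)) => [x y /addIr|l].
    have n_gt0 : (0 < n)%N := leq_ltn_trans (leq0n i) (ltn_ord i).
    rewrite -!natrX => /(natr_inj_pchar0 charF0)/eqP; rewrite eqn_exp2r //.
    by move=> /eqP[].
  have nz : l.+1%:R != 0 :> F by apply: natr_neq0_pchar0.
  exact: form_slice_comm (dilation_unit i (expf_neq0 _ nz)) (dilation_inv i nz) k.
- move=> A B commAB; rewrite -[A]addr0 -(scale0r B).
  apply: (comm_tensor_line (f := fun l => l.+1%:R)) => [x y /(natr_inj_pchar0 charF0)[]//|l].
  by apply: commAB; apply: natr_neq0_pchar0.
Qed.

Lemma invariant_trace_form : exists C : {ffun 'I_d -> L} -> 'S_d -> F,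
  forall B, form T (entries B) = trace_form C B.
Proof.
have [C CE] := fin_all_exists (fun k => schur_weyl charF0 (form_slice_comm_tensor k)).
have nz := natr_neq0_pchar0 charF0 (fact_gt0 d).
exists (fun k s => (d`!)%:R^-1 * C k s) => B; apply: (mulfI nz).
rewrite -form_symmetrize /trace_form; under [in RHS]eq_bigr do under eq_bigr do rewrite -mulrA.
under [in RHS]eq_bigr do rewrite -mulr_sumr.
rewrite -mulr_sumr mulVKf // -/(trace_form C B) trace_form_entries.
apply: eq_bigr => f _; congr (_ * _); rewrite -[f]pair_ffunK -[fst_ffun f]pair_ffunK.
set k := fst_ffun _; set a := snd_ffun _; set b := snd_ffun f; rewrite trace_form_coefE.
have := congr1 (fun X => finmx_entry X b a) (CE k); rewrite finmxE => ->.
rewrite /finmx_entry summxE; apply: eq_bigr => s _.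
by rewrite [LHS]mxE -/(finmx_entry _ _ _) finmxE.
Qed.

End Degree.

Lemma term_eval_forms (W : finType) (p : seq (F * seq W)) :
  exists D (T : forall d, {ffun 'I_d -> W} -> F),
    forall x, term_eval x p = \sum_(d < D) form (T d) x.
Proof.
pose word_ffun (m : seq W) : {d & {ffun 'I_d -> W}} :=
  existT _ (size m) [ffun j => tnth (in_tuple m) j].
have [D pE] := sum_graded (T := fun d => {ffun 'I_d -> W}) [seq (t.1, word_ffun t.2) | t <- p].
exists D, (fun d f => graded_coef [seq (t.1, word_ffun t.2) | t <- p] f) => x.
rewrite /form -(pE (fun u => \prod_j x (tagged u j))) big_map; apply: eq_bigr => t _ /=.
by rewrite big_tnth; congr (_ * _); apply: eq_bigr => j _; rewrite ffunE.
Qed.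

Theorem invariant_trace_polynomial (f : (V -> F) -> F) : has_pchar0 F -> polyfun f ->
    (forall i j s, i != j -> conj_invariant f (elem_mx i j s)) ->
    (forall i s, s != 0 -> conj_invariant f (dilation i (s ^+ n))) ->
  exists p : trace_poly F L, forall B, f (entries B) = trace_poly_eval B p.
Proof.
move=> charF0 pf transvection_inv dilation_inv; have [p fp] := pf.
have [D [T pE]] := term_eval_forms p.
have form_inv g : conj_invariant f g -> forall d : 'I_D, conj_invariant (form (T d)) g.
  move=> inv d B; apply/subr0_eq.
  apply: (sum_expr_eq0 (c := fun d => form (T d) (entries (conj_family g B)) -
    form (T d) (entries B))) => // s.
  under eq_bigr do rewrite mulrBr -!formZ.
  rewrite sumrB -!pE -!fp; apply/eqP; rewrite subr_eq0; apply/eqP.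
  have scale_entries B' : f (fun v => s * entries B' v) = f (entries (fun l => s *: B' l)).
    by apply: polyfun_eq => // v; rewrite /entries mxE.
  rewrite !scale_entries -[RHS]inv; apply: polyfun_eq => // v.
  by rewrite /entries /conj_family -scalemxAr -scalemxAl.
have [C CE] := fin_all_exists (fun d : 'I_D => invariant_trace_form charF0
  (fun i j s nij => form_inv _ (transvection_inv i j s nij) d)
  (fun i s nz => form_inv _ (dilation_inv i s nz) d)).
have [q qE] := fin_all_exists (fun d : 'I_D => trace_form_poly (C d)).
exists (flatten [seq q d | d <- enum 'I_D]) => B.
rewrite trace_poly_eval_flatten big_enum fp pE; apply: eq_bigr => d _.
by rewrite CE qE.
Qed.

End FirstFundamentalTheorem.

(** * Characters of the general linear group *)

Section GLCharacter.
Variables (F : fieldType) (n : nat) (chi : 'M[F]_n -> F).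
Hypothesis chi1 : chi 1%:M = 1.
Hypothesis chiM : {in unitmx &, {morph chi : g h / g *m h >-> g * h}}.

Lemma GL_character_neq0 g : g \in unitmx -> chi g != 0.
Proof.
move=> Ug; apply: contraNneq (oner_neq0 F) => chi0.
by rewrite -chi1 -(mulmxV Ug) chiM ?unitmx_inv // chi0 mul0r.
Qed.

Lemma GL_character_transvection (i j : 'I_n) s : 2%:R != 0 :> F -> i != j ->
  chi (elem_mx i j s) = 1.
Proof.
move=> nz2 nij; pose e := dilation i (2%:R : F).
have Ue : e \in unitmx by apply: dilation_unit.
have Us := elem_mx_unit s nij.
have conj_e : e *m elem_mx i j s = elem_mx i j s *m elem_mx i j s *m e.
  rewrite elem_mxM // /e /dilation /elem_mx (_ : 2%:R - 1 = 1); last by ring.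
  rewrite scale1r.
  rewrite !mulmxDl !mulmxDr !mul1mx !mulmx1 -!scalemxAl -!scalemxAr mul_delta_mx.
  by rewrite mul_delta_mx_0 1?eq_sym // !scaler0 addr0 scalerDl -!addrA [X in 1%:M + X]addrCA.
have /eqP := congr1 chi conj_e; rewrite !chiM ?unitmx_mul ?Us // mulrC.
have nz_s := GL_character_neq0 Us; have nz_e := GL_character_neq0 Ue.
by rewrite (inj_eq (mulIf nz_e)) -{1}[chi _]mulr1 (inj_eq (mulfI nz_s)) eq_sym => /eqP.
Qed.

Lemma GL_character_dilationX (i : 'I_n) s k : s != 0 ->
  chi (dilation i (s ^+ k)) = chi (dilation i s) ^+ k.
Proof.
move=> nz; elim: k => [|k IH]; first by rewrite !expr0 dilation1.
by rewrite !exprS -dilationM chiM ?IH // dilation_unit ?expf_neq0.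
Qed.

Lemma GL_character_dilation (i j : 'I_n) s : s != 0 ->
  chi (dilation i s) = chi (dilation j s).
Proof.
move=> nz; pose w : 'M[F]_n := perm_mx (tperm i j).
have Uw : w \in unitmx by apply: unitmx_perm.
have conj_w : w *m dilation i s = dilation j s *m w.
  rewrite /dilation /elem_mx mulmxDr mulmxDl mulmx1 mul1mx -scalemxAr -scalemxAl.
  congr (_ + _ *: _); rewrite /w -row_permE -[in RHS]tpermV -col_permE.
  by apply/matrixP => p q; rewrite !mxE; congr (_ && _)%:R;
    rewrite -(inj_eq (@perm_inj _ (tperm i j))) ?tpermK ?tpermL ?tpermR.
have := congr1 chi conj_w; rewrite !chiM ?dilation_unit // mulrC => /mulIf; apply.
exact: GL_character_neq0.
Qed.

Lemma diag_mx_dilations (s : F) (r : seq 'I_n) :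
  mx_word (fun i => dilation i s) r = diag_mx (\row_j s ^+ count_mem j r).
Proof.
elim: r => [|i r IH] /=.
  by apply/matrixP => p q; rewrite !mxE expr0.
have -> : dilation i s = diag_mx (\row_j s ^+ (i == j)).
  apply/matrixP => p q; rewrite !mxE; case: (eqVneq p q) => [->|npq]; last first.
    rewrite (_ : (p == i) && (q == i) = false) ?mulr0 ?addr0 //.
    by apply: contraNF npq => /andP[/eqP-> /eqP->].
  rewrite andbb eq_sym; case: eqP => _; rewrite ?mulr1 ?mulr0 ?addr0 //.
  by rewrite addrC subrK.
by rewrite IH mulmx_diag; congr diag_mx; apply/rowP => j; rewrite !mxE exprD.
Qed.

Lemma GL_character_scalar (i : 'I_n) (s : F) : s != 0 -> chi s%:M = chi (dilation i s) ^+ n.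
Proof.
move=> nz; have -> : s%:M = mx_word (fun i => dilation i s) (enum 'I_n).
  rewrite diag_mx_dilations -diag_const_mx; congr diag_mx; apply/rowP => j.
  by rewrite !mxE count_uniq_mem ?enum_uniq // mem_enum.
have [Uw] : mx_word (fun i => dilation i s) (enum 'I_n) \in unitmx /\
    chi (mx_word (fun i => dilation i s) (enum 'I_n)) = chi (dilation i s) ^+ size (enum 'I_n).
  elim: (enum _) => [|j r [Ur IH]] /=; first by rewrite unitmx1.
  rewrite unitmx_mul dilation_unit // Ur chiM ?dilation_unit // IH exprS.
  by rewrite (GL_character_dilation j i).
by rewrite size_enum_ord.
Qed.

End GLCharacter.

(** * Relations between words *)

Section Conjugation.
Variables (F : fieldType) (n N : nat).
Local Notation L := 'I_N.+1.
Local Notation V := (L * 'I_n * 'I_n)%type.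
Implicit Types (x : V -> F) (g h : 'M[F]_n) (f : (V -> F) -> F) (w : word).

Definition matrices x (l : L) : 'M[F]_n := \matrix_(i, j) x (l, i, j).

Lemma entriesK x : entries (matrices x) =1 x.
Proof. by move=> [[l i] j]; rewrite /entries mxE. Qed.

Lemma matricesK (B : L -> 'M[F]_n) : matrices (entries B) =1 B.
Proof. by move=> l; apply/matrixP=> i j; rewrite mxE. Qed.

(* Letters beyond [N] are junk: [inord] sends them to [0]. *)
Definition word_value x w : 'M[F]_n := mx_word (fun l => matrices x (inord l)) w.

Lemma polyfun_word_value w i j : polyfun (fun x => word_value x w i j).
Proof.
elim: w i => [|k w IH] i; first exact: polyfun_const (1%:M i j).
have : polyfun (fun x => \sum_l x (inord k, i, l) * word_value x w l j).
  by apply: polyfun_sum => l; apply: polyfunM; first exact: polyfun_var.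
by apply: polyfun_ext => x; rewrite [RHS]mxE; apply: eq_bigr => l _; rewrite mxE.
Qed.

Definition conj_point g x : V -> F := entries (conj_family g (matrices x)).

Lemma polyfun_conj_point g f : polyfun f -> polyfun (fun x => f (conj_point g x)).
Proof.
apply: polyfun_comp => v.
have : polyfun (fun x => \sum_u sandwich_coef g (invmx g) v u * x u).
  by apply: polyfun_sum => u; apply: polyfunM; [exact: polyfun_const | exact: polyfun_var].
apply: polyfun_ext => x; rewrite /conj_point entries_sandwich.
by apply: eq_bigr => u _; rewrite entriesK.
Qed.

Lemma invmxM g h : g \in unitmx -> h \in unitmx -> invmx (g *m h) = invmx h *m invmx g.
Proof.
move=> Ug Uh; have Ugh : g *m h \in unitmx by rewrite unitmx_mul Ug.
have inv_gh : g *m h *m (invmx h *m invmx g) = 1%:M by rewrite mulmxA mulmxK // mulmxV.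
by rewrite -[RHS](mulKmx Ugh) inv_gh mulmx1.
Qed.

Lemma conj_pointM g h x : g \in unitmx -> h \in unitmx ->
  conj_point g (conj_point h x) =1 conj_point (g *m h) x.
Proof.
move=> Ug Uh v; apply: (congr1 (fun X : 'M_n => X v.1.2 v.2)).
by rewrite /conj_family matricesK /conj_family invmxM // !mulmxA.
Qed.

Lemma conj_point_scalar s x : s != 0 -> conj_point s%:M x =1 x.
Proof.
move=> nz v; rewrite -[RHS]entriesK /conj_point /entries /conj_family.
rewrite invmx_scalar mul_scalar_mx mul_mx_scalar scalerA mulVf //.
by rewrite scale1r.
Qed.

Lemma word_value_conj g x w : g \in unitmx ->
  word_value (conj_point g x) w = g *m word_value x w *m invmx g.
Proof.
move=> Ug; elim: w => [|k w IH] /=; first by rewrite mulmx1 mulmxV.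
by rewrite -/(word_value _ _) IH matricesK /conj_family !mulmxA mulmxKV.
Qed.

End Conjugation.

Section Relations.
Variables (F : fieldType) (n N t : nat).
Local Notation V := ('I_N.+1 * 'I_n * 'I_n)%type.
Implicit Types (x : V -> F) (a b : 'I_t.+1 -> (V -> F) -> F).
Variable M : 'I_t.+1 -> word.

Definition word_relation b := forall x, \sum_i b i x *: word_value x (M i) = 0.

Hypothesis charF0 : has_pchar0 F.
Variable x_indep : V -> F.
Hypothesis indep : forall c : 'I_t -> F,
  \sum_i c i *: word_value x_indep (M (lift ord0 i)) = 0 -> forall i, c i = 0.

Let words_mx x : 'M[F]_(t, n * n) := \matrix_i mxvec (word_value x (M (lift ord0 i))).

Let mul_words_mx (r : 'rV[F]_t) x :
  r *m words_mx x = mxvec (\sum_i r 0 i *: word_value x (M (lift ord0 i))).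
Proof.
by rewrite mulmx_sum_row linear_sum; apply: eq_bigr => i _; rewrite rowK linearZ.
Qed.

(* A minor of [words_mx] which does not vanish at [x_indep] kills [c]. *)
Lemma generic_words_indep (c : 'I_t -> (V -> F) -> F) : (forall i, polyfun (c i)) ->
    (forall x, \sum_i c i x *: word_value x (M (lift ord0 i)) = 0) ->
  forall i x, c i x = 0.
Proof.
move=> pc c0; have free : row_free (words_mx x_indep).
  apply: inj_row_free => r; rewrite mul_words_mx => /(congr1 vec_mx).
  by rewrite mxvecK linear0 => r0; apply/rowP=> i; rewrite mxE; apply: indep.
have [B BE] := row_freeP free; pose minor x := \det (words_mx x *m B).
have pminor : polyfun minor.
  apply: polyfun_sum => s; apply: polyfunM; first exact: polyfun_const.
  apply: polyfun_prod => i; have : polyfun (fun x => \sum_l words_mx x i l * B l (s i)).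
    apply: polyfun_sum => l; apply: polyfunM; last exact: polyfun_const.
    case/mxvec_indexP: l => p q; have := polyfun_word_value F N (M (lift ord0 i)) p q.
    by apply: polyfun_ext => x; rewrite mxE mxvecE.
  by apply: polyfun_ext => x; rewrite mxE.
have minor0 : exists x, minor x != 0 by exists x_indep; rewrite /minor BE det1 oner_neq0.
move=> i; apply: (polyfun_mul_eq0 charF0 pminor (pc i) minor0) => x.
have r0 : (\row_i c i x) *m words_mx x = 0.
  rewrite mul_words_mx (_ : \sum_i _ = 0) ?linear0 // -[RHS](c0 x).
  by apply: eq_bigr => l _; rewrite mxE.
have := congr1 (fun X => X *m B *m \adj (words_mx x *m B)) r0.
rewrite !mul0mx -[_ *m _ *m B]mulmxA -mulmxA mul_mx_adj mul_mx_scalar.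
by move/rowP=> /(_ i); rewrite !mxE.
Qed.

Lemma word_relation_cross a b i x : (forall i, polyfun (a i)) -> (forall i, polyfun (b i)) ->
  word_relation a -> word_relation b -> a ord0 x * b i x = b ord0 x * a i x.
Proof.
move=> pa pb rel_a rel_b; case: (unliftP ord0 i) => [j ->|->]; last by rewrite mulrC.
apply/subr0_eq; move: j x.
apply: (generic_words_indep (c := fun j x => a ord0 x * b (lift ord0 j) x -
  b ord0 x * a (lift ord0 j) x)) => [j|x]; first by apply: polyfunB; apply: polyfunM.
have /eqP := rel_b x; have /eqP := rel_a x; rewrite !big_ord_recl !addr_eq0 => /eqP ea /eqP eb.
under eq_bigr do rewrite scalerBl -!scalerA.
rewrite sumrB -!scaler_sumr -[X in a _ _ *: X]opprK -[X in _ - _ *: X]opprK -ea -eb.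
by rewrite !scalerN !scalerA mulrC subrr.
Qed.

Lemma word_relation_proportional a b : (exists i x, a i x != 0) ->
    (forall i, polyfun (a i)) -> (forall i, polyfun (b i)) ->
    word_relation a -> word_relation b ->
  forall x, proportional (a^~ x) (b^~ x).
Proof.
move=> nz_a pa pb rel_a rel_b.
have nz_a0 : exists x, a ord0 x != 0.
  have [a0|//] := polyfun_eq0_or_neq0 charF0 (pa ord0).
  case: nz_a => i [x /eqP[]]; case: (unliftP ord0 i) => [j ->|->//].
  move: j x; apply: generic_words_indep => [j|x]; first exact: pa.
  by have := rel_a x; rewrite big_ord_recl a0 scale0r add0r.
move=> x i j; apply/subr0_eq; move: x; apply: (polyfun_mul_eq0 charF0 (pa ord0) _ nz_a0).
  by apply: polyfunB; apply: polyfunM.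
move=> x; have cross k := word_relation_cross k x pa pb rel_a rel_b.
by rewrite mulrBr mulrCA cross [a ord0 x * _]mulrCA cross; ring.
Qed.

Lemma word_relation_generator a : (exists i x, a i x != 0) ->
    (forall i, polyfun (a i)) -> word_relation a ->
  exists mu, [/\ forall i, polyfun (mu i), word_relation mu, exists i x, mu i x != 0 &
    forall b, (forall i, polyfun (b i)) -> word_relation b ->
      exists k, polyfun k /\ forall i x, b i x = k x * mu i x].
Proof.
move=> nz_a pa rel_a; have [mu [pmu gen]] := polyfun_rank_one_free charF0 pa nz_a.
have gen_rel b pb rel_b := gen b pb (word_relation_proportional nz_a pa pb rel_a rel_b).
have [h [ph aE]] := gen_rel a pa rel_a.
have [i0 [x0 [nz_h nz_mu]]] : exists i x, h x != 0 /\ mu i x != 0.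
  by case: nz_a => i [x]; rewrite aE mulf_eq0 negb_or => /andP[? ?]; exists i, x.
exists mu; split=> //; last by exists i0, x0.
move=> x; apply/matrixP=> p q; rewrite summxE mxE; move: x.
apply: (polyfun_mul_eq0 charF0 ph); last 2 first.
- by exists x0.
- move=> x; have := congr1 (fun X : 'M_n => X p q) (rel_a x); rewrite summxE [RHS]mxE => rel_pq.
  by rewrite -[RHS]rel_pq mulr_sumr; apply: eq_bigr => i _; rewrite !mxE aE mulrA.
apply: polyfun_sum => i.
have := polyfunM (pmu i) (polyfun_word_value F N (M i) p q).
by apply: polyfun_ext => x; rewrite mxE.
Qed.

Section Invariance.
Variable mu : 'I_t.+1 -> (V -> F) -> F.
Hypothesis pmu : forall i, polyfun (mu i).
Hypothesis mu_rel : word_relation mu.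
Hypothesis mu_gen : forall b, (forall i, polyfun (b i)) -> word_relation b ->
  exists k, polyfun k /\ forall i x, b i x = k x * mu i x.
Variables (i0 : 'I_t.+1) (x0 : V -> F).
Hypothesis nz_mu : mu i0 x0 != 0.

Lemma word_relation_conj g : g \in unitmx -> word_relation (fun i x => mu i (conj_point g x)).
Proof.
move=> Ug x; have := mu_rel (conj_point g x).
under eq_bigr do rewrite word_value_conj //.
move/(congr1 (fun X => invmx g *m X *m g)); rewrite mulmx0 mul0mx mulmx_sumr mulmx_suml => rel_gx.
rewrite -[RHS]rel_gx; apply: eq_bigr => i _; rewrite -scalemxAr -scalemxAl; congr (_ *: _).
by rewrite !mulmxA mulVmx // mul1mx mulmxKV.
Qed.

(* The factor is a unit of the ring of polynomial functions. *)
Lemma generator_semi_invariant g : g \in unitmx ->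
  exists c, forall i x, mu i (conj_point g x) = c * mu i x.
Proof.
move=> Ug.
have factor h : h \in unitmx -> exists k, polyfun k /\
    forall i x, mu i (conj_point h x) = k x * mu i x.
  move=> Uh; apply: mu_gen => [i|]; [exact: polyfun_conj_point | exact: word_relation_conj].
have [k [pk kE]] := factor g Ug.
have [k' [pk' k'E]] := factor (invmx g) (etrans (unitmx_inv _) Ug).
have pk'g : polyfun (fun x => k' (conj_point g x)) by apply: polyfun_conj_point.
have unit_k x : k x * k' (conj_point g x) = 1.
  apply/subr0_eq; move: x; apply: (polyfun_mul_eq0 charF0 (pmu i0)); last 2 first.
  - by exists x0.
  - move=> x; have := k'E i0 (conj_point g x); rewrite kE.
    rewrite (polyfun_eq (y := x) (pmu i0)) => [E|v].
      by rewrite mulrBr mulr1 {2}E; ring.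
    by rewrite conj_pointM ?unitmx_inv // mulVmx // conj_point_scalar ?oner_neq0.
  - by apply: polyfunB; [apply: polyfunM | apply: polyfun_const].
have k_const := polyfun_unit_const charF0 pk pk'g unit_k.
by exists (k x0) => i x; rewrite kE (k_const x x0).
Qed.

Definition generator_character g : F := mu i0 (conj_point g x0) / mu i0 x0.

Lemma generator_characterP g i x : g \in unitmx ->
  mu i (conj_point g x) = generator_character g * mu i x.
Proof.
by move=> /generator_semi_invariant[c cE]; rewrite /generator_character !cE mulfK.
Qed.

Lemma generator_character_scalar s : s != 0 -> generator_character s%:M = 1.
Proof.
move=> nz; rewrite /generator_character (polyfun_eq (y := x0) (pmu i0)) ?mulfV //.
exact: conj_point_scalar.
Qed.

Lemma generator_characterM : {in unitmx &, {morph generator_character : g h / g *m h >-> g * h}}.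
Proof.
move=> g h Ug Uh; apply: (mulIf nz_mu).
rewrite -generator_characterP ?unitmx_mul ?Ug // -mulrA -!generator_characterP //.
by apply: polyfun_eq => // v; rewrite conj_pointM.
Qed.

Lemma generator_conj_invariant i :
  (forall p q s, p != q -> conj_invariant (mu i) (elem_mx p q s)) /\
  (forall p s, s != 0 -> conj_invariant (mu i) (dilation p (s ^+ n))).
Proof.
have chi1 : generator_character 1%:M = 1 by rewrite generator_character_scalar ?oner_neq0.
have conj_entries g B : mu i (entries (conj_family g B)) = mu i (conj_point g (entries B)).
  by apply: polyfun_eq => // v; rewrite /conj_point /entries /conj_family matricesK.
split=> [p q s npq B|p s nz B]; rewrite conj_entries generator_characterP.
- rewrite (GL_character_transvection chi1 generator_characterM) ?mul1r //.
  exact: natr_neq0_pchar0.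
- exact: elem_mx_unit.
- rewrite (GL_character_dilationX chi1 generator_characterM) //.
  by rewrite -(GL_character_scalar chi1 generator_characterM) // generator_character_scalar ?mul1r.
- by rewrite dilation_unit ?expf_neq0.
Qed.

End Invariance.

Theorem word_relation_trace_factor a : (forall i, polyfun (a i)) -> word_relation a ->
  exists (h : (V -> F) -> F) (p : 'I_t.+1 -> trace_poly F 'I_N.+1), polyfun h /\
    forall B : 'I_N.+1 -> 'M[F]_n,
      (forall i, a i (entries B) = h (entries B) * trace_poly_eval B (p i)) /\
      \sum_i trace_poly_eval B (p i) *: mx_word (fun l => B (inord l)) (M i) = 0.
Proof.
move=> pa rel_a; have [a0|nz_a] := polyfun_family_eq0_or_neq0 charF0 pa.
  exists (fun=> 0), (fun=> [::]); split=> [|B]; first exact: polyfun_const.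
  split=> [i|]; first by rewrite a0 mul0r.
  by rewrite big1 // => i _; rewrite /trace_poly_eval big_nil scale0r.
have [mu [pmu rel_mu [i0 [x0 nz_mu]] mu_gen]] := word_relation_generator nz_a pa rel_a.
have [h [ph aE]] := mu_gen a pa rel_a.
have [p pE] : exists p, forall i (B : 'I_N.+1 -> 'M[F]_n),
    mu i (entries B) = trace_poly_eval B (p i).
  apply: (@fin_all_exists _ (fun=> trace_poly F 'I_N.+1)
    (fun i p => forall B, mu i (entries B) = trace_poly_eval B p)) => i.
  have [transvection_inv dilation_inv] := generator_conj_invariant pmu rel_mu mu_gen nz_mu i.
  exact: invariant_trace_polynomial charF0 (pmu i) transvection_inv dilation_inv.
exists h, p; split=> // B; split=> [i|]; first by rewrite aE pE.
rewrite -[RHS](rel_mu (entries B)); apply: eq_bigr => i _; rewrite pE; congr (_ *: _).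
by apply: eq_mx_word => l; rewrite matricesK.
Qed.

End Relations.

(** * Quasi-identities *)

Lemma mxtrace_mul_inj (R : comPzRingType) d (M M' : 'M[R]_d) :
  (forall X : 'M_d, \tr (M *m X) = \tr (M' *m X)) -> M = M'.
Proof.
move=> eqM; apply/matrixP=> i j.
have trE (P : 'M[R]_d) : \tr (P *m delta_mx j i) = P i j.
  rewrite /mxtrace; under eq_bigr do rewrite mulmx_delta_entry.
  by rewrite sum_eq_mul.
by rewrite -!trE.
Qed.

Section TraceRelations.
Variables (F : fieldType) (n N : nat).
Local Notation L := 'I_N.+1.

Lemma linear_slot_insert m (k : {ffun 'I_m -> option L}) :
  (forall i, k i != None) -> linear_slot (insert_ffun ord0 None k).
Proof.
move=> nk; apply/existsP; exists ord0; apply/forallP=> i; apply/eqP.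
case: (unliftP ord0 i) => [j ->|->]; last by rewrite insert_ffun_id eqxx.
by rewrite insert_ffun_lift (negPf (nk j)) eq_sym (negPf (neq_lift _ _)).
Qed.

(* Each letter of [w] is added to the cycle through the point at which [X] sits. *)
Lemma trace_monomial_mul_word (u : trace_monomial L) (w : word) :
  exists u' : trace_monomial (option L), linear_slot (tagged u').1 /\
    forall d (B : nat -> 'M[F]_d) X,
      trace_monomial_eval (fun l : L => B l) u * \tr (mx_word (fun l => B (inord l : L)) w *m X) =
      trace_monomial_eval (slot_eval B X) u'.
Proof.
case: u => m [k s]; elim: w => [|l w [[m' [k' s']] [/= /existsP[i0 /forallP none_i0] IH]]].
  pose k0 := insert_ffun ord0 None [ffun i => Some (k i)].
  exists (existT _ m.+1 (k0, lift_perm ord0 ord0 s)); split=> [|d B X].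
    by apply: linear_slot_insert => i; rewrite ffunE.
  rewrite /trace_monomial_eval /= mul1mx perm_trace_lift insert_ffun_id mulrC; congr (_ * _).
  by apply: eq_perm_trace => i /=; rewrite insert_ffun_lift ffunE.
have slot_i0 i : (k' i == None) = (i == i0) := eqP (none_i0 i).
pose kl := insert_ffun ord0 None [ffun i => if i == i0 then Some (inord l) else k' i].
exists (existT _ m'.+1 (kl, lift_perm ord0 ord0 s' * tperm ord0 (lift ord0 i0))%g).
split=> [|d B X].
  apply: linear_slot_insert => i; rewrite ffunE; case: (eqVneq i i0) => // ni.
  by rewrite slot_i0 ni.
rewrite /= -mulmxA mxtrace_mulC -mulmxA IH /trace_monomial_eval /= perm_trace_cut.
apply: eq_perm_trace => i; rewrite insert_ffun_id !insert_ffun_lift !ffunE eqxx.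
have := slot_i0 i; case: (eqVneq i i0) => [_ /eqP -> //|_].
by case: (k' i).
Qed.

Lemma trace_poly_mul_word (p : trace_poly F L) (w : word) :
  exists q : trace_poly F (option L), (forall t, t \in q -> linear_slot (tagged t.2).1) /\
    forall d (B : nat -> 'M[F]_d) X,
      trace_poly_eval (fun l : L => B l) p * \tr (mx_word (fun l => B (inord l : L)) w *m X) =
      trace_poly_eval (slot_eval B X) q.
Proof.
elim: p => [|[c u] p [q [lin_q qE]]].
  by exists [::]; split=> // d B X; rewrite /trace_poly_eval !big_nil mul0r.
have [u' [lin_u' u'E]] := trace_monomial_mul_word u w.
exists ((c, u') :: q); split=> [t|d B X]; first by rewrite inE => /predU1P[->//|/lin_q].
by rewrite /trace_poly_eval !big_cons /= mulrDl -mulrA u'E qE.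
Qed.

Lemma trace_poly_compatible (p : trace_poly F L) (A : nat -> 'M[F]_n) d (B : nat -> 'M[F]_d) :
    trace_compatible A B ->
  trace_poly_eval (fun l : L => A l) p = trace_poly_eval (fun l : L => B l) p.
Proof.
move=> cAB; apply: eq_bigr => -[c [m [k s]]] _; congr (_ * _); rewrite /trace_monomial_eval /=.
have := perm_trace_words_compatible s (W := fun i => [:: nat_of_ord (k i)]) cAB (fun=> isT).
under [LHS]eq_perm_trace do rewrite /= mulmx1.
by under [in RHS]eq_perm_trace do rewrite /= mulmx1.
Qed.

Hypothesis charF0 : has_pchar0 F.

Theorem trace_relation_in_TQn t (M : 'I_t -> word) (p : 'I_t -> trace_poly F L) :
    (forall B : L -> 'M[F]_n,
      \sum_i trace_poly_eval B (p i) *: mx_word (fun l => B (inord l)) (M i) = 0) ->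
  exists P : quasipoly F n, in_TQn P /\
    forall (A : nat -> 'M[F]_n) d (B : nat -> 'M[F]_d), trace_compatible A B -> eval2 A B P =
      \sum_i trace_poly_eval (fun l : L => A l) (p i) *: mx_word (fun l => B (inord l : L)) (M i).
Proof.
move=> rel.
have [q qP] := fin_all_exists (fun i => trace_poly_mul_word (p i) (M i)).
have slotE d (B : nat -> 'M[F]_d) X : trace_poly_eval (slot_eval B X)
      (flatten [seq q i | i <- enum 'I_t]) =
    \tr ((\sum_i trace_poly_eval (fun l : L => B l) (p i) *:
      mx_word (fun l => B (inord l : L)) (M i)) *m X).
  rewrite trace_poly_eval_flatten big_enum mulmx_suml raddf_sum; apply: eq_bigr => i _.
  by have [_ <-] := qP i; rewrite /= -scalemxAl mxtraceZ.
have lin_q v : v \in flatten [seq q i | i <- enum 'I_t] -> linear_slot (tagged v.2).1.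
  by case/flatten_mapP => i _; have [lin_qi _] := qP i; apply: lin_qi.
have q0 (B : nat -> 'M[F]_n) X :
    trace_poly_eval (slot_eval B X) (flatten [seq q i | i <- enum 'I_t]) = 0.
  by rewrite slotE (rel (fun l : L => B l)) mul0mx mxtrace0.
have [P [TP PE]] := trace_identity_TQn_trace charF0 lin_q q0.
exists P; split=> // A d B cAB; apply: mxtrace_mul_inj => X.
under eq_bigr do rewrite (trace_poly_compatible _ cAB).
by rewrite (PE d A) // slotE.
Qed.

End TraceRelations.

Section Truncation.
Variables (F : fieldType) (n N : nat).
Local Notation L := 'I_N.+1.
Local Notation V := (L * 'I_n * 'I_n)%type.
Implicit Types (P : quasipoly F n) (w : word) (A : nat -> 'M[F]_n).

Definition cvar_indices P : seq nat := [seq v.1.1 | v <- flatten [seq t.1.2 | t <- P]].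

(* As for words, indices beyond [N] are sent to 0. *)
Definition truncate_cvar (v : cvar n) : V := (inord v.1.1, v.1.2, v.2).

Definition coef_value P (x : V -> F) : F :=
  term_eval x [seq (t.1, map truncate_cvar t.2) | t <- [seq t.1 | t <- P]].

Lemma polyfun_coef_value P : polyfun (coef_value P).
Proof. by exists [seq (t.1, map truncate_cvar t.2) | t <- [seq t.1 | t <- P]]. Qed.

Lemma eval2_coef_value A d (B : nat -> 'M[F]_d) P x :
    is_coef P -> {in cvar_indices P, forall k, A k = matrices x (inord k)} ->
  eval2 A B P = (coef_value P x)%:M.
Proof.
move=> Pc AE; rewrite eval2_is_coef // /coef_value term_eval_map; congr (_%:M).
rewrite /term_eval !big_map [LHS]big_seq [RHS]big_seq; apply: eq_bigr => t tP; congr (_ * _).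
rewrite [LHS]big_seq [RHS]big_seq; apply: eq_bigr => v vt.
rewrite /entries AE ?mxE //; apply: map_f; apply/flattenP.
by exists t.1.2 => //; apply: (map_f (fun t => t.1.2)).
Qed.

Lemma polyfun_coef (h : (V -> F) -> F) : polyfun h ->
  exists c : quasipoly F n, forall A d (B : nat -> 'M[F]_d),
    eval2 A B c = (h (entries (fun l : L => A l)))%:M.
Proof.
case=> p hE; pose embed (v : V) : cvar n := (nat_of_ord v.1.1, v.1.2, v.2).
exists [seq (t, [::]) | t <- [seq (t.1, map embed t.2) | t <- p]] => A d B.
rewrite eval2_is_coef; last by apply/allP => _ /mapP[t _ ->].
by rewrite mapK // term_eval_map -hE.
Qed.

Lemma mx_word_inord (B : nat -> 'M[F]_n) w : {in w, forall k, k <= N}%N ->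
  mx_word (fun l => B (inord l : L)) w = mx_word B w.
Proof. by move=> wN; apply: eq_in_mx_word => k /wN kN; rewrite inordK. Qed.

Lemma word_value_entries A w : {in w, forall k, k <= N}%N ->
  word_value (entries (fun l : L => A l)) w = mx_word A w.
Proof.
by move=> wN; apply: eq_in_mx_word => k /wN kN; rewrite matricesK inordK.
Qed.

End Truncation.

Section LinearCombinations.
Variables (F : fieldType) (n t : nat) (lam : 'I_t.+1 -> quasipoly F n) (M : 'I_t.+1 -> word).

Definition qlin_comb := qsum [seq qmul (lam i) (qword F n (M i)) | i <- enum 'I_t.+1].

Lemma eval2_qlin_comb A d (B : nat -> 'M[F]_d) :
  eval2 A B qlin_comb = \sum_i eval2 A B (lam i) *m mx_word B (M i).
Proof.
by rewrite eval2_sum big_enum; apply: eq_bigr => i _; rewrite /= eval2_mul eval2_word.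
Qed.

Lemma letters_bound : exists N,
  forall i, {in cvar_indices (lam i), forall k, k <= N}%N /\ {in M i, forall k, k <= N}%N.
Proof.
exists (\max_i \max_(k <- cvar_indices (lam i) ++ M i) k)%N => i.
have bound k : k \in cvar_indices (lam i) ++ M i ->
    (k <= \max_i \max_(k <- cvar_indices (lam i) ++ M i) k)%N.
  move=> ki; apply: leq_trans (leq_bigmax i).
  exact: (@leq_bigmax_seq _ _ xpredT id).
by split=> k ki; apply: bound; rewrite mem_cat ki ?orbT.
Qed.

Lemma quasi_identity_word_relation N : (forall i, is_coef (lam i)) ->
  quasi_identity qlin_comb -> word_relation (N := N) M (fun i => coef_value (N := N) (lam i)).
Proof.
move=> lamC P_id x; pose A k : 'M[F]_n := matrices x (inord k).
rewrite -[RHS](P_id A) -[RHS]/(eval2 A A qlin_comb) eval2_qlin_comb; apply: eq_bigr => i _.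
by rewrite (eval2_coef_value _ (lamC i) (x := x)) // mul_scalar_mx.
Qed.

End LinearCombinations.

Theorem mainTheorem15 (F : fieldType) (n t : nat)
  (charF0 : [pchar F] =i pred0) (n_gt0 : (0 < n)%N)
  (lam : 'I_t.+1 -> quasipoly F n) (lamC : forall i, is_coef (lam i))
  (M : 'I_t.+1 -> word) :
  quasi_identity (qsum [seq qmul (lam i) (qword F n (M i)) | i <- enum 'I_t.+1]) ->
  locally_lin_indep F n (fun i : 'I_t => M (lift ord0 i)) ->
  in_TQn (qsum [seq qmul (lam i) (qword F n (M i)) | i <- enum 'I_t.+1]).
Proof.
move=> P_id [A0 indep]; have [N bound] := letters_bound lam M.
have indepN (c : 'I_t -> F) : \sum_i c i *:
    word_value (entries (fun l : 'I_N.+1 => A0 l)) (M (lift ord0 i)) = 0 -> forall i, c i = 0.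
  move=> c0; apply: indep; rewrite -[RHS]c0; apply: eq_bigr => i _.
  by rewrite word_value_entries //; apply: (bound _).2.
have [h [p [ph factor]]] := word_relation_trace_factor charF0 indepN
  (fun i => polyfun_coef_value N (lam i)) (quasi_identity_word_relation lamC P_id).
have [c cE] := polyfun_coef ph.
have [P [TP PE]] := trace_relation_in_TQn charF0 (fun B => (factor B).2).
apply: TQ_eq (TQ_mul c (qone F n) TP) _; apply: qeq_eval2 => // d A B cAB.
rewrite !eval2_mul eval2_const mulmx1 cE PE // mul_scalar_mx eval2_qlin_comb scaler_sumr.
apply: eq_bigr => i _; have [lamN MN] := bound i.
rewrite (eval2_coef_value _ (lamC i) (x := entries (fun l : 'I_N.+1 => A l))) // => [|k /lamN kN].
  by rewrite (factor _).1 mul_scalar_mx scalerA mx_word_inord.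
by rewrite matricesK inordK.
Qed.
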